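(* The problem of deciding, given an $\mathcal{L}_{A}^{\Box}$-formula $\varphi$, whether $\varphi$ is $\mathsf{K(A)}$-valid is in coNEXPTIME.
   Context: $\mathcal{L}_{A}^{\Box}$-formulas are built from a countably infinite set $\mathrm{Var}$ of variables with binary $\wedge,\vee,\&,\to$, constant $\overline{0}$, unary $\Box$. A $\mathsf{K(A)}$-model $\langle W,R,V\rangle$: nonempty $W$, $R\subseteq W\times W$, $V\colon\mathrm{Var}\times W\to[-r,r]$ for some real $r\ge0$, extended by $\wedge=\min$, $\vee=\max$, $\&=+$, $V(\varphi\to\psi,x)=V(\psi,x)-V(\varphi,x)$, $V(\overline{0},x)=0$, $V(\Box\varphi,x)=\inf_{\mathbb{R}}\{V(\varphi,y):Rxy\}$ (empty infimum $=0$). $\varphi$ is $\mathsf{K(A)}$-valid if $V(\varphi,x)\ge0$ for all models and all worlds $x$. *)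

(* Defs.v *)
From HB Require Import structures.
From mathcomp Require Import all_boot all_order all_algebra.
From mathcomp Require Import classical_sets reals Rstruct.
From Stdlib Require Import BinNat Rdefinitions.

Set Implicit Arguments.
Unset Strict Implicit.
Unset Printing Implicit Defensive.
Import Order.TTheory GRing.Theory Num.Theory.

Inductive form : Type :=
  | FVar  : nat -> form
  | FAnd  : form -> form -> form
  | FOr   : form -> form -> form
  | FAmp  : form -> form -> form
  | FImp  : form -> form -> form
  | FZero : form
  | FBox  : form -> form.

Local Open Scope ring_scope.
Local Open Scope classical_set_scope.

(* V(phi, x); [inf] of the empty set is 0 in MathComp-Analysis (lemma inf0),
   matching the convention "empty infimum = 0". *)
Fixpoint eval (W : Type) (Rel : W -> W -> Prop) (V : nat -> W -> Rdefinitions.R)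
    (phi : form) (x : W) {struct phi} : Rdefinitions.R :=
  match phi with
  | FVar p => V p x
  | FAnd a b => Num.min (eval Rel V a x) (eval Rel V b x)
  | FOr a b => Num.max (eval Rel V a x) (eval Rel V b x)
  | FAmp a b => eval Rel V a x + eval Rel V b x
  | FImp a b => eval Rel V b x - eval Rel V a x
  | FZero => 0
  | FBox a => inf [set eval Rel V a y | y in [set y | Rel x y]]
  end.

(* A K(A)-model is <W,R,V> with W nonempty and V : Var x W -> [-r, r] for
   some real r >= 0.  phi is K(A)-valid if V(phi,x) >= 0 in every model at
   every world x. (Nonemptiness of W is witnessed by the world x itself.) *)
Definition KA_valid (phi : form) : Prop :=
  forall (W : Type) (Rel : W -> W -> Prop) (V : nat -> W -> Rdefinitions.R) (r : Rdefinitions.R),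
    0 <= r ->
    (forall p x, - r <= V p x <= r) ->
    forall x : W, 0 <= eval Rel V phi x.

Local Close Scope classical_set_scope.
Local Close Scope ring_scope.

Inductive sym : Type :=
  | SVar | SBit0 | SBit1 | SAnd | SOr | SAmp | SImp | SZero | SBox.

Fixpoint pos_bits (p : positive) : seq sym :=
  match p with
  | xH => [:: SBit1]
  | xO q => rcons (pos_bits q) SBit0
  | xI q => rcons (pos_bits q) SBit1
  end.

Definition nat_bits (n : nat) : seq sym :=
  match N.of_nat n with
  | N0 => [:: SBit0]
  | Npos p => pos_bits p
  end.

(* Polish (prefix) notation; variable p_n is written SVar followed by n in
   binary.  This is uniquely readable. *)
Fixpoint enc (phi : form) : seq sym :=
  match phi with
  | FVar n => SVar :: nat_bits n
  | FAnd a b => SAnd :: enc a ++ enc b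
  | FOr a b => SOr :: enc a ++ enc b
  | FAmp a b => SAmp :: enc a ++ enc b
  | FImp a b => SImp :: enc a ++ enc b
  | FZero => [:: SZero]
  | FBox a => SBox :: enc a
  end.

Definition KA_VALID (w : seq sym) : Prop :=
  exists phi, w = enc phi /\ KA_valid phi.

Inductive move : Type := MLeft | MStay | MRight.

Record NTM (Sigma : Type) : Type := {
  tm_state : finType;
  tm_tape  : finType;
  tm_inp   : Sigma -> tm_tape;
  tm_blank : tm_tape;
  tm_start : tm_state;
  tm_acc   : tm_state;
  tm_delta : tm_state -> tm_tape -> seq (tm_state * tm_tape * move)
}.

Section TM.
Variables (Sigma : Type) (M : NTM Sigma).

(* configuration: state, left part of the tape (reversed, nearest cell
   first), scanned symbol, right part of the tape *)
Definition config : Type :=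
  (tm_state M * seq (tm_tape M) * tm_tape M * seq (tm_tape M))%type.

Definition step (c c' : config) : Prop :=
  let: (q, l, a, r) := c in
  exists q2 b m, List.In (q2, b, m) (tm_delta q a) /\
    c' = match m with
         | MStay => (q2, l, b, r)
         | MLeft => (q2, behead l, head (tm_blank M) l, b :: r)
         | MRight => (q2, b :: l, head (tm_blank M) r, behead r)
         end.

Fixpoint reach (n : nat) (c c' : config) : Prop :=
  match n with
  | 0 => c = c'
  | n.+1 => exists c1, step c c1 /\ reach n c1 c'
  end.

Definition init (w : seq Sigma) : config :=
  (tm_start M, [::], head (tm_blank M) (map (tm_inp M) w),
   behead (map (tm_inp M) w)).

Definition accepts (w : seq Sigma) : Prop :=
  exists n c, reach n (init w) c /\ c.1.1.1 = tm_acc M.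

Definition halts_within (t : nat) (w : seq Sigma) : Prop :=
  forall c, reach t (init w) c -> forall c', ~ step c c'.
End TM.

Definition in_NEXPTIME (Sigma : Type) (L : seq Sigma -> Prop) : Prop :=
  exists (M : NTM Sigma) (k : nat),
    (forall w, halts_within M (2 ^ (size w ^ k)) w) /\
    (forall w, accepts M w <-> L w).

Definition in_coNEXPTIME (Sigma : Type) (L : seq Sigma -> Prop) : Prop :=
  in_NEXPTIME (fun w => ~ L w).

(* Main.v *)
From HB Require Import structures.
From mathcomp Require Import all_boot all_order all_fingroup all_algebra zify ring lra.
From mathcomp Require Import classical_sets reals Rstruct boolp.
From Stdlib Require BinNat Nnat.
Require Import Defs.

(** Validity fails iff it fails in a finite tree: a world only needs one
    successor, chosen up to a small error, for each outermost box.  All values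
    occurring in such a tree form a finite set of reals, and a map [h] from
    this set to the integers that preserves order and existing sums turns the
    tree into an integer-valued one.  The conditions on [h] are linear
    inequalities with coefficients in {-1, 0, 1} and the identity solves them,
    so a vertex of the polyhedron they define, computed by Cramer's rule, gives
    an [h] whose values have exponentially many bits.

    A refutation is searched nondeterministically, depth first: at each world
    guess the values of variables and boxes, evaluate the formulas whose values
    the parent constrains, and visit one successor per guessed box.  This is
    written as a recursive program over stacks of symbols.  A one-tape machine
    runs such programs by shuffling all stacks, control stack included, into
    one word: a push extends the word to the left, a pop erases the first
    letter of the right kind.  The input cells carry the digits of a clock that
    every instruction increments, so that all branches halt in exponential
    time. *)

Set Implicit Arguments.
Unset Strict Implicit.
Unset Printing Implicit Defensive.
Import Order.TTheory GRing.Theory Num.Theory.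
Local Open Scope nat_scope.

(** Strict negativity leaves room for error: infima need not be attained, but the value of a formula
    depends on the values of its boxes in a Lipschitz way, so approximate witnesses still refute.
    Keeping 0 among the preserved reals forces the integer map to fix it, which the empty infimum
    needs; the connectives use only order and sums, and for an integer being negative means being at
    most -1, a bound that can be checked. Numbers with exponentially many digits live on stacks and
    are processed digit by digit, in a redundant signed notation in which subtraction needs no case
    analysis on signs. The complement also contains every word that encodes no formula, and as
    acceptance is existential the program has to find a positive witness of malformedness. On inputs
    of length 0 or 1 the time bound is 1 or 2 whatever the positive exponent, so the first two
    transitions of the machine answer these; for longer inputs one clock digit per input cell, in a
    constant base, gives exponential capacity. *)

Section StackMachine.

(** * Nondeterministic stack programs *)

Variables (Sigma : Type) (K L C : finType).

Definition instr : predArgType := (C + K * L)%type.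
HB.instance Definition _ := Finite.on instr.

Variables (rd : C -> option K) (body : C -> option L -> seq (seq instr)).

Definition stacks := {ffun K -> seq L}.

Definition setstk (s : stacks) (k : K) (l : seq L) : stacks :=
  [ffun j => if j == k then l else s j].

(* [cs] is the control stack: an instruction either pushes a letter on a data
   stack or calls a procedure, which pops the stack [rd] designates (seeing
   [None] when it is empty) and is replaced by one of the bodies allowed for
   the popped letter. *)
Inductive run : nat -> seq instr -> stacks -> stacks -> Prop :=
  | run_nil s : run 0 [::] s s
  | run_push t k x cs s s' : run t cs (setstk s k (x :: s k)) s' ->
      run t.+1 (inr (k, x) :: cs) s s'
  | run_call t c b cs s s' : rd c = None -> List.In b (body c None) ->
      run t (b ++ cs) s s' -> run t.+1 (inl c :: cs) s s'
  | run_pop t c k x l b cs (s : stacks) s' : rd c = Some k -> s k = x :: l ->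
      List.In b (body c (Some x)) ->
      run t (b ++ cs) (setstk s k l) s' -> run t.+1 (inl c :: cs) s s'
  | run_empty t c k b cs (s : stacks) s' : rd c = Some k -> s k = [::] ->
      List.In b (body c None) ->
      run t (b ++ cs) s s' -> run t.+1 (inl c :: cs) s s'.

Definition acc_run t cs s := exists s', run t cs s s'.

Lemma acc_nil s : acc_run 0 [::] s.
Proof. by exists s; apply: run_nil. Qed.

Lemma acc_push t k x cs s : acc_run t cs (setstk s k (x :: s k)) ->
  acc_run t.+1 (inr (k, x) :: cs) s.
Proof. by case=> s' h; exists s'; apply: run_push. Qed.

Lemma acc_call t c b cs s : rd c = None -> List.In b (body c None) ->
  acc_run t (b ++ cs) s -> acc_run t.+1 (inl c :: cs) s.
Proof. by move=> h1 h2 [s' h]; exists s'; apply: run_call h1 h2 h. Qed.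

Lemma acc_pop t c k x l b cs (s : stacks) : rd c = Some k -> s k = x :: l ->
  List.In b (body c (Some x)) ->
  acc_run t (b ++ cs) (setstk s k l) -> acc_run t.+1 (inl c :: cs) s.
Proof. by move=> h1 h2 h3 [s' h]; exists s'; apply: run_pop h1 h2 h3 h. Qed.

Lemma acc_empty t c k b cs (s : stacks) : rd c = Some k -> s k = [::] ->
  List.In b (body c None) ->
  acc_run t (b ++ cs) s -> acc_run t.+1 (inl c :: cs) s.
Proof. by move=> h1 h2 h3 [s' h]; exists s'; apply: run_empty h1 h2 h3 h. Qed.

(** One shape for popping and for finding the stack empty: [ohead] and [behead] cover both, because
    replacing an empty stack by itself changes nothing. *)
Lemma run_cons t i cs s s' : run t (i :: cs) s s' -> exists2 t', t = t'.+1 &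
  match i with
  | inr (k, x) => run t' cs (setstk s k (x :: s k)) s'
  | inl c => exists2 b, run t' (b ++ cs)
      (if rd c is Some k then setstk s k (behead (s k)) else s) s' &
      List.In b (body c (if rd c is Some k then ohead (s k) else None))
  end.
Proof.
move=> h; inversion h as [|t1 k x cs1 s1 s2 h1 e1 [e2 e3] e4|t1 c b cs1 s1 s2 hr hb h1 e1 [e2 e3] e4
  |t1 c k x l b cs1 s1 s2 hr hs hb h1 e1 [e2 e3] e4|t1 c k b cs1 s1 s2 hr hs hb h1 e1 [e2 e3] e4];
  exists t1 => //.
- by exists b; rewrite hr.
- by exists b; rewrite hr hs.
- exists b; rewrite hr hs //=.
  by rewrite (_ : setstk s k [::] = s) //; apply/ffunP=> j; rewrite ffunE; case: eqP => // ->.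
Qed.

Lemma acc_run_cons t i cs s : acc_run t (i :: cs) s -> exists2 t', t = t'.+1 &
  match i with
  | inr (k, x) => acc_run t' cs (setstk s k (x :: s k))
  | inl c => exists2 b, acc_run t' (b ++ cs)
      (if rd c is Some k then setstk s k (behead (s k)) else s) &
      List.In b (body c (if rd c is Some k then ohead (s k) else None))
  end.
Proof.
case=> s' /run_cons [t' -> h]; exists t' => //.
by case: i h => [c [b h hb]|[k x] h]; [exists b => //; exists s'|exists s'].
Qed.

(** The induction is on time, not on [cs1], since a call replaces its instruction by a whole
    body. *)
Lemma run_cat t cs1 cs2 s s' : run t (cs1 ++ cs2) s s' ->
  exists t1 t2 s1, [/\ t = t1 + t2, run t1 cs1 s s1 & run t2 cs2 s1 s'].
Proof.
have [n] := ubnP t; elim: n t cs1 s => // n IH t [|i cs1] s ht hr.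
  by exists 0, t, s; split=> //; apply: run_nil.
have [t' e hi] := run_cons hr; subst t.
case: i hr hi => [c|[k x]] hr hi; last first.
  have [|t1 [t2 [s1 [-> h1 h2]]]] := IH _ cs1 _ _ hi; first by lia.
  by exists t1.+1, t2, s1; split=> //; apply: run_push.
case: hi => b; rewrite catA => hi hb.
have [|t1 [t2 [s1 [-> h1 h2]]]] := IH _ _ _ _ hi; first by lia.
exists t1.+1, t2, s1; split=> //; case er: (rd c) hb h1 => [k|] hb h1; last exact: run_call er hb h1.
case es: (s k) hb h1 => [|x l] hb h1; last exact: run_pop er es hb h1.
apply: (run_empty er es hb); move: h1; rewrite (_ : setstk s k _ = s) //.
by apply/ffunP=> j; rewrite ffunE; case: eqP => // ->; rewrite es.
Qed.

Lemma cat_run t1 t2 cs1 cs2 s s1 s' :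
  run t1 cs1 s s1 -> run t2 cs2 s1 s' -> run (t1 + t2) (cs1 ++ cs2) s s'.
Proof.
move=> h; elim: h s' => {t1 cs1 s s1} //= [t k x cs s s1 _ IH|t c b cs s s1 h1 h2 _ IH
  |t c k x l b cs s s1 h1 h2 h3 _ IH|t c k b cs s s1 h1 h2 h3 _ IH] s' h'; rewrite addSn.
- by apply: run_push; apply: IH.
- by apply: run_call h1 h2 _; rewrite catA; apply: IH.
- by apply: run_pop h1 h2 h3 _; rewrite catA; apply: IH.
- by apply: run_empty h1 h2 h3 _; rewrite catA; apply: IH.
Qed.

(** * A one-tape machine for stack programs *)

Variables (m b0 : nat).
Hypothesis body_size : forall c x b, List.In b (body c x) -> size b <= m.
Hypothesis m_gt0 : 0 < m.
(** [sing] is the answer on inputs of one letter, where the time bound leaves no room to run the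
    program. *)
Variables (kin : K) (inp : Sigma -> L) (c0 : C) (sing : L -> bool).

(* A cell may also carry a digit of the clock; only the input cells do. *)
Let base := b0.+1.
Definition letter : predArgType := (instr + K * L)%type.
HB.instance Definition _ := Finite.on letter.
Definition cell : predArgType := (option letter * option 'I_b0.+1)%type.
HB.instance Definition _ := Finite.on cell.

(** One instruction takes one round: [QFetch] searches for the first control letter and erases it,
    [QFound] carries it to the right end, [QTick] increments the clock from there, [QLeft] goes on
    to the left end, [QPop] looks for the data letter to erase, and [QWrite] returns to the left end
    and prepends the new letters. [QStart] and [QOne] only find out whether the input has fewer than
    two letters. *)
Inductive state :=
  | QStart | QOne of bool | QAcc | QFetch | QFound of instr | QTick of instr | QLeft of instr
  | QPop of C | QWrite of m.-bseq letter.

Definition state_code (q : state) :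
    option (option (option (bool + (instr + instr) + (instr + (C + m.-bseq letter))))) :=
  match q with
  | QStart => None
  | QAcc => Some None
  | QFetch => Some (Some None)
  | QOne b => Some (Some (Some (inl (inl b))))
  | QFound i => Some (Some (Some (inl (inr (inl i)))))
  | QTick i => Some (Some (Some (inl (inr (inr i)))))
  | QLeft i => Some (Some (Some (inr (inl i))))
  | QPop c => Some (Some (Some (inr (inr (inl c)))))
  | QWrite l => Some (Some (Some (inr (inr (inr l)))))
  end.
Definition state_decode x : state :=
  match x with
  | None => QStart
  | Some None => QAcc
  | Some (Some None) => QFetch
  | Some (Some (Some (inl (inl b)))) => QOne b
  | Some (Some (Some (inl (inr (inl i))))) => QFound i
  | Some (Some (Some (inl (inr (inr i))))) => QTick i
  | Some (Some (Some (inr (inl i)))) => QLeft i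
  | Some (Some (Some (inr (inr (inl c))))) => QPop c
  | Some (Some (Some (inr (inr (inr l))))) => QWrite l
  end.
Lemma state_codeK : cancel state_code state_decode. Proof. by case. Qed.
HB.instance Definition _ := Finite.copy state (can_type state_codeK).

(** States form a finite type, so only lists of at most [m] letters fit; [insub_bseq] sends a longer
    one to the empty list, which [body_size] and [m_gt0] rule out where it matters. In [wb] the body
    is reversed because each letter is written to the left of the previous one, so that the first
    instruction ends up leftmost. *)
Definition wr (l : seq letter) : state := QWrite (insub_bseq m l).
Definition wb (b : seq instr) : state := wr (rev [seq inl i | i <- b]).

(** [QTick] has no transition on a cell without a digit: this is how a branch dies when the clock
    overflows. [QFetch] meeting the blank has found no control letter, so the program has ended and
    the machine accepts. *)
Definition delta (q : state) (a : option cell) : seq (state * option cell * move) :=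
  match q, a with
  | QStart, None => [:: (QAcc, None, MStay)]
  | QStart, Some x =>
      [:: (QOne (if x.1 is Some (inr (_, y)) then sing y else false), a, MRight)]
  | QOne b, None => if b then [:: (QAcc, None, MStay)] else [::]
  | QOne _, Some _ => [:: (QLeft (inl c0), a, MLeft)]
  | QAcc, _ => [::]
  | QFetch, None => [:: (QAcc, None, MStay)]
  | QFetch, Some (Some (inl i), d) => [:: (QFound i, Some (None, d), MRight)]
  | QFetch, Some _ => [:: (QFetch, a, MRight)]
  | QFound i, None => [:: (QTick i, None, MLeft)]
  | QFound i, Some _ => [:: (QFound i, a, MRight)]
  | QTick i, Some (y, Some d) =>
      if d == ord_max then [:: (QTick i, Some (y, Some ord0), MLeft)]
      else [:: (QLeft i, Some (y, Some (inord d.+1)), MLeft)]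
  | QTick i, _ => [::]
  | QLeft i, Some _ => [:: (QLeft i, a, MLeft)]
  | QLeft (inr d), None => [:: (wr [:: inr d], None, MStay)]
  | QLeft (inl c), None =>
      if rd c is Some _ then [:: (QPop c, None, MRight)]
      else [seq (wb b, None, MStay) | b <- body c None]
  | QPop c, Some (Some (inr (k, x)), d) =>
      if rd c == Some k then [seq (wb b, Some (None, d), MLeft) | b <- body c (Some x)]
      else [:: (QPop c, a, MRight)]
  | QPop c, Some _ => [:: (QPop c, a, MRight)]
  | QPop c, None => [seq (wb b, None, MLeft) | b <- body c None]
  | QWrite l, Some _ => [:: (QWrite l, a, MLeft)]
  | QWrite l, None => if val l is y :: l' then [:: (wr l', Some (Some y, None), MLeft)]
                 else [:: (QFetch, None, MRight)]
  end.

Definition tm : NTM Sigma :=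
  {| tm_state := state; tm_tape := option cell;
     tm_inp := fun a => Some (Some (inr (kin, inp a)), Some ord0);
     tm_blank := None; tm_start := QStart; tm_acc := QAcc; tm_delta := delta |}.

(* Halting *)

Definition isS (a : option cell) : nat := if a is Some _ then 1 else 0.
Definition digit (a : option cell) : option 'I_b0.+1 := if a is Some x then x.2 else None.
Definition hasd (a : option cell) : nat := if digit a is Some _ then 1 else 0.
Definition nd (s : seq (option cell)) : nat := sumn [seq hasd a | a <- s].
(** The value of the clock, most significant digit leftmost; cells without a digit are skipped. *)
Fixpoint cv (s : seq (option cell)) : nat :=
  if s is a :: s' then (if digit a is Some d then d * base ^ nd s' else 0) + cv s' else 0.

Lemma nd_cat s1 s2 : nd (s1 ++ s2) = nd s1 + nd s2.
Proof. by rewrite /nd map_cat sumn_cat. Qed.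

Lemma nd_cons a s : nd (a :: s) = hasd a + nd s. Proof. by []. Qed.

Lemma cv_cat s1 s2 : cv (s1 ++ s2) = cv s1 * base ^ nd s2 + cv s2.
Proof.
elim: s1 => //= a s1 ->; case: (digit a) => [d|] //.
by rewrite nd_cat expnD mulnDl mulnA addnA.
Qed.

Lemma cv_lt s : cv s < base ^ nd s.
Proof.
elim: s => //= a s IH; rewrite nd_cons /hasd; case: (digit a) => [d|] //=.
have := ltn_ord d; rewrite add1n expnS -/base => hd.
by apply: (@leq_trans (d.+1 * base ^ nd s)); [rewrite mulSn addnC ltn_add2r|rewrite leq_mul2r hd orbT].
Qed.

(** A time budget for [k] further ticks on a word of [M] cells: each round is allowed
    [10 * (M + m + 10)] steps and a growth of the word by [m + 5]. *)
Fixpoint psi (k M : nat) : nat :=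
  if k is k'.+1 then 10 * (M + m + 10) + psi k' (M + m + 5) else 0.

Lemma psi_mono k M M' : M <= M' -> psi k M <= psi k M'.
Proof.
elim: k M M' => //= k IH M M' h; apply: leq_add; first by lia.
by apply: IH; lia.
Qed.

Lemma psi_monok k k' M : k <= k' -> psi k M <= psi k' M.
Proof.
elim: k k' M => //= k IH [|k'] M //= h; rewrite leq_add2l; exact: IH.
Qed.

Lemma psi_le k M : psi k M <= k * (10 * (M + k * (m + 5) + m + 10)).
Proof.
elim: k M => //= k IH M; have := IH (M + m + 5); nia.
Qed.

Definition conf := (state * seq (option cell) * option cell * seq (option cell))%type.

Definition move_to (q : state) (l : seq (option cell)) (b : option cell)
    (r : seq (option cell)) (mv : move) : conf :=
  match mv with
  | MStay => (q, l, b, r)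
  | MLeft => (q, behead l, head None l, b :: r)
  | MRight => (q, b :: l, head None r, behead r)
  end.

Lemma stepP (q : state) l a r (c' : conf) :
  step (M := tm) (q, l, a, r) c' <->
  exists q2 b mv, List.In (q2, b, mv) (delta q a) /\ c' = move_to q2 l b r mv.
Proof. by []. Qed.

Section Clock.
Variable n : nat.
Let Bn := base ^ n.

Definition word (c : conf) : seq (option cell) :=
  let: (q, l, a, r) := c in rev l ++ a :: r.

(** The summands pay for the current sweep, for the remaining sweeps of the round, and through [psi]
    for the later rounds. Under [QTick] the clock is read as if the pending carry, of weight
    [base ^ nd r], were already added, so the reading is constant while the carry travels. *)
Definition mu (c : conf) : nat :=
  let: (q, l, a, r) := c in
  let v := cv (word c) in
  let M := size l + size r + isS a in
  let rr := 2 * size r + isS a in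
  let rl := 2 * size l + isS a in
  match q with
  | QStart => rr + 10 + 10 * (M + m + 20) + psi (Bn - v) (M + m + 10)
  | QOne _ => rr + 9 + 10 * (M + m + 15) + psi (Bn - v) (M + m + 10)
  | QAcc => 0
  | QFetch | QFound _ => rr + 1 + psi (Bn - v) M
  | QTick _ => rl + 7 * (M + m + 7) + psi (Bn - (v + base ^ nd r)) (M + m + 4)
  | QLeft _ => rl + 6 * (M + m + 6) + psi (Bn - v) (M + m + 4)
  | QPop _ => rr + 4 * (M + m + 5) + psi (Bn - v) (M + m + 3)
  | QWrite l => rl + size l + 2 * (M + size l + 2) + 2 + psi (Bn - v) (M + size l + 2)
  end.

Lemma size_insub (l : seq letter) : size (insub_bseq m l) <= size l.
Proof. exact: size_insub_bseq. Qed.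

Lemma hasd_le a : hasd a <= isS a.
Proof. by case: a => [[y [d|]]|]. Qed.

Definition keepd (a a' : option cell) := digit a' = digit a.

Lemma cv_keep l a a' r : keepd a a' -> cv (rev l ++ a' :: r) = cv (rev l ++ a :: r).
Proof. by rewrite !cv_cat /= !nd_cons /hasd => ->. Qed.

Lemma nd_keep l a a' r : keepd a a' -> nd (rev l ++ a' :: r) = nd (rev l ++ a :: r).
Proof. by rewrite !nd_cat !nd_cons /hasd => ->. Qed.

Implicit Types (l r : seq (option cell)) (a : option cell).

Lemma word_right l a r :
  rev (a :: l) ++ head None r :: behead r = rev l ++ a :: r ++ nseq (nilp r) None.
Proof. by rewrite rev_cons cat_rcons; case: r => [|b r] //=; rewrite cats0. Qed.

Lemma word_left l a r :
  rev (behead l) ++ head None l :: a :: r = nseq (nilp l) None ++ rev l ++ a :: r.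
Proof. by case: l => [|b l] //=; rewrite rev_cons cat_rcons. Qed.

Lemma cv_right l a r : cv (rev (a :: l) ++ head None r :: behead r) = cv (rev l ++ a :: r).
Proof.
rewrite word_right; case: r => [|b r]; last by rewrite cats0.
by rewrite !cv_cat /= !nd_cons /= addn0.
Qed.

Lemma nd_right l a r : nd (rev (a :: l) ++ head None r :: behead r) = nd (rev l ++ a :: r).
Proof. by rewrite word_right !nd_cat !nd_cons nd_cat; case: (nilp r); rewrite /= ?addn0. Qed.

Lemma cv_left l a r : cv (rev (behead l) ++ head None l :: a :: r) = cv (rev l ++ a :: r).
Proof. by rewrite word_left cv_cat; case: l. Qed.

Lemma nd_left l a r : nd (rev (behead l) ++ head None l :: a :: r) = nd (rev l ++ a :: r).
Proof. by rewrite word_left nd_cat; case: l. Qed.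

Lemma isS_le a : isS a <= 1. Proof. by case: a. Qed.

Lemma head_isS l : 2 * size (behead l) + isS (head None l) <= 2 * size l /\
  size (behead l) + isS (head None l) <= size l /\
  size l <= (size (behead l)).+1.
Proof. by case: l => [|x l] //=; have := isS_le x; lia. Qed.

(** Resetting a maximal digit loses [b0 * base ^ nd r], exactly what the pending carry gains by
    moving up one place. *)
Lemma carry_word l y d r : d = ord_max ->
  cv (rev (behead l) ++ head None l :: Some (y, Some ord0) :: r) +
    base ^ nd (Some (y, Some ord0) :: r) =
  cv (rev l ++ Some (y, Some d) :: r) + base ^ nd r.
Proof.
move=> ->; rewrite cv_left !cv_cat /= !nd_cons /= add1n expnS /base mul0n add0n -!addnA; congr (_ + _); nia.
Qed.

Lemma incr_word l y (d : 'I_b0.+1) r : d != ord_max ->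
  cv (rev (behead l) ++ head None l :: Some (y, Some (inord d.+1)) :: r) =
  cv (rev l ++ Some (y, Some d) :: r) + base ^ nd r.
Proof.
move=> dm; have dlt : d.+1 < b0.+1.
  by move: dm; rewrite -val_eqE /=; have := ltn_ord d; lia.
by rewrite cv_left !cv_cat /= !nd_cons /= inordK // mulSn -!addnA; congr (_ + _); rewrite addnC -addnA [cv r + _]addnC.
Qed.

Lemma psi_lt x y k M M' : M <= M' -> x < y -> x + psi k M < y + psi k M'.
Proof. by move=> h1 h2; have := psi_mono k h1; lia. Qed.

Lemma mu_step (c c' : conf) :
  nd (word c) = n -> step (M := tm) c c' -> nd (word c') = n /\ mu c' < mu c.
Proof.
case: c => [[[q l] a] r]; rewrite [word _]/= => hn /stepP [q2 [b [mv [hin ->]]]].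
have vlt : cv (rev l ++ a :: r) < Bn by rewrite /Bn -hn; apply: cv_lt.
have [hr1 [hr2 hr3]] := head_isS r; have [hl1 [hl2 hl3]] := head_isS l.
have := isS_le (head None r); have := isS_le (head None l) => hil hir.
have right x y : a = Some x -> keepd a (Some y) ->
  let c := rev (Some y :: l) ++ head None r :: behead r in
  nd c = n /\ cv c = cv (rev l ++ a :: r).
  by move=> _ k /=; rewrite nd_right cv_right (nd_keep _ _ k) (cv_keep _ _ k).
have left x : keepd a x ->
  let c := rev (behead l) ++ head None l :: x :: r in
  nd c = n /\ cv c = cv (rev l ++ a :: r).
  by move=> k /=; rewrite nd_left cv_left (nd_keep _ _ k) (cv_keep _ _ k).
have wbs b' : exists2 w, wb b' = QWrite w & size w <= m.
  by exists (insub_bseq m (rev [seq inl i | i <- b'])); rewrite ?size_bseq.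
case: q hin => [|bb||| i|i|i|c|w] hin.
- case: a hn vlt hin right left => [x|] hn vlt /= hin right left; case: hin => // -[<- <- <-].
    have [h1 h2] := right x x erefl erefl.
    by rewrite /move_to /mu /word h1 h2; split=> //; apply: psi_lt => /=; lia.
  by split=> //=; lia.
- case: a hn vlt hin right left => [x|] hn vlt /= hin right left.
    case: hin => // -[<- <- <-]; have [h1 h2] := left (Some x) erefl.
    by rewrite /move_to /mu /word h1 h2; split=> //; apply: psi_lt => /=; lia.
  by case: bb hin => //=; case=> // -[<- <- <-]; split=> //=; lia.
- by [].
- case: a hn vlt hin right left => [[y d]|] hn vlt /= hin right left; last first.
    by case: hin => // -[<- <- <-]; split=> //=; lia.
  have [[i hi]|hi] : (exists i, (q2, b, mv) = (QFound i, Some (None, d), MRight)) \/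
      (q2, b, mv) = (QFetch, Some (y, d), MRight).
    by move: hin; case: y {hn vlt right left} => [[i|k]|] /= [] // <-; [left; exists i | right | right].
    case: hi => -> -> ->; have [h1 h2] := right (y, d) (None, d) erefl erefl.
    by rewrite /move_to /mu /word h1 h2; split=> //; apply: psi_lt => /=; lia.
  case: hi => -> -> ->; have [h1 h2] := right (y, d) (y, d) erefl erefl.
  by rewrite /move_to /mu /word h1 h2; split=> //; apply: psi_lt => /=; lia.
- case: a hn vlt hin right left => [x|] hn vlt /= hin right left; case: hin => // -[<- <- <-].
    have [h1 h2] := right x x erefl erefl.
    by rewrite /move_to /mu /word h1 h2; split=> //; apply: psi_lt => /=; lia.
  have [h1 h2] := left None erefl.
  rewrite /move_to /mu /word h1 h2; split=> //.
  (* The turn at the right end is where a tick is charged: the clock value is below [Bn], so one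
     layer of [psi] can be unfolded to pay for the round. *)
  have -> : Bn - cv (rev l ++ None :: r) = (Bn - (cv (rev l ++ None :: r) + 1)).+1 by lia.
  have hk : Bn - (cv (rev l ++ None :: r) + base ^ nd (None :: r)) <=
      Bn - (cv (rev l ++ None :: r) + 1).
    have : 0 < base ^ nd (None :: r) by rewrite expn_gt0.
    by move: (base ^ nd _) => x; lia.
  have := psi_monok (size (behead l) + size (None :: r) + isS (head None l) + m + 4) hk.
  rewrite [psi _.+1 _]/= addnA => hp.
  by apply: leq_ltn_trans (leq_add (leqnn _) hp) _; apply: psi_lt => /=; lia.
- case: a hn vlt hin right left => [[y [d|]]|] hn vlt //= hin right left.
  move: hin; case: eqP => [dm|/eqP dm] /= [] // [<- <- <-]; rewrite /move_to /mu /word.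
    rewrite (carry_word _ _ _ dm) nd_left; split; first by rewrite -hn !nd_cat !nd_cons.
    by apply: psi_lt => /=; lia.
  rewrite (incr_word _ _ _ dm) nd_left; split; first by rewrite -hn !nd_cat !nd_cons.
  by apply: psi_lt => /=; lia.
- case: a hn vlt hin right left => [x|] hn vlt /= hin right left.
    have [h1 h2] := left (Some x) erefl.
    have [-> -> ->] : (q2, b, mv) = (QLeft i, Some x, MLeft) by case: i hin => i /= [].
    by rewrite /move_to /mu /word h1 h2; split=> //; apply: psi_lt => /=; lia.
  case: i hin => [c|dd].
    case: (rd c) => [k|] /=.
      case=> // -[<- <- <-]; rewrite /move_to /mu /word nd_right cv_right; split=> //.
      by apply: psi_lt => /=; lia.
    case/List.in_map_iff => b' [[<- <- <-] _]; have [w -> hs] := wbs b'.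
    by split=> //; rewrite /move_to /mu /word; apply: psi_lt => /=; lia.
  case=> // -[<- <- <-]; rewrite /wr; have := size_bseq (insub_bseq m [:: inr dd : letter]).
  move: (insub_bseq _ _) => w hs.
  by split=> //; rewrite /move_to /mu /word; apply: psi_lt => /=; lia.
- case: a hn vlt hin right left => [[y d]|] hn vlt /= hin right left; last first.
    case/List.in_map_iff: hin => b' [[<- <- <-] _]; have [h1 h2] := left None erefl.
    have [w -> hs] := wbs b'.
    by rewrite /move_to /mu /word h1 h2; split=> //; apply: psi_lt => /=; lia.
  have [[b' hi]|hi] : (exists b', (q2, b, mv) = (wb b', Some (None, d), MLeft)) \/
      (q2, b, mv) = (QPop c, Some (y, d), MRight).
    move: hin; case: y {hn vlt right left} => [[i|[k x]]|] /=; try by case=> // <-; right.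
    case: eqP => _; last by case=> // <-; right.
    by case/List.in_map_iff=> b' [<- _]; left; exists b'.
    case: hi => -> -> ->; have [w -> hs] := wbs b'.
    have [h1 h2] := left (Some (None, d)) erefl.
    by rewrite /move_to /mu /word h1 h2; split=> //; apply: psi_lt => /=; lia.
  case: hi => -> -> ->; have [h1 h2] := right (y, d) (y, d) erefl erefl.
  by rewrite /move_to /mu /word h1 h2; split=> //; apply: psi_lt => /=; lia.
- case: a hn vlt hin right left => [x|] hn vlt /= hin right left.
    have [h1 h2] := left (Some x) erefl.
    by case: hin => // -[<- <- <-]; rewrite /move_to /mu /word h1 h2; split=> //; apply: psi_lt => /=; lia.
  case: w hin => [[|y w] hw] /=.
    case=> // -[<- <- <-]; rewrite /move_to /mu /word nd_right cv_right; split=> //.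
    by apply: psi_lt => /=; lia.
  case=> // -[<- <- <-]; have [h1 h2] := left (Some (Some y, None)) erefl.
  rewrite /move_to /mu /word h1 h2; split=> //; have := size_insub w => hs.
  by apply: psi_lt => /=; lia.
Qed.

(** * Correctness of the simulation: tape words as shuffled stacks *)

Definition lets (s : seq cell) : seq letter := pmap fst s.
Definition ctl (w : seq letter) : seq instr :=
  pmap (fun y : letter => if y is inl i then Some i else None) w.
Definition ofkind (k : K) (y : letter) : option L :=
  if y is inr (j, x) then (if j == k then Some x else None) else None.
Definition stk (w : seq letter) : stacks := [ffun k => pmap (ofkind k) w].
Definition accw t (w : seq letter) := acc_run t (ctl w) (stk w).

Definition ocell (a : option cell) : seq cell := if a is Some x then [:: x] else [::].
Definition cells (cl : seq cell) (a : option cell) (cr : seq cell) :=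
  rev cl ++ ocell a ++ cr.
(** Letters held in the state, already fetched or not yet written; the abstract word has them in
    front of those on the tape. *)
Definition pend (q : state) : seq letter :=
  match q with
  | QFound i | QTick i | QLeft i => [:: inl i]
  | QPop c => [:: inl (inl c)]
  | QWrite l => rev l
  | _ => [::]
  end.
Definition absw q cl a cr := pend q ++ lets (cells cl a cr).

Definition mk (s : seq cell) i : seq (option cell) := map Some s ++ nseq i None.

(** A blank under the head marks the end of the word towards which the head was walking, so nothing
    lies beyond it. The further conditions for [QFetch] and [QPop] say that no letter of the kind
    searched for has been passed, so that the one found is the top of its stack. [QStart] and [QOne]
    are excluded: the simulation begins after them. *)
Definition wf_walk q (cl : seq cell) (a : option cell) (cr : seq cell) : Prop :=
  match q with
  | QFetch => (a = None -> cr = [::]) /\ ctl (lets cl) = [::]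
  | QFound _ => a = None -> cr = [::]
  | QPop c => (a = None -> cr = [::]) /\
      exists2 k, rd c = Some k & stk (lets cl) k = [::]
  | QTick _ | QLeft _ | QWrite _ => a = None -> cl = [::]
  | QAcc => accw 0 (lets (cells cl a cr))
  | _ => False
  end.

Definition wf (c : conf) q cl a cr :=
  (exists i j, c = (q, mk cl i, a, mk cr j)) /\ wf_walk q cl a cr.

Lemma mkR q cl i x cr j : move_to q (mk cl i) (Some x) (mk cr j) MRight =
  (q, mk (x :: cl) i, ohead cr, mk (behead cr) (j - nilp cr)).
Proof. by case: cr => [|y cr] /=; rewrite ?subn0 //; case: j => //= j; rewrite subn1. Qed.

Lemma mkRb q i cr j : move_to q (mk [::] i) None (mk cr j) MRight =
  (q, mk [::] i.+1, ohead cr, mk (behead cr) (j - nilp cr)).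
Proof. by case: cr => [|y cr] /=; rewrite ?subn0 //; case: j => //= j; rewrite subn1. Qed.

Lemma mkL q cl i x cr j : move_to q (mk cl i) (Some x) (mk cr j) MLeft =
  (q, mk (behead cl) (i - nilp cl), ohead cl, mk (x :: cr) j).
Proof. by case: cl => [|y cl] /=; rewrite ?subn0 //; case: i => //= i; rewrite subn1. Qed.

Lemma mkLb q cl i j : move_to q (mk cl i) None (mk [::] j) MLeft =
  (q, mk (behead cl) (i - nilp cl), ohead cl, mk [::] j.+1).
Proof. by case: cl => [|y cl] /=; rewrite ?subn0 //; case: i => //= i; rewrite subn1. Qed.

Lemma cellsR cl x cr : cells (x :: cl) (ohead cr) (behead cr) = cells cl (Some x) cr.
Proof. by rewrite /cells rev_cons cat_rcons; case: cr. Qed.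

Lemma cellsRb cr : cells [::] (ohead cr) (behead cr) = cells [::] None cr.
Proof. by case: cr. Qed.

Lemma cellsL cl x cr : cells (behead cl) (ohead cl) (x :: cr) = cells cl (Some x) cr.
Proof. by rewrite /cells; case: cl => //= y cl; rewrite rev_cons cat_rcons. Qed.

Lemma cellsLb cl : cells (behead cl) (ohead cl) [::] = cells cl None [::].
Proof. by rewrite /cells; case: cl => //= y cl; rewrite rev_cons cats0 cats1. Qed.

Lemma ohead_nil (s : seq cell) : ohead s = None -> behead s = [::].
Proof. by case: s. Qed.

Lemma ctl_cat w1 w2 : ctl (w1 ++ w2) = ctl w1 ++ ctl w2.
Proof. exact: pmap_cat. Qed.

Lemma stk_cat w1 w2 k : stk (w1 ++ w2) k = stk w1 k ++ stk w2 k.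
Proof. by rewrite !ffunE pmap_cat. Qed.

Lemma lets_cat s1 s2 : lets (s1 ++ s2) = lets s1 ++ lets s2.
Proof. exact: pmap_cat. Qed.

Lemma pmap_rev (A B : Type) (f : A -> option B) s : pmap f (rev s) = rev (pmap f s).
Proof.
elim: s => //= x s IH; rewrite rev_cons -cats1 pmap_cat IH /=.
by case: (f x) => [y|] /=; rewrite ?rev_cons -?cats1 ?cats0.
Qed.

Lemma ctl_rev w : ctl (rev w) = rev (ctl w). Proof. exact: pmap_rev. Qed.
Lemma lets_rev w : lets (rev w) = rev (lets w). Proof. exact: pmap_rev. Qed.
Lemma stk_rev w k : stk (rev w) k = rev (stk w k). Proof. by rewrite !ffunE pmap_rev. Qed.

Lemma ctl_inl (b : seq instr) : ctl [seq inl i | i <- b] = b.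
Proof. by elim: b => //= i b ->. Qed.

Lemma stk_inl (b : seq instr) w : stk ([seq inl i | i <- b] ++ w) = stk w.
Proof. by apply/ffunP=> k; rewrite !ffunE; elim: b => //=. Qed.

Lemma stk_cons_inl i w : stk (inl i :: w) = stk w.
Proof. by apply/ffunP=> k; rewrite !ffunE. Qed.

Lemma stk_cons_inr k x w : stk (inr (k, x) :: w) = setstk (stk w) k (x :: stk w k).
Proof. by apply/ffunP=> j; rewrite !ffunE /= eq_sym; case: eqP => [->|] /=. Qed.

Lemma val_insub (l : seq letter) : size l <= m -> insub_bseq m l = l :> seq letter.
Proof. by move=> h; rewrite /insub_bseq /insubd insubT. Qed.

Lemma pend_wb c x b : List.In b (body c x) -> pend (wb b) = [seq inl i | i <- b].
Proof.
move=> /body_size h; rewrite /wb /wr /= val_insub ?revK //.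
by rewrite size_rev size_map.
Qed.

Lemma accw_eq t w w' : ctl w = ctl w' -> stk w = stk w' -> accw t w -> accw t w'.
Proof. by rewrite /accw => -> ->. Qed.

(* the hole left by a popped letter *)
Lemma pop_word cl k x d cr : stk (lets cl) k = [::] ->
  let w := lets (cells cl (Some (Some (inr (k, x)), d)) cr) in
  let w' := lets (cells cl (Some (None, d)) cr) in
  stk w k = x :: stk w' k /\ ctl w = ctl w' /\ setstk (stk w) k (stk w' k) = stk w'.
Proof.
move=> h /=; rewrite /cells !lets_cat !ctl_cat /=; split; last split=> //.
  by rewrite !stk_cat lets_rev stk_rev h !ffunE /= eqxx.
apply/ffunP=> j; rewrite ffunE; case: eqP => // jk; first by rewrite jk.
rewrite !stk_cat; congr (_ ++ _); rewrite !ffunE /=.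
by case: eqP => // kj; case: jk.
Qed.

(** Runs are carried backwards, from the new configuration to the old one: soundness recovers a run
    of the program from an accepting computation and need not track its length. *)
Definition simulates (c' : conf) q cl a cr :=
  exists q' cl' a' cr', wf c' q' cl' a' cr' /\
    (forall t, accw t (absw q' cl' a' cr') -> exists t', accw t' (absw q cl a cr)).

Lemma wf_sound (c c' : conf) q cl a cr :
  wf c q cl a cr -> step (M := tm) c c' -> simulates c' q cl a cr.
Proof.
case=> [[i [j ->]] hw] /stepP [q2 [b [mv [hin ->]]]].
(* One helper per head move: right or left from a cell, staying on a blank, and right or left from a
   blank. *)
have stepR q' x y : a = Some x -> (q2, b, mv) = (q', Some y, MRight) ->
    wf_walk q' (y :: cl) (ohead cr) (behead cr) ->
    (forall t, accw t (absw q' cl (Some y) cr) -> exists t', accw t' (absw q cl a cr)) ->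
    simulates (move_to q2 (mk cl i) b (mk cr j) mv) q cl a cr.
  move=> _ [-> -> ->] h1 h2; rewrite mkR; exists q', (y :: cl), (ohead cr), (behead cr); split.
    by split=> //; exists i, (j - nilp cr).
  by rewrite /absw cellsR.
have stepL q' y : (q2, b, mv) = (q', Some y, MLeft) ->
    wf_walk q' (behead cl) (ohead cl) (y :: cr) ->
    (forall t, accw t (absw q' cl (Some y) cr) -> exists t', accw t' (absw q cl a cr)) ->
    simulates (move_to q2 (mk cl i) b (mk cr j) mv) q cl a cr.
  move=> [-> -> ->] h1 h2; rewrite mkL; exists q', (behead cl), (ohead cl), (y :: cr); split.
    by split=> //; exists (i - nilp cl), j.
  by rewrite /absw cellsL.
have stepS q' : a = None -> (q2, b, mv) = (q', None, MStay) ->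
    wf_walk q' cl None cr ->
    (forall t, accw t (absw q' cl None cr) -> exists t', accw t' (absw q cl a cr)) ->
    simulates (move_to q2 (mk cl i) b (mk cr j) mv) q cl a cr.
  move=> _ [-> -> ->] h1 h2; exists q', cl, None, cr; split=> //.
  by split=> //; exists i, j.
have stepRb q' : a = None -> cl = [::] -> (q2, b, mv) = (q', None, MRight) ->
    wf_walk q' [::] (ohead cr) (behead cr) ->
    (forall t, accw t (absw q' [::] None cr) -> exists t', accw t' (absw q cl a cr)) ->
    simulates (move_to q2 (mk cl i) b (mk cr j) mv) q cl a cr.
  move=> _ -> [-> -> ->] h1 h2; rewrite mkRb; exists q', [::], (ohead cr), (behead cr); split.
    by split=> //; exists i.+1, (j - nilp cr).
  by rewrite /absw cellsRb.
have stepLb q' : a = None -> cr = [::] -> (q2, b, mv) = (q', None, MLeft) ->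
    wf_walk q' (behead cl) (ohead cl) [::] ->
    (forall t, accw t (absw q' cl None [::]) -> exists t', accw t' (absw q cl a cr)) ->
    simulates (move_to q2 (mk cl i) b (mk cr j) mv) q cl a cr.
  move=> _ -> [-> -> ->] h1 h2; rewrite mkLb; exists q', (behead cl), (ohead cl), [::]; split.
    by split=> //; exists (i - nilp cl), j.+1.
  by rewrite /absw cellsLb.
have nilP := ohead_nil.
case: q hw hin stepR stepL stepS stepRb stepLb => [|bb||| ii|ii|ii|c1|w] //.
- case: a => [[y d]|] /= [h1 h2] hin stepR stepL stepS stepRb stepLb; last first.
    case: hin => // hin; apply: (stepS _ erefl (esym hin)); last by move=> t; exists t.
    rewrite h1 // /wf_walk /accw; move: (h2) => h3.
    rewrite /cells /= cats0 lets_rev ctl_rev h2; exact: acc_nil.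
  case: y hin h1 stepR stepL stepS stepRb stepLb => [[ii|y]|] /= [] // hin h1 stepR stepL stepS stepRb stepLb; have {stepR} stepR := stepR _ _ _ erefl (esym hin).
  + apply: stepR => [|t ha]; first exact: nilP.
     exists t; move: ha; rewrite /absw /=; apply: accw_eq.
      by rewrite /cells !lets_cat /= !ctl_cat lets_rev ctl_rev h2.
    by rewrite stk_cons_inl; apply/ffunP=> k; rewrite /cells !lets_cat !stk_cat !ffunE.
  + by apply: stepR => [|t h]; [split=> //; exact: nilP | exists t].
  + by apply: stepR => [|t h]; [split=> //; exact: nilP | exists t].
- case: a => [x|] /= h1 hin stepR stepL stepS stepRb stepLb; case: hin => // hin.
    by apply: (stepR _ _ _ erefl (esym hin)) => [|t h]; [exact: nilP | exists t].
  move: (h1 erefl) stepLb => -> stepLb.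
  by apply: (stepLb _ erefl erefl (esym hin)) => [|t h]; [exact: nilP | exists t].
- case: a => [[y [d|]]|] //= h1 hin stepR stepL stepS stepRb stepLb.
  have hl e : lets (cells cl (Some (y, e)) cr) = lets (cells cl (Some (y, Some d)) cr).
    by rewrite /cells !lets_cat.
  by move: hin; case: eqP => _ /= [] // hin; apply: (stepL _ _ (esym hin)) => [|t];
    [exact: nilP | rewrite /absw hl; exists t | exact: nilP | rewrite /absw hl; exists t].
- case: a => [x|] h1 hin stepR stepL stepS stepRb stepLb.
    have e : (q2, b, mv) = (QLeft ii, Some x, MLeft) by move: hin; clear; case: ii => ii /= [].
    by apply: (stepL _ _ e) => [|t h]; [exact: nilP | exists t].
  move: (h1 erefl) stepS stepRb => {stepR stepL stepLb h1} -> stepS stepRb.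
  case: ii hin stepS stepRb => [c1|[k x]] /= hin stepS stepRb; last first.
    case: hin => // hin; apply: (stepS _ erefl (esym hin)) => // t.
    rewrite /absw /= val_insub //= => ha; exists t.+1; rewrite /accw /=.
    by apply: acc_push; move: ha; rewrite /accw /= stk_cons_inr !stk_cons_inl.
  case hr: (rd c1) hin => [k|] /= hin.
    case: hin => // hin; apply: (stepRb _ erefl erefl (esym hin)) => [|t h]; last by exists t.
    by split; [exact: nilP | exists k => //; rewrite ffunE].
  case/List.in_map_iff: hin => b' [hin hb].
  apply: (stepS _ erefl (esym hin)) => // t; rewrite /absw (pend_wb hb) => ha.
  exists t.+1; rewrite /accw /= stk_cons_inl; apply: acc_call hr hb _.
  by move: ha; rewrite /accw stk_inl ctl_cat ctl_inl.
- case: a => [[y d]|] /= [h1 [k hr hk]] hin stepR stepL stepS stepRb stepLb; last first.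
    case/List.in_map_iff: hin => b' [hin hb].
    move: (h1 erefl) stepLb => {stepR stepL stepS stepRb} -> stepLb.
    apply: (stepLb _ erefl erefl (esym hin)) => [|t]; first exact: nilP.
    rewrite /absw (pend_wb hb) => ha; exists t.+1; rewrite /accw /= stk_cons_inl.
    apply: acc_empty hr _ hb _; last by move: ha; rewrite /accw stk_inl ctl_cat ctl_inl.
    by rewrite /cells [ocell _ ++ _]/= cats0 lets_rev stk_rev hk.
  have [[x [b' [hy hb hin']]]|hin'] : (exists x b', [/\ y = Some (inr (k, x)),
      List.In b' (body c1 (Some x)) & (q2, b, mv) = (wb b', Some (None, d), MLeft)]) \/
      ((q2, b, mv) = (QPop c1, Some (y, d), MRight) /\ ofkind k (odflt (inl (inl c1)) y) = None).
    move: hin; case: y {h1 stepR stepL stepS stepRb stepLb} => [[ii|[k' x]]|] /=; try by case=> // <-; right.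
    rewrite hr; case: eqP => [[<-]|ne]; last first.
      by case=> // <-; right; split=> //; case: eqP => // e; case: ne; rewrite e.
    by case/List.in_map_iff=> b' [<- hb]; left; exists x, b'.
    subst y; have /= [e1 [e2 e3]] := pop_word x d cr hk.
    apply: (stepL _ _ hin') => [|t]; first exact: nilP.
    rewrite /absw (pend_wb hb) => ha; exists t.+1; rewrite /accw /= stk_cons_inl.
    apply: (acc_pop hr e1 hb); rewrite e3 e2.
    by move: ha; rewrite /accw stk_inl ctl_cat ctl_inl.
  case: hin' => hin' hy; apply: (stepR _ _ _ erefl hin') => [|t ha]; last by exists t.
  split; first exact: nilP.
  exists k => //; case: y hy {h1 hin stepR stepL stepS stepRb stepLb hin'} => [y|] //= hy.
  by move: hk; rewrite !ffunE /= hy.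
- case: a => [x|] /= h1 hin stepR stepL stepS stepRb stepLb.
    by case: hin => // hin; apply: (stepL _ _ (esym hin)) => [|t h]; [exact: nilP | exists t].
  move: (h1 erefl) stepL stepRb => {stepR stepLb stepS h1} -> stepL stepRb.
  case: w hin stepL stepRb => [[|y w] hs] /= hin stepL stepRb; case: hin => // hin.
    by apply: (stepRb _ erefl erefl (esym hin)) => [|t h]; [split=> //; exact: nilP | exists t].
  apply: (stepL _ _ (esym hin)) => // t; rewrite /absw /= val_insub; last exact: ltnW.
  by rewrite /cells /= rev_cons cat_rcons => ha; exists t.
Qed.

Definition marks (s : seq cell) : seq bool := [seq isSome x.2 | x <- s].
(** The digits occupy the [n] rightmost cells: the word grows only on the left, by cells without
    digits. *)
Definition dpat (s : seq cell) : Prop := exists p, marks s = nseq p false ++ nseq n true.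

(** The clock has room for the [t] instructions still to be run. The inequality is weak between the
    tick and the execution of an instruction, because the current one is counted both in the clock
    and in [t]. *)
Definition clock (c : conf) (t : nat) : Prop :=
  let: (q, l, a, r) := c in
  let v := cv (word c) in
  match q with
  | QFetch | QFound _ | QWrite _ => v + t < Bn
  | QTick _ => v + base ^ nd r + t <= Bn
  | QLeft _ | QPop _ => v + t <= Bn
  | _ => True
  end.

Definition advances (c : conf) :=
  exists c' q cl a cr t, [/\ step (M := tm) c c', wf c' q cl a cr,
    dpat (cells cl a cr), accw t (absw q cl a cr) & clock c' t].

Lemma dpat_last s1 s2 p : s1 ++ false :: s2 = nseq p false ++ nseq n true ->
  n <= count id s2.
Proof.
move=> e.
have lt : size s1 < p.
  have := congr1 (nth true ^~ (size s1)) e; rewrite nth_cat ltnn subnn /=.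
  rewrite nth_cat size_nseq nth_nseq nth_nseq; case: ltnP => // _.
  by case: (_ < _).
have s1E : count id s1 = 0.
  have := congr1 (take (size s1)) e; rewrite take_size_cat // take_cat size_nseq lt => ->.
  by rewrite (take_nseq _ (ltnW lt)) count_nseq.
have := congr1 (count id) e; rewrite !count_cat !count_nseq /= s1E; lia.
Qed.

Lemma nd_mk s j : nd (mk s j) = count id (marks s).
Proof.
rewrite /mk nd_cat; have -> : nd (nseq j None) = 0 by elim: j.
by rewrite addn0 /marks; elim: s => //= -[y [d|]] s IH; rewrite nd_cons IH.
Qed.

Lemma accw_inl t i w : accw t (inl i :: w) -> exists2 t', t = t'.+1 &
  match i with
  | inr (k, x) => acc_run t' (ctl w) (setstk (stk w) k (x :: stk w k))
  | inl c => exists2 b, acc_run t' (b ++ ctl w)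
      (if rd c is Some k then setstk (stk w) k (behead (stk w k)) else stk w) &
      List.In b (body c (if rd c is Some k then ohead (stk w k) else None))
  end.
Proof. by move=> /acc_run_cons; rewrite stk_cons_inl. Qed.

Lemma cv_move q l a b r mv : keepd a b ->
  cv (word (move_to q l b r mv)) = cv (rev l ++ a :: r).
Proof. by move=> k; case: mv; rewrite /= ?cv_right ?cv_left (cv_keep _ _ k). Qed.

Lemma wf_complete (c : conf) q cl a cr t :
  wf c q cl a cr -> dpat (cells cl a cr) -> q <> QAcc ->
  accw t (absw q cl a cr) -> clock c t -> advances c.
Proof.
case=> [[i [j ->]] hw] hd hq ha hc.
have advR q' x y t' : a = Some x -> List.In (q', Some y, MRight) (delta q a) ->
    isSome y.2 = isSome x.2 -> wf_walk q' (y :: cl) (ohead cr) (behead cr) ->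
    accw t' (absw q' cl (Some y) cr) ->
    clock (move_to q' (mk cl i) (Some y) (mk cr j) MRight) t' ->
    advances (q, mk cl i, a, mk cr j).
  move=> e hin hs hw' ha' hc'.
  exists (move_to q' (mk cl i) (Some y) (mk cr j) MRight), q', (y :: cl), (ohead cr), (behead cr), t'.
  split=> //; first by apply/stepP; exists q', (Some y), MRight.
  - by split=> //; rewrite mkR; exists i, (j - nilp cr).
  - by rewrite cellsR; move: hd; rewrite /dpat e /cells /marks !map_cat /= hs.
  - by rewrite /absw cellsR.
have advL q' y t' : List.In (q', Some y, MLeft) (delta q a) ->
    dpat (cells cl (Some y) cr) -> wf_walk q' (behead cl) (ohead cl) (y :: cr) ->
    accw t' (absw q' cl (Some y) cr) ->
    clock (move_to q' (mk cl i) (Some y) (mk cr j) MLeft) t' ->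
    advances (q, mk cl i, a, mk cr j).
  move=> hin hs hw' ha' hc'.
  exists (move_to q' (mk cl i) (Some y) (mk cr j) MLeft), q', (behead cl), (ohead cl), (y :: cr), t'.
  split=> //; first by apply/stepP; exists q', (Some y), MLeft.
  - by split=> //; rewrite mkL; exists (i - nilp cl), j.
  - by rewrite cellsL.
  - by rewrite /absw cellsL.
have advS q' t' : a = None -> List.In (q', None, MStay) (delta q a) ->
    wf_walk q' cl None cr -> accw t' (absw q' cl None cr) ->
    clock (move_to q' (mk cl i) None (mk cr j) MStay) t' ->
    advances (q, mk cl i, a, mk cr j).
  move=> e hin hw' ha' hc'.
  exists (move_to q' (mk cl i) None (mk cr j) MStay), q', cl, None, cr, t'.
  split=> //; first by apply/stepP; exists q', None, MStay.
  - by split=> //; exists i, j.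
  - by rewrite -e.
have advRb q' t' : a = None -> cl = [::] -> List.In (q', None, MRight) (delta q a) ->
    wf_walk q' [::] (ohead cr) (behead cr) -> accw t' (absw q' [::] None cr) ->
    clock (move_to q' (mk cl i) None (mk cr j) MRight) t' ->
    advances (q, mk cl i, a, mk cr j).
  move=> e e' hin hw' ha' hc'.
  exists (move_to q' (mk cl i) None (mk cr j) MRight), q', [::], (ohead cr), (behead cr), t'.
  split=> //; first by apply/stepP; exists q', None, MRight.
  - by split=> //; rewrite e' mkRb; exists i.+1, (j - nilp cr).
  - by rewrite cellsRb -e -e'.
  - by rewrite /absw cellsRb.
have advLb q' t' : a = None -> cr = [::] -> List.In (q', None, MLeft) (delta q a) ->
    wf_walk q' (behead cl) (ohead cl) [::] -> accw t' (absw q' cl None [::]) ->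
    clock (move_to q' (mk cl i) None (mk cr j) MLeft) t' ->
    advances (q, mk cl i, a, mk cr j).
  move=> e e' hin hw' ha' hc'.
  exists (move_to q' (mk cl i) None (mk cr j) MLeft), q', (behead cl), (ohead cl), [::], t'.
  split=> //; first by apply/stepP; exists q', None, MLeft.
  - by split=> //; rewrite e' mkLb; exists (i - nilp cl), j.+1.
  - by rewrite cellsLb -e -e'.
  - by rewrite /absw cellsLb.
have nilP := ohead_nil.
have cvE q' y mv : keepd a y ->
  cv (word (move_to q' (mk cl i) y (mk cr j) mv)) = cv (rev (mk cl i) ++ a :: mk cr j).
  exact: cv_move.
case: q hw hc ha hq advR advL advS advRb advLb => [|bb||| ii|ii|ii|c1|w] //.
- case: a hd cvE => [[y d]|] hd cvE [h1 h2] hc ha hq advR advL advS advRb advLb; last first.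
    apply: (advS QAcc 0) => //=; first by left.
    + rewrite h1 // /cells /= cats0 /accw lets_rev ctl_rev h2; exact: acc_nil.
    + rewrite h1 // /absw /cells /= cats0 /accw lets_rev ctl_rev h2; exact: acc_nil.
  case: y hd cvE hc ha h1 advR advL advS advRb advLb => [[ii|y]|] hd cvE hc ha h1 advR advL advS advRb advLb.
  + apply: (advR (QFound ii) _ (None, d) t erefl) => //; [by left|exact: nilP| |].
    * move: ha; rewrite /absw /=; apply: accw_eq.
        by rewrite /cells !lets_cat /= !ctl_cat lets_rev ctl_rev h2.
      by rewrite stk_cons_inl; apply/ffunP=> k; rewrite /cells !lets_cat !stk_cat !ffunE.
    * by rewrite /clock -/(word _) cvE.
  + by apply: (advR QFetch _ (Some (inr y), d) t erefl) => //;
      [by left|split=> //; exact: nilP|rewrite /clock -/(word _) cvE].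
  + by apply: (advR QFetch _ (None, d) t erefl) => //;
      [by left|split=> //; exact: nilP|rewrite /clock -/(word _) cvE].
- case: a hd cvE => [x|] hd cvE h1 hc ha hq advR advL advS advRb advLb.
    by apply: (advR (QFound ii) x x t erefl) => //;
      [by left|exact: nilP|rewrite /clock -/(word _) cvE].
  move: (h1 erefl) hc ha cvE advLb => {advR advL advS advRb} -> hc ha cvE advLb.
  apply: (advLb (QTick ii) t) => //; [by left|exact: nilP|].
  rewrite /clock -/(word _) cvE // /= nd_cons nd_mk /=.
  by move: hc; rewrite /clock [hasd None]/= expn0 /=; lia.
- move=> h1 hc ha hq advR advL advS advRb advLb.
  have [t' tE _] := accw_inl ha.
  (* With all [n] digits to the right of the head the pending carry would weigh [Bn], leaving no
     room for the pending instruction. Hence some digit is at or left of the head and, the digits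
     being contiguous, the scanned cell carries one. *)
  have ndlt : nd (mk cr j) < n.
    rewrite ltnNge; apply/negP=> hge; move: hc.
    have := leq_pexp2l (ltn0Sn b0) hge; rewrite -/base -/Bn tE /clock; lia.
  have [y [d aE]] : exists y d, a = Some (y, Some d).
    case: a hd h1 {ha hc cvE advR advL advS advRb advLb} => [[y [d|]]|] [p hp] h1.
    + by exists y, d.
    + move: hp; rewrite /cells /marks map_cat /= => /dpat_last.
      by rewrite -/(marks cr) -(nd_mk cr j); lia.
    + move: hp; rewrite /cells h1 //= => hp.
      have := congr1 (count id) hp; rewrite count_cat !count_nseq /= -(nd_mk cr j); lia.
  subst a; case: (eqVneq d ord_max) => dm.
    apply: (advL (QTick ii) (y, Some ord0) t) => //=.
    + by rewrite dm eqxx; left.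
    + by move: hd; rewrite /dpat /cells /marks !map_cat.
    + exact: nilP.
    + by move: ha; rewrite /absw /cells !lets_cat.
    + move: hc; rewrite /clock /word -(carry_word _ _ _ dm); exact.
  apply: (advL (QLeft ii) (y, Some (inord d.+1)) t) => //=.
  + by rewrite (negPf dm); left.
  + by move: hd; rewrite /dpat /cells /marks !map_cat.
  + exact: nilP.
  + by move: ha; rewrite /absw /cells !lets_cat.
  + move: hc; rewrite /clock /word (incr_word _ _ _ dm); exact.
- case: a hd cvE => [x|] hd cvE h1 hc ha hq advR advL advS advRb advLb.
    apply: (advL (QLeft ii) x t) => //; last by rewrite /clock -/(word _) cvE.
      by case: ii {h1 hc ha hq advR advL advS advRb advLb} => ii; left.
    exact: nilP.
  move: (h1 erefl) hc ha cvE advS advRb => {advR advL advLb h1 hq} -> hc ha cvE advS advRb.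
  have [t' tE hr] := accw_inl ha; subst t.
  case: ii hc ha advS advRb hr => [c1|[k x]] hc ha advS advRb hr; last first.
    apply: (advS (wr [:: inr (k, x)]) t') => //; first by left.
      by rewrite /absw /= val_insub //= /accw stk_cons_inr.
    by move: hc; rewrite /clock -/(word _) cvE // addnS.
  case: hr => b hr hb; case er: (rd c1) hr hb => [k|] /= hr hb.
    apply: (advRb (QPop c1) t'.+1) => //; first by rewrite /= er; left.
      by split; [exact: nilP|exists k => //; rewrite ffunE].
    by move: hc; rewrite /clock -/(word _) cvE.
  apply: (advS (wb b) t') => //.
  + by rewrite /= er; apply/List.in_map_iff; exists b.
  + by rewrite /absw (pend_wb hb) /accw stk_inl ctl_cat ctl_inl.
  + by move: hc; rewrite /clock -/(word _) cvE // addnS.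
- case: a hd cvE => [[y d]|] hd cvE [h1 [k er hk]] hc ha hq advR advL advS advRb advLb; last first.
    move: (h1 erefl) hc ha cvE advLb => {advR advL advS advRb} -> hc ha cvE advLb.
    have [t' tE] := accw_inl ha; subst t; rewrite er /= => -[b hr hb].
    have e : stk (lets (cells cl None [::])) k = [::].
      by rewrite /cells [ocell _ ++ _]/= cats0 lets_rev stk_rev hk.
    rewrite e in hr hb.
    have e' : setstk (stk (lets (cells cl None [::]))) k (behead [::]) = stk (lets (cells cl None [::])).
      by apply/ffunP=> k'; rewrite ffunE; case: eqP => // ->; rewrite e.
    rewrite e' in hr.
    apply: (advLb (wb b) t') => //.
    + by apply/List.in_map_iff; exists b.
    + exact: nilP.
    + by rewrite /absw (pend_wb hb) /accw stk_inl ctl_cat ctl_inl.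
    + by move: hc; rewrite /clock -/(word _) cvE // addnS.
  have [[x hy]|hy] : (exists x, y = Some (inr (k, x))) \/ ofkind k (odflt (inl (inl c1)) y) = None.
    case: y {hd cvE h1 hc ha advR advL advS advRb advLb} => [[?|[k' x]]|] /=; try by right.
    by case: eqP => [->|_]; [left; exists x|right].
    subst y; have /= [e1 [e2 e3]] := pop_word x d cr hk.
    have [t' tE] := accw_inl ha; subst t; rewrite er /= => -[b hr hb].
    rewrite e1 in hr hb; rewrite [behead _]/= e3 e2 in hr.
    apply: (advL (wb b) (None, d) t') => //.
    + by rewrite /= er eqxx; apply/List.in_map_iff; exists b.
    + by move: hd; rewrite /dpat /cells /marks !map_cat.
    + exact: nilP.
    + by rewrite /absw (pend_wb hb) /accw stk_inl ctl_cat ctl_inl.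
    + by move: hc; rewrite /clock -/(word _) cvE // addnS.
  apply: (advR (QPop c1) _ (y, d) t erefl) => //.
  + case: y hy {hd cvE h1 hc ha advR advL advS advRb advLb} => [[?|[k' x]]|] /= hy; try by left.
    case: (eqVneq k' k) hy => [//|ne _].
    by rewrite er (inj_eq Some_inj) eq_sym (negPf ne); left.
  + split; first exact: nilP.
    exists k => //; case: y hy {hd cvE h1 hc ha advR advL advS advRb advLb} => [y|] //= hy.
    by move: hk; rewrite !ffunE /= hy.
  + by rewrite /clock -/(word _) cvE.
- case: a hd cvE => [x|] hd cvE h1 hc ha hq advR advL advS advRb advLb.
    by apply: (advL (QWrite w) x t) => //; [left|exact: nilP|rewrite /clock -/(word _) cvE].
  move: (h1 erefl) hd hc ha cvE advL advRb => {advR advLb advS h1 hq} -> hd hc ha cvE advL advRb.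
  case: w hc ha advL advRb => [[|y w] hs] hc ha advL advRb.
    by apply: (advRb QFetch t) => //; [left|split=> //; exact: nilP|rewrite /clock -/(word _) cvE].
  apply: (advL (wr w) (Some y, None) t) => //; first by left.
  + by case: hd => p hp; exists p.+1; move: hp; rewrite /cells /= => ->.
  + rewrite /absw /= val_insub; last exact: ltnW.
    by move: ha; rewrite /absw /= rev_cons cat_rcons.
  + by rewrite /clock -/(word _) cvE.
Qed.

Lemma accept_sound k (c c' : conf) q cl a cr : wf c q cl a cr ->
  reach (M := tm) k c c' -> c'.1.1.1 = QAcc -> exists t, accw t (absw q cl a cr).
Proof.
elim: k c q cl a cr => [|k IH] c q cl a cr hw /=.
  by move=> <-; case: hw => [[i [j ->]]] /= hw e; move: hw; rewrite e; exists 0.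
case=> c1 [hs hk] e; have [q' [cl' [a' [cr' [hw' himp]]]]] := wf_sound hw hs.
by have [t ht] := IH _ _ _ _ _ hw' hk e; exact: himp ht.
Qed.

(** Outside [QAcc] a good step always exists, and [mu] decreases along it, so [QAcc] is reached. *)
Lemma accept_complete (c : conf) q cl a cr t : wf c q cl a cr ->
  dpat (cells cl a cr) -> accw t (absw q cl a cr) -> clock c t -> nd (word c) = n ->
  exists k (c' : conf), reach (M := tm) k c c' /\ c'.1.1.1 = QAcc.
Proof.
have [N] := ubnP (mu c); elim: N c q cl a cr t => // N IH c q cl a cr t hN hw hd ha hc hn.
have [qE|/eqP qA] := eqVneq q QAcc.
  by exists 0, c; split=> //; case: hw => [[i [j ->]]].
have [c' [q' [cl' [a' [cr' [t' [hs hw' hd' ha' hc']]]]]]] := wf_complete hw hd qA ha hc.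
have [hn' hmu] := mu_step hn hs.
have [//|k [c2 [h1 h2]]] := IH c' q' cl' a' cr' t' _ hw' hd' ha' hc' hn'; first exact: leq_trans hmu _.
by exists k.+1, c2; split=> //; exists c'.
Qed.

Lemma reach_mu k (c c' : conf) : nd (word c) = n -> reach (M := tm) k c c' ->
  nd (word c') = n /\ mu c' + k <= mu c.
Proof.
elim: k c => [|k IH] c hn /=; first by move=> <-; rewrite addn0.
case=> c1 [hs hk]; have [hn1 h1] := mu_step hn hs; have [hn2 h2] := IH _ hn1 hk.
by split=> //; lia.
Qed.
End Clock.

(** * Stack programs of exponential length decide languages in NEXPTIME *)

Definition inst (w : seq Sigma) : stacks := [ffun k => if k == kin then map inp w else [::]].

Definition icell (a : Sigma) : cell := (Some (inr (kin, inp a)), Some ord0).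

Lemma init_lets w : ctl (lets [seq icell a | a <- w]) = [::] /\
  stk (lets [seq icell a | a <- w]) = inst w.
Proof.
have h : lets [seq icell a | a <- w] = [seq inr (kin, inp a) | a <- w].
  by elim: w => //= a w ->.
rewrite h; split; first by elim: w {h}.
apply/ffunP=> k; rewrite !ffunE; elim: w {h} => [|a w IH] /=; first by case: ifP.
by rewrite eq_sym; case: eqP IH => [->|_] /= ->; rewrite ?eqxx.
Qed.

Lemma cv_init w : cv [seq Some (icell a) | a <- w] = 0 /\ nd [seq Some (icell a) | a <- w] = size w.
Proof. by elim: w => //= a w [-> ]; rewrite nd_cons => ->. Qed.

Lemma size2_time (w : seq Sigma) (c : config tm) k :
  1 < size w -> reach k (init tm w) c ->
  k <= 12 * size w + 10 * m + 300 +
    base ^ size w * (10 * (size w + 2 * m + 20 + base ^ size w * (m + 5))).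
Proof.
case: w => [|a w] // _ hr; pose n := size (a :: w).
have [hv hn] := cv_init (a :: w).
have := @reach_mu n k (QStart, [::], Some (icell a), [seq Some (icell b) | b <- w]) c hn hr.
move=> [_ h]; apply: leq_trans (leq_trans (leq_addl _ _) h) _ => {h hr}.
rewrite /mu (_ : cv (word _) = 0); last exact: hv.
rewrite subn0 /= size_map.
have := psi_le (base ^ n) (0 + size w + 1 + m + 10); rewrite -/n.
have -> : size w = n.-1 by []; have : 0 < n by [].
move: (base ^ n) => X; case: (n) => // n' _ /=; nia.
Qed.

(** The left side is at most [e * n * f ^ n * f ^ n], and each factor is at most a power of 2 with
    exponent linear in [n]; as [n] is at least 2, the constant [e + 1 + 2 * f] is below a power of
    [n]. *)
Lemma exp_bound (n : nat) : 1 < n ->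
  12 * n + 10 * m + 300 + base ^ n * (10 * (n + 2 * m + 20 + base ^ n * (m + 5)))
  <= 2 ^ (n ^ (1000 * (m + 5) + 2 * base).+1).
Proof.
move=> n1; set e := 1000 * (m + 5); set f := base.
have h1 : n < 2 ^ n by apply: ltn_expl.
have h2 : f ^ n <= 2 ^ (f * n) by rewrite expnM leq_exp2r ?(ltnW n1) //; apply/ltnW/ltn_expl.
have h3 : e <= 2 ^ e by apply/ltnW/ltn_expl.
have hf : 0 < f ^ n by rewrite expn_gt0.
have h4 : 12 * n + 10 * m + 300 + f ^ n * (10 * (n + 2 * m + 20 + f ^ n * (m + 5)))
    <= e * (n * (f ^ n * f ^ n)).
  by rewrite /e; move: (f ^ n) hf => X hX; nia.
apply: leq_trans h4 _.
apply: (@leq_trans (2 ^ (e * n) * (2 ^ n * (2 ^ (f * n) * 2 ^ (f * n))))).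
  apply: leq_mul; last by apply: leq_mul; [exact: ltnW|apply: leq_mul].
  by apply: leq_trans h3 _; rewrite leq_exp2l // leq_pmulr // (ltnW n1).
rewrite -!expnD leq_exp2l // expnS.
have h5 : (e + 1 + f + f) <= n ^ (e + 2 * f).
  apply: (@leq_trans (2 ^ (e + 2 * f))); last by rewrite leq_exp2r // addn_gt0 muln_gt0 orbT.
  by apply: leq_trans (ltn_expl (e + 2 * f) (isT : 1 < 2)); lia.
rewrite [n * _]mulnC; apply: leq_trans (leq_mul h5 (leqnn n)); nia.
Qed.

Lemma reach_rcons k (c1 c2 c3 : config tm) :
  reach k c1 c2 -> step c2 c3 -> reach k.+1 c1 c3.
Proof.
elim: k c1 => [|k IH] c1 /=; first by move=> -> hs; exists c3.
by case=> c [h1 hk] hs; exists c; split=> //; apply: IH.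
Qed.

Lemma Nat_powE a b : PeanoNat.Nat.pow a b = a ^ b.
Proof. by elim: b => //= b ->; rewrite expnS. Qed.

Theorem stack_program_NEXPTIME (Lg : seq Sigma -> Prop) :
  Lg [::] -> (forall a, Lg [:: a] <-> sing (inp a)) ->
  (forall w, 1 < size w -> Lg w ->
    exists2 t, t < base ^ size w & acc_run t [:: inl c0] (inst w)) ->
  (forall w t, 1 < size w -> acc_run t [:: inl c0] (inst w) -> Lg w) ->
  in_NEXPTIME Lg.
Proof.
move=> L0 L1 Lcomp Lsound; exists tm, (1000 * (m + 5) + 2 * base).+1; split.
  move=> w c; rewrite !Nat_powE; have [h2|] := ltnP 1 (size w).
    move=> hr c' /(reach_rcons hr) hr'.
    by have := leq_trans (size2_time h2 hr') (exp_bound h2); rewrite ltnn.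
  (* The time bound is [2 ^ 0 = 1] for the empty word and [2 ^ 1 = 2] for one letter, which the
     machine meets exactly. *)
  case: w => [|a [|//]] _; rewrite ?exp0n ?exp1n //.
    case=> c1 [/stepP [q2 [b [mv [[|//] ]]]]] /= [<- <- <-] -> <- c'.
    by case/stepP=> ? [? [? []]].
  case=> c1 [/stepP [q2 [b [mv [[|//] ]]]]] /= [<- <- <-] -> [c2 []].
  case/stepP=> q2' [b' [mv' [/=]]]; case: (sing _) => //= -[|//] [<- <- <-] -> <- c'.
  by case/stepP=> ? [? [? []]].
move=> w; have [h2|] := ltnP 1 (size w).
  case: w h2 => [|x [|y w]] // h2; pose cr := [seq icell b | b <- y :: w].
  (* Two steps after the start the head is back on the first cell with the initial call pending; the
     simulation starts from this configuration. *)
  pose ci : conf := (QLeft (inl c0), [::], Some (icell x), [seq Some (icell b) | b <- y :: w]).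
  have hw : wf ci (QLeft (inl c0)) [::] (Some (icell x)) cr.
    by split=> //; exists 0, 0; rewrite /ci /mk /cr !cats0 -map_comp.
  have [hl1 hl2] := init_lets (x :: y :: w).
  have habs t : accw t (absw (QLeft (inl c0)) [::] (Some (icell x)) cr) <->
      acc_run t [:: inl c0] (inst (x :: y :: w)).
    by rewrite /accw /absw (_ : cells _ _ _ = [seq icell a | a <- x :: y :: w]) // stk_cons_inl hl2 ctl_cat hl1.
  have s0 : step (M := tm) (init tm (x :: y :: w)) (QOne (sing (inp x)), [:: Some (icell x)], Some (icell y), [seq Some (icell b) | b <- w]).
    by apply/stepP; do 3 eexists; split; [left; reflexivity|].
  have s1 : step (M := tm) (QOne (sing (inp x)), [:: Some (icell x)], Some (icell y), [seq Some (icell b) | b <- w]) ci.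
    by apply/stepP; do 3 eexists; split; [left; reflexivity|].
  split.
    case=> -[|[|k]] [c [hr hc]]; first by move: hc; rewrite -hr.
    - case: hr => c1 [/stepP [q2 [b [mv [[|//] ]]]]] /= [<- <- <-] -> e.
      by move: hc; rewrite -e.
    - case: hr => c1 [/stepP [q2 [b [mv [[|//] ]]]]] /= [<- <- <-] ->.
      case=> c2 [/stepP [q2' [b' [mv' [[|//] ]]]]] /= [<- <- <-] -> hr.
      by have [t /habs ht] := accept_sound hw hr hc; exact: Lsound ht.
  move=> /(Lcomp _ h2) [t tlt /habs ht].
  have [hv hn] := cv_init (x :: y :: w).
  have hd : dpat (size (x :: y :: w)) (cells [::] (Some (icell x)) cr).
    exists 0; rewrite /marks /cells /cr /= -map_comp.
    by congr [:: _, _ & _]; elim: (w) => //= z w' ->.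
  have hc : clock (size (x :: y :: w)) ci t.
    by rewrite /clock (_ : cv (word _) = 0); [exact: ltnW|exact: hv].
  have [k [c [hr hA]]] := accept_complete hw hd ht hc hn.
  by exists k.+2, c; split=> //; exists (QOne (sing (inp x)), [:: Some (icell x)], Some (icell y), [seq Some (icell b) | b <- w]); split=> //; exists ci.
case: w => [|a [|//]] _.
  split=> // _; exists 1, (QAcc, [::], None, [::]); split=> //; exists (QAcc, [::], None, [::]); split=> //.
  by apply/stepP; do 3 eexists; split; [left; reflexivity|].
split.
  case=> -[|[|k]] [c [hr hc]]; first by move: hc; rewrite -hr.
  - case: hr => c1 [/stepP [q2 [b [mv [[|//] ]]]]] /= [<- <- <-] -> e.
    by move: hc; rewrite -e.
  - case: hr => c1 [/stepP [q2 [b [mv [[|//] ]]]]] /= [<- <- <-] ->.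
    case=> c2 [/stepP [q2' [b' [mv' [/=]]]]]; case: ifP => //= h _ _ _.
    by apply/L1.
move=> /L1 ha; exists 2, (QAcc, [:: Some (icell a)], None, [::]); split=> //.
exists (QOne (sing (inp a)), [:: Some (icell a)], None, [::]); split.
  by apply/stepP; do 3 eexists; split; [left; reflexivity|].
exists (QAcc, [:: Some (icell a)], None, [::]); split=> //.
by apply/stepP; rewrite ha; do 3 eexists; split; [left; reflexivity|].
Qed.
End StackMachine.

(** * Integer solutions of bounded size for systems of linear inequalities *)

Section SmallSolutions.
Local Open Scope ring_scope.

(** Permutations are among all functions from rows to columns, and the Leibniz sum extended to all
    functions factors into the product of row sums. *)
Lemma det_le (n : nat) (M : 'M[int]_n) : `|\det M| <= \prod_i \sum_j `|M i j|.
Proof.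
rewrite /determinant; apply: le_trans (ler_norm_sum _ _ _) _.
rewrite bigA_distr_bigA /=.
pose G (f : {ffun 'I_n -> 'I_n}) := \prod_i `|M i (f i)|.
apply: (@le_trans _ _ (\sum_(s : 'S_n) G (pval s))).
  apply: ler_sum => s _; rewrite normrM normrX normrN1 expr1n mul1r normr_prod.
  by apply: ler_prod => i _; rewrite normr_ge0 /= pvalE.
have -> : \sum_(s : 'S_n) G (pval s) = \sum_(f in [set pval s | s in [set: 'S_n]]) G f.
  rewrite big_imset /=; last by move=> s1 s2 _ _ /val_inj.
  by apply: eq_bigl => s; rewrite inE.
rewrite big_mkcond /=; apply: ler_sum => f _.
by case: ifP => // _; apply: prodr_ge0.
Qed.

Lemma cofactor_le (n c : nat) (B : 'M[int]_n) i k : (0 < c)%N ->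
  (forall i, \sum_j `|B i j| <= c%:Z) -> `|cofactor B i k| <= (c ^ n)%N%:Z.
Proof.
case: n B i k => [|n] B i k; first by case: i.
move=> c0 hB; rewrite /cofactor normrM normrX normrN1 expr1n mul1r.
apply: le_trans (det_le _) _; apply: (@le_trans _ _ (\prod_(j < n) c%:Z)); last first.
  by rewrite prodr_const card_ord -!natz -natrX ler_nat leq_pexp2l.
apply: ler_prod => j _; rewrite sumr_ge0 //=; apply: le_trans (hB (lift i j)).
rewrite (bigD1_ord k) //=; apply: (@le_trans _ _ (\sum_(l < n) `|B (lift i j) (lift k l)|)).
  by apply: ler_sum => l _; rewrite !mxE.
by rewrite lerDr.
Qed.

Section Vertex.
Variables (R : realFieldType) (m n : nat) (A : 'M[R]_(m, n)) (b : 'cV[R]_m).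

Definition feasible (x : 'cV[R]_n) := forall j, b j 0 <= (A *m x) j 0.
Definition tight (x : 'cV[R]_n) (j : 'I_m) := (A *m x) j 0 == b j 0.
(** The rows of constraints that are not tight are replaced by 0, so that the rank counts
    independent tight constraints without changing the shape of the matrix. *)
Definition tmx (x : 'cV[R]_n) : 'M[R]_(m, n) := \matrix_(j, i) (A j i *+ tight x j).

Lemma tmx_mul x p (u : 'M[R]_(n, p)) j i : (tmx x *m u) j i = (A *m u) j i *+ tight x j.
Proof.
by rewrite !mxE -sumrMnl; apply: eq_bigr => k _; rewrite !mxE mulrnAl.
Qed.

Hypothesis kerA : forall u : 'cV[R]_n, A *m u = 0 -> u = 0.

(* Moving along a direction that keeps the tight constraints tight until a new one becomes tight. *)
Lemma vertex_step x : feasible x -> (\rank (tmx x) < n)%N ->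
  exists2 x', feasible x' & (\rank (tmx x) < \rank (tmx x'))%N.
Proof.
move=> fx rk.
have [u u0 hu] : exists2 u : 'cV[R]_n, u != 0 & tmx x *m u = 0.
  have : cokermx (tmx x) != 0.
    by rewrite -mxrank_eq0 mxrank_coker -lt0n subn_gt0.
  case/matrix0Pn=> i [j hij]; exists (col j (cokermx (tmx x))).
    by apply/eqP => /matrixP /(_ i 0); rewrite [LHS]mxE [RHS]mxE => /eqP; rewrite (negPf hij).
  by rewrite colE mulmxA mulmx_coker mul0mx.
(* The kernel of [A] is trivial, so along [u] or along [- u] some constraint decreases. *)
wlog [j0 hj0] : u u0 hu / exists j, (A *m u) j 0 < 0.
  move=> hw; have : A *m u != 0 by apply: contra_neq u0 => /kerA.
  case/matrix0Pn=> j [k]; rewrite ord1 neq_lt => /orP[h|h]; first by apply: (hw u) => //; exists j.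
  apply: (hw (- u)); rewrite ?oppr_eq0 ?mulmxN ?hu ?oppr0 //.
  by exists j; rewrite mxE oppr_lt0.
have tu j : tight x j -> (A *m u) j 0 = 0.
  by move=> tj; have := tmx_mul x u j 0; rewrite hu mxE tj.
(* How far one can move along [u] before a decreasing constraint [j] becomes tight; the least such
   distance keeps all constraints satisfied. *)
pose ratio j := ((A *m x) j 0 - b j 0) / - (A *m u) j 0.
pose neg j := (A *m u) j 0 < 0.
case: (@arg_minP _ _ _ j0 neg ratio hj0) => j1 nj1 hmin.
pose x' := x + ratio j1 *: u.
have Ax' j : (A *m x') j 0 = (A *m x) j 0 + ratio j1 * (A *m u) j 0.
  by rewrite mulmxDr -scalemxAr !mxE.
have th0 : 0 <= ratio j1 by rewrite divr_ge0 ?subr_ge0 ?oppr_ge0 ?(ltW nj1).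
have fx' : feasible x'.
  move=> j; rewrite Ax'; have [nj|] := boolP (neg j); last first.
    by rewrite /neg -leNgt => h; apply: (le_trans (fx j)); rewrite lerDl mulr_ge0.
  have := hmin j nj; rewrite {2}/ratio ler_pdivlMr ?oppr_gt0 // mulrN.
  by move: (ratio j1 * _) => c; lra.
exists x' => //.
have sub j : tight x j -> tight x' j.
  by move=> tj; rewrite /tight Ax' (tu _ tj) mulr0 addr0.
have t1 : tight x' j1.
  rewrite /tight Ax' /ratio; move: nj1; rewrite /neg => /ltr0_neq0.
  by move: ((A *m u) j1 0) => c c0; apply/eqP; field.
have sm : (tmx x <= tmx x')%MS.
  apply/row_subP => j; have [tj|nt] := boolP (tight x j).
    have -> : row j (tmx x) = row j (tmx x') by apply/rowP => k; rewrite !mxE tj sub.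
    exact: row_sub.
  by have -> : row j (tmx x) = 0; [apply/rowP => k; rewrite !mxE (negPf nt)|apply: sub0mx].
(* The newly tight row does not annihilate [u], whereas everything spanned by the old tight rows
   does. *)
rewrite (ltn_leqif (mxrank_leqif_sup sm)); apply/negP => /submxP [D hD].
have := tmx_mul x' u j1 0; rewrite t1 hD -mulmxA hu mulmx0 mxE => /esym /eqP.
by rewrite lt_eqF.
Qed.

Lemma vertex x : feasible x -> exists x' (f : 'I_n -> 'I_m),
  [/\ feasible x', rowsub f A \in unitmx & rowsub f A *m x' = rowsub f b].
Proof.
have [k] := ubnP (n - \rank (tmx x)); elim: k x => // k IH x hk fx.
have := rank_leq_col (tmx x); rewrite leq_eqVlt => /orP[full|lt]; last first.
  have [x' fx' h] := vertex_step fx lt; apply: (IH x') => //.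
  by move: h lt hk; move: (\rank _) (\rank _) => r1 r2; lia.
have fA : row_full (tmx x) by [].
pose f := fullrankfun fA; exists x, f.
have un : rowsub f (tmx x) \in unitmx by apply: fullrowsub_unit.
(* A row that is not tight is 0 in [tmx x] and cannot belong to an invertible selection. *)
have tf i : tight x (f i).
  apply/negPn/negP => /negPf nt.
  have r0 : row i (rowsub f (tmx x)) = 0 by apply/rowP => l; rewrite !mxE nt.
  have := congr1 (fun M : 'M_n => row i M 0 i) (mulmxV un).
  by rewrite row_mul r0 mul0mx !mxE eqxx => /eqP; rewrite eq_sym oner_eq0.
have eA : rowsub f (tmx x) = rowsub f A.
  by apply/matrixP => i j; rewrite !mxE tf.
split=> //; first by rewrite -eA.
by apply/matrixP => i j; rewrite mul_rowsub_mx ord1 ![rowsub _ _ _ _]mxE; apply/eqP/tf.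
Qed.

End Vertex.

(** A vertex solves a square system with integer matrix [B]. Multiplied by the absolute value of
    [\det B] it becomes, up to sign, the adjugate of [B] applied to a part of [b], hence integral
    with entries bounded through cofactors. It stays feasible because the factor is at least 1 and
    [b] is nonnegative. *)
Lemma small_integer_solution (R : realFieldType) (m n c : nat) (A : 'M[int]_(m, n))
    (b : 'cV[int]_m) (x : 'cV[R]_n) :
  (forall u : 'cV[R]_n, map_mx intr A *m u = 0 -> u = 0) ->
  (forall j, \sum_i `|A j i| <= c%:Z) -> (0 < c)%N ->
  (forall j, 0 <= b j 0 <= 1) ->
  (forall j, (b j 0)%:~R <= (map_mx intr A *m x) j 0) ->
  exists y : 'cV[int]_n, (forall j, b j 0 <= (A *m y) j 0) /\
    forall i, `|y i 0| <= (n * c ^ n)%N%:Z.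
Proof.
move=> kerA hc c0 hb hx; pose AR : 'M[R]_(m, n) := map_mx intr A; pose bR : 'cV[R]_m := map_mx intr b.
have fx : feasible AR bR x by move=> j; rewrite mxE; apply: hx.
have [x' [f [fx' un e]]] := vertex kerA fx.
pose B := rowsub f A; pose D := \det B.
have BE : rowsub f AR = map_mx intr B by apply/matrixP => i j; rewrite !mxE.
have D0 : D != 0.
  apply: contraTneq un; rewrite /D => d0.
  by rewrite BE unitmxE det_map_mx d0 /= rmorph0 unitr0.
pose y0 := \adj B *m rowsub f b.
have yE : map_mx intr y0 = D%:~R *: x' :> 'cV[R]_n.
  have -> : map_mx intr y0 = map_mx intr (\adj B) *m (rowsub f AR *m x').
    by rewrite e /y0 map_mxM /=; congr (_ *m _); apply/matrixP => i j; rewrite !mxE.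
  rewrite BE mulmxA -map_mxM mul_adj_mx map_scalar_mx mul_scalar_mx.
  by [].
pose y := Num.sg D *: y0; exists y; split=> [j|i].
  have : (b j 0)%:~R <= ((A *m y) j 0)%:~R :> R; last by rewrite ler_int.
  have -> : ((A *m y) j 0)%:~R = `|D|%:~R * (AR *m x') j 0 :> R.
    have -> : ((A *m y) j 0)%:~R = (map_mx intr (A *m y)) j 0 :> R by rewrite [RHS]mxE.
    rewrite /y -scalemxAr map_mxZ map_mxM /= yE -scalemxAr scalerA -rmorphM /=.
    by rewrite -normrEsg mxE.
  have := fx' j; rewrite [bR _ _]mxE => h; apply: (le_trans h); rewrite ler_peMl //.
    by apply: le_trans h; rewrite ler0z; have /andP[] := hb j.
  by rewrite -[1]/(1%:~R) ler_int -gtz0_ge1 normr_gt0.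
rewrite /y mxE normrM normr_sg D0 mul1r /y0 mxE.
apply: le_trans (ler_norm_sum _ _ _) _.
have -> : (n * c ^ n)%N%:Z = \sum_(k < n) (c ^ n)%N%:Z.
  by rewrite sumr_const card_ord -mulr_natl natz PoszM.
apply: ler_sum => k _; rewrite normrM; apply: (@le_trans _ _ (`|(\adj B) i k| * 1)).
  apply: ler_wpM2l => //; rewrite mxE; have /andP[b0 b1] := hb (f k).
  by rewrite ger0_norm.
rewrite mulr1 mxE; apply: cofactor_le => // l.
by apply: le_trans (hc (f l)); apply: ler_sum => p _; rewrite mxE.
Qed.

(** * Maps from finitely many reals to the integers that preserve order and sums *)

Section Homomorphism.
Variables (R : realFieldType) (s : seq R) (N : nat).
Hypothesis sN : size s = N.
Variable i0 : 'I_N.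

(** Monotonicity for pairs, additivity for triples as two opposite inequalities, and negativity at
    [i0], normalised to at most -1. All pairs and triples are indexed; where [v] does not satisfy
    the relation the row is 0. A row involves at most three unit vectors, which is the origin of the
    base 3. *)
Let cstr : finType := ('I_N * 'I_N + ('I_N * 'I_N * 'I_N * bool + unit))%type.
Let v (i : 'I_N) : R := s`_i.

Let e (a : 'I_N) : 'rV[int]_N := delta_mx 0 a.

Let rowc (r : cstr) : 'rV[int]_N :=
  match r with
  | inl (a, b) => if v a <= v b then e b - e a else 0
  | inr (inl (a, b, c, sg)) =>
      if v a + v b == v c then (-1) ^+ sg *: (e a + e b - e c) else 0
  | inr (inr _) => - e i0
  end.

Let rhs (r : cstr) : int := if r is inr (inr _) then 1 else 0.

Let rowc_eval (T : comNzRingType) (y : 'cV[T]_N) r : (map_mx intr (rowc r) *m y) 0 0 =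
  match r with
  | inl (a, b) => if v a <= v b then y b 0 - y a 0 else 0
  | inr (inl (a, b, c, sg)) =>
      if v a + v b == v c then (-1) ^+ sg * (y a 0 + y b 0 - y c 0) else 0
  | inr (inr _) => - y i0 0
  end.
Proof.
pose lin (M : 'rV[int]_N) := (map_mx intr M *m y) 0 0.
have linD M M' : lin (M + M') = lin M + lin M'.
  rewrite /lin !mxE -big_split; apply: eq_bigr => i _.
  by rewrite !mxE rmorphD mulrDl.
have linZ a M : lin (a *: M) = a%:~R * lin M.
  rewrite /lin !mxE mulr_sumr; apply: eq_bigr => i _.
  by rewrite !mxE rmorphM mulrA.
have lin0 : lin 0 = 0 by rewrite -(scale0r (0 : 'rV[int]_N)) linZ mul0r.
have linN M : lin (- M) = - lin M by rewrite -scaleN1r linZ mulN1r.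
have eE a : lin (e a) = y a 0.
  by rewrite /lin map_delta_mx -rowE mxE.
rewrite -/(lin _); case: r => [[a b]|[[[[a b] c] sg]|_]] /=; last by rewrite linN eE.
  by case: ifP => _; rewrite ?lin0 // linD linN !eE.
by case: ifP => _; rewrite ?lin0 // linZ !linD linN !eE rmorphXn rmorphN1.
Qed.

Let rowc_norm r : \sum_i `|rowc r 0 i| <= 3%:Z.
Proof.
pose nm (M : 'rV[int]_N) := \sum_i `|M 0 i|.
have nmD M M' : nm (M + M') <= nm M + nm M'.
  by rewrite /nm -big_split; apply: ler_sum => i _; rewrite mxE ler_normD.
have nmN M : nm (- M) = nm M.
  by apply: eq_bigr => i _; rewrite mxE normrN.
have nm0 : nm 0 = 0 by rewrite /nm big1 // => i _; rewrite mxE normr0.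
have nme a : nm (e a) = 1.
  rewrite /nm (bigD1 a) //= big1 ?addr0 ?mxE ?eqxx ?normr1 //.
  by move=> i /negPf h; rewrite mxE eqxx h normr0.
rewrite -/(nm _); case: r => [[a b]|[[[[a b] c] sg]|_]] /=; last by rewrite nmN nme.
  case: ifP => _; rewrite ?nm0 //; apply: le_trans (nmD _ _) _.
  by rewrite nmN !nme.
case: ifP => _; rewrite ?nm0 //.
have -> : nm ((-1) ^+ sg *: (e a + e b - e c)) = nm (e a + e b - e c).
  by apply: eq_bigr => i _; rewrite mxE normrM normrX normrN1 expr1n mul1r.
apply: le_trans (nmD _ _) _; apply: le_trans (lerD (nmD _ _) (lexx _)) _.
by rewrite nmN !nme.
Qed.

Lemma small_values : 0 \in s -> v i0 < 0 ->
  exists y : 'I_N -> int, [/\ y i0 < 0,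
    forall a b, v a <= v b -> y a <= y b,
    forall a b c, v a + v b = v c -> y a + y b = y c &
    forall a, `|y a| <= (N * 3 ^ N)%N%:Z].
Proof.
move=> s0 h0; have [z vz] : exists z, v z = 0.
  by have := s0; rewrite -index_mem sN => h; exists (Ordinal h); rewrite /v /= nth_index.
pose A : 'M[int]_(#|cstr|, N) := \matrix_j rowc (enum_val j).
pose b : 'cV[int]_#|cstr| := \col_j rhs (enum_val j).
(* The original values, scaled so that the constraint at [i0] holds with equality. *)
pose x : 'cV[R]_N := \col_i (v i / - v i0).
have AE (T : comNzRingType) (y : 'cV[T]_N) j :
    (map_mx intr A *m y) j 0 = (map_mx intr (rowc (enum_val j)) *m y) 0 0.
  by rewrite !mxE; apply: eq_bigr => i _; rewrite !mxE.
have Arank (T : comNzRingType) (y : 'cV[T]_N) r :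
    (map_mx intr (rowc r) *m y) 0 0 = (map_mx intr A *m y) (enum_rank r) 0.
  by rewrite AE enum_rankK.
have i0p : 0 < - v i0 by rewrite oppr_gt0.
have [|||||y [hy yb]] := @small_integer_solution R _ N 3 A b x.
(* Trivial kernel: [0 + 0 = 0] gives a row that forces the coordinate of 0 to vanish, and every
   other value is comparable with 0, which gives a row identifying its coordinate with that one. *)
- move=> u hu; have ur r : (map_mx intr (rowc r) *m u) 0 0 = 0 by rewrite Arank hu mxE.
  have uz : u z 0 = 0.
    have := ur (inr (inl (z, z, z, false))); rewrite rowc_eval vz addr0 eqxx mul1r.
    by rewrite addrK.
  apply/matrixP => i j; rewrite ord1 mxE; case/orP: (le_total (v i) (v z)) => h.
    by have := ur (inl (i, z)); rewrite rowc_eval h uz sub0r => /eqP; rewrite oppr_eq0 => /eqP.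
  by have := ur (inl (z, i)); rewrite rowc_eval h uz subr0.
- by move=> j; apply: le_trans (rowc_norm (enum_val j)); apply: ler_sum => i _; rewrite !mxE.
- by [].
- by move=> j; rewrite mxE; case: (enum_val j) => [|[]].
- move=> j; rewrite AE rowc_eval mxE; case: (enum_val j) => [[a c]|[[[[a c] d] sg]|[]]] /=.
  + case: ifP => // h; rewrite !mxE -mulrBl divr_ge0 ?(ltW i0p) //.
    by rewrite subr_ge0.
  + case: eqP => // h; rewrite !mxE -mulrDl -mulrBl h subrr mul0r mulr0.
    by [].
  + by rewrite mxE -mulNr divff // gt_eqF.
have yr r : rhs r <= (map_mx intr (rowc r) *m y) 0 0.
  have := hy (enum_rank r); rewrite mxE enum_rankK; rewrite Arank.
  by have -> : map_mx intr A = A by apply/matrixP => i j; rewrite mxE intz.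
exists (fun i => y i 0); split=> //.
- by have := yr (inr (inr tt)); rewrite rowc_eval /= => h; rewrite -oppr_gt0; apply: lt_le_trans h.
- by move=> a c h; have := yr (inl (a, c)); rewrite rowc_eval h subr_ge0.
- move=> a c d h; apply/eqP; rewrite eq_le.
  have := yr (inr (inl (a, c, d, true))); have := yr (inr (inl (a, c, d, false))).
  rewrite !rowc_eval h eqxx expr1 mulN1r mul1r /= subr_ge0 opprB subr_ge0 => h1 h2.
  by rewrite h1 h2.
Qed.
End Homomorphism.

(* A finite set of reals embeds additively and monotonically into the
   integers, with values of size exponential in its cardinality. *)
Lemma small_hom (R : realFieldType) (S : seq R) (x0 : R) : 0 \in S -> x0 \in S -> x0 < 0 ->
  exists h : R -> int, [/\ h x0 < 0,
    {in S &, forall x y, x <= y -> h x <= h y},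
    {in S & &, forall x y z, x + y = z -> h x + h y = h z} &
    forall x, `|h x| <= (size S * 3 ^ size S)%N%:Z].
Proof.
move=> S0 Sx0 x0lt; pose s := undup S; pose N := size s.
have mem x : x \in S -> (index x s < N)%N by rewrite index_mem mem_undup.
have nthE x (h : x \in S) : s`_(Ordinal (mem x h)) = x by rewrite /= nth_index ?mem_undup.
have [] := @small_values R s N erefl (Ordinal (mem _ Sx0)).
- by rewrite mem_undup.
- by rewrite nthE.
move=> y [y0 ymono yadd yb].
pose h x : int := if insub (index x s) is Some i then y i else 0.
have hE x (hx : x \in S) : h x = y (Ordinal (mem x hx)) by rewrite /h (insubT (fun i => (i < N)%N) (mem x hx)).
exists h; split.
- by rewrite (hE _ Sx0).
- by move=> a b ha hb le; rewrite (hE _ ha) (hE _ hb); apply: ymono; rewrite !nthE.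
- by move=> a b c ha hb hc e; rewrite (hE _ ha) (hE _ hb) (hE _ hc); apply: yadd; rewrite !nthE.
move=> x; have le : (N * 3 ^ N <= size S * 3 ^ size S)%N.
  by have sz := size_undup S; rewrite leq_mul // leq_exp2l.
rewrite /h; case: insubP => [i _ _|_]; last by rewrite normr0.
by apply: le_trans (yb i) _; rewrite lez_nat.
Qed.
End SmallSolutions.

(** * Formulas, their outermost boxes, and finite trees as models *)

Fixpoint form_code (f : form) : GenTree.tree nat :=
  match f with
  | FVar n => GenTree.Leaf n
  | FAnd a b => GenTree.Node 0 [:: form_code a; form_code b]
  | FOr a b => GenTree.Node 1 [:: form_code a; form_code b]
  | FAmp a b => GenTree.Node 2 [:: form_code a; form_code b]
  | FImp a b => GenTree.Node 3 [:: form_code a; form_code b]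
  | FZero => GenTree.Node 4 [::]
  | FBox a => GenTree.Node 5 [:: form_code a]
  end.
Fixpoint form_decode (t : GenTree.tree nat) : form :=
  match t with
  | GenTree.Leaf n => FVar n
  | GenTree.Node 0 [:: a; b] => FAnd (form_decode a) (form_decode b)
  | GenTree.Node 1 [:: a; b] => FOr (form_decode a) (form_decode b)
  | GenTree.Node 2 [:: a; b] => FAmp (form_decode a) (form_decode b)
  | GenTree.Node 3 [:: a; b] => FImp (form_decode a) (form_decode b)
  | GenTree.Node 5 [:: a] => FBox (form_decode a)
  | _ => FZero
  end.
Lemma form_codeK : cancel form_code form_decode.
Proof. by elim=> //= [a -> b ->|a -> b ->|a -> b ->|a -> b ->|a ->]. Qed.
HB.instance Definition _ := Choice.copy form (can_type form_codeK).

Fixpoint boxes (f : form) : nat :=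
  match f with
  | FAnd a b | FOr a b | FAmp a b | FImp a b => boxes a + boxes b
  | FBox a => (boxes a).+1
  | _ => 0
  end.

(* bodies of the outermost boxes *)
Fixpoint ob (f : form) : seq form :=
  match f with
  | FAnd a b | FOr a b | FAmp a b | FImp a b => ob a ++ ob b
  | FBox a => [:: a]
  | _ => [::]
  end.

Definition bxs (F : seq form) : nat := sumn [seq boxes f | f <- F].
Definition obs (F : seq form) : seq form := flatten [seq ob f | f <- F].

Lemma bxs_cat F G : bxs (F ++ G) = bxs F + bxs G.
Proof. by rewrite /bxs map_cat sumn_cat. Qed.

Lemma boxesE f : boxes f = size (ob f) + bxs (ob f).
Proof.
by elim: f => //= [a -> b ->|a -> b ->|a -> b ->|a -> b ->|a _];
  rewrite ?size_cat ?bxs_cat /bxs /=; lia.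
Qed.

(** The measure of both recursions over worlds, building a tree and bounding the search: descending
    to a successor removes one box for each successor visited. *)
Lemma bxsE F : bxs F = size (obs F) + bxs (obs F).
Proof.
elim: F => //= f F IH; rewrite -[bxs (f :: F)]/(boxes f + bxs F) IH boxesE.
rewrite -[obs (f :: F)]/(ob f ++ obs F) size_cat bxs_cat; lia.
Qed.

Fixpoint subf (f : form) : seq form :=
  f :: match f with
  | FAnd a b | FOr a b | FAmp a b | FImp a b => subf a ++ subf b
  | FBox a => subf a
  | _ => [::]
  end.

Lemma subf_refl f : f \in subf f. Proof. by case: f => *; rewrite inE eqxx. Qed.

Lemma subf_trans f g h : f \in subf g -> g \in subf h -> f \in subf h.
Proof.
move=> fg; elim: h => /= [n|a IHa b IHb|a IHa b IHb|a IHa b IHb|a IHa b IHb||a IHa];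
  rewrite in_cons => /orP[/eqP e|]; try (by move: fg; rewrite e);
  rewrite ?mem_cat ?in_nil // => h; rewrite in_cons ?mem_cat;
  by [case/orP: h => [/IHa ->|/IHb ->]; rewrite ?orbT | rewrite IHa ?orbT].
Qed.

Lemma ob_sub f g : g \in ob f -> FBox g \in subf f.
Proof.
by elim: f => //= [a IHa b IHb|a IHa b IHb|a IHa b IHb|a IHa b IHb|a _];
  rewrite !(in_cons, mem_cat, in_nil, orbF); [case/orP=> [/IHa ->|/IHb ->]; rewrite ?orbT..|move/eqP=> ->; rewrite eqxx].
Qed.

Inductive wtree (T : Type) : Type := Node (v : nat -> T) (ch : seq (wtree T)).
Definition tval T (t : wtree T) := let: Node v _ := t in v.
Definition tch T (t : wtree T) := let: Node _ ch := t in ch.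

Fixpoint wtree_nested_ind (T : Type) (P : wtree T -> Prop)
    (H : forall v ch, (forall c, List.In c ch -> P c) -> P (Node v ch)) (t : wtree T) : P t :=
  let: Node v ch := t in
  H v ch ((fix F (s : seq (wtree T)) : forall c, List.In c s -> P c :=
    match s with
    | [::] => fun c h => match h with end
    | x :: s' => fun c h => match h with
        | or_introl e => match e with erefl => wtree_nested_ind H x end
        | or_intror h' => F s' c h' end
    end) ch).

Fixpoint nodes T (t : wtree T) : seq (wtree T) :=
  let: Node _ ch := t in t :: flatten [seq nodes c | c <- ch].

Fixpoint tmap T U (h : T -> U) (t : wtree T) : wtree U :=
  let: Node v ch := t in Node (h \o v) [seq tmap h c | c <- ch].

Lemma nodes_refl T (t : wtree T) : List.In t (nodes t).
Proof. by case: t => v ch /=; left. Qed.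

Lemma In_flatten_map (A B : Type) (f : A -> seq B) s y :
  List.In y (flatten [seq f x | x <- s]) <-> exists2 x, List.In x s & List.In y (f x).
Proof.
elim: s => [|x s IH] /=; first by split=> // -[].
rewrite List.in_app_iff IH; split=> [[h|[z h1 h2]]|[z [->|h1] h2]].
- by exists x => //; left.
- by exists z => //; right.
- by left.
- by right; exists z.
Qed.

Lemma nodes_child T (t s c : wtree T) : List.In s (nodes t) -> List.In c (tch s) -> List.In c (nodes t).
Proof.
elim/wtree_nested_ind: t => v ch IH /= [<- /= hc|].
  by right; apply/In_flatten_map; exists c => //; apply: nodes_refl.
move=> /In_flatten_map [d hd hs] hc; right; apply/In_flatten_map; exists d => //.
exact: IH hs hc.
Qed.

Section Evaluation.
Local Open Scope ring_scope.
Variable T : realDomainType.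

(** The fold starts from the first element so that 0 enters only for the empty list. *)
Definition tinf (s : seq T) : T := if s is x :: s' then foldr Num.min x s' else 0.

Fixpoint teval (f : form) (t : wtree T) : T :=
  match f with
  | FVar p => tval t p
  | FAnd a b => Num.min (teval a t) (teval b t)
  | FOr a b => Num.max (teval a t) (teval b t)
  | FAmp a b => teval a t + teval b t
  | FImp a b => teval b t - teval a t
  | FZero => 0
  | FBox a => tinf [seq teval a c | c <- tch t]
  end.

Lemma tinf_mem s : s != [::] -> tinf s \in s.
Proof.
case: s => //= x s _; elim: s => [|y s IH] /=; first by rewrite inE.
rewrite !inE; case: leP => _; first by rewrite eqxx orbT.
by move: IH; rewrite inE => /orP[->|->]; rewrite ?orbT.
Qed.

Lemma tinf_le s x : x \in s -> tinf s <= x.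
Proof.
case: s => //= y s; elim: s => [|z s IH] /=; first by rewrite inE => /eqP ->.
rewrite !inE ge_min => /or3P[h|/eqP ->|h]; rewrite ?lexx // orbC.
  by rewrite IH // inE h.
by rewrite IH // inE h orbT.
Qed.

Lemma tinf_eq s x : x \in s -> (forall y, y \in s -> x <= y) -> tinf s = x.
Proof.
move=> xs h; apply/le_anti; rewrite tinf_le //= h // tinf_mem //.
by case: s xs {h}.
Qed.
End Evaluation.

Lemma In_map_mem (A : Type) (B : eqType) (f : A -> B) s y :
  reflect (exists2 x, List.In x s & y = f x) (y \in [seq f x | x <- s]).
Proof.
elim: s => [|x s IH] /=; first by constructor=> -[].
rewrite inE; case: eqP => [->|ne] /=; first by constructor; exists x => //; left.
apply: (iffP IH) => [[z h1 h2]|[z [<-|h1] h2]]; try by exists z => //; right.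
Qed.

(** * Approximating a model by a finite tree *)

Section Models.
Local Open Scope ring_scope.
Local Open Scope classical_set_scope.
Local Notation R := Rdefinitions.R.
Variables (W : Type) (Rel : W -> W -> Prop) (V : nat -> W -> R) (r : R).
Hypothesis Vr : forall p x, - r <= V p x <= r.
Local Notation ev := (eval Rel V).

(** This makes [inf] over a nonempty set of successors a true greatest lower bound. *)
Lemma eval_bounded f : exists2 B, 0 <= B & forall x, `|ev f x| <= B.
Proof.
have r0 (x : W) : 0 <= r by have := Vr 0%N x; lra.
have minmax (x y B C : R) : `|x| <= B -> `|y| <= C ->
    `|Num.min x y| <= B + C /\ `|Num.max x y| <= B + C.
  move=> h1 h2; have B0 := le_trans (normr_ge0 x) h1; have C0 := le_trans (normr_ge0 y) h2.
  have hx : `|x| <= B + C by apply: (le_trans h1); rewrite lerDl.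
  have hy : `|y| <= B + C by apply: (le_trans h2); rewrite lerDr.
  by split; case: (leP x y).
elim: f => /= [p|a [B B0 hB] b [C C0 hC]|a [B B0 hB] b [C C0 hC]|a [B B0 hB] b [C C0 hC]
  |a [B B0 hB] b [C C0 hC]||a [B B0 hB]].
- by exists `|r| => // x; rewrite (ger0_norm (r0 x)) ler_norml Vr.
- by exists (B + C) => [|x]; [rewrite addr_ge0|have [] := minmax _ _ _ _ (hB x) (hC x)].
- by exists (B + C) => [|x]; [rewrite addr_ge0|have [] := minmax _ _ _ _ (hB x) (hC x)].
- by exists (B + C) => [|x]; [rewrite addr_ge0|apply: le_trans (ler_normD _ _) _; rewrite lerD].
- by exists (B + C) => [|x]; [rewrite addr_ge0|apply: le_trans (ler_normB _ _) _; rewrite addrC lerD].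
- by exists 0 => // x; rewrite normr0.
exists B => // x; set A := (X in inf X).
have [[z [y xy yz]]|nA] := pselect (A !=set0); last first.
  by rewrite inf_out ?normr0 // => -[].
have lbA : lbound A (- B) by move=> w [u _ <-]; have := hB u; rewrite ler_norml => /andP[].
rewrite ler_norml lb_le_inf //=; last by exists z, y.
have : inf A <= z by apply: ge_inf; [exists (- B)|exists y].
by move=> h; apply: (le_trans h); rewrite -yz; have := hB y; rewrite ler_norml => /andP[].
Qed.

Fixpoint leaves (f : form) : nat :=
  match f with
  | FAnd a b | FOr a b | FAmp a b | FImp a b => (leaves a + leaves b)%N
  | _ => 1
  end.

(** No connective produces an error above the sum of the errors of its arguments, so there is one
    [d] for each leaf. *)
Lemma eval_lipschitz (t : wtree R) x (d : R) f : 0 <= d ->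
  (forall p, tval t p = V p x) ->
  (forall g, g \in ob f -> `|teval (FBox g) t - ev (FBox g) x| <= d) ->
  `|teval f t - ev f x| <= d *+ leaves f.
Proof.
move=> d0 hV; have lf0 g : 0 <= d *+ leaves g by rewrite mulrn_wge0.
elim: f => [p|a IHa b IHb|a IHa b IHb|a IHa b IHb|a IHa b IHb||a IHa] hob.
all: try (have {}IHa : `|teval a t - ev a x| <= d *+ leaves a
            by apply: IHa => g hg; apply: hob; rewrite /= mem_cat hg).
all: try (have {}IHb : `|teval b t - ev b x| <= d *+ leaves b
            by apply: IHb => g hg; apply: hob; rewrite /= mem_cat hg orbT).
all: rewrite /= ?mulrnDr ?RplusE ?RminusE.
- by rewrite hV subrr normr0 mulr1n.
- move: IHa IHb (lf0 a) (lf0 b); move: (d *+ leaves a) (d *+ leaves b) => ca cb.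
  rewrite !ler_norml => /andP[h1 h2] /andP[h3 h4] h5 h6.
  by case: (leP (teval a t)) => ?; case: (leP (ev a x)) => ?; apply/andP; split; lra.
- move: IHa IHb (lf0 a) (lf0 b); move: (d *+ leaves a) (d *+ leaves b) => ca cb.
  rewrite !ler_norml => /andP[h1 h2] /andP[h3 h4] h5 h6.
  by case: (leP (teval a t)) => ?; case: (leP (ev a x)) => ?; apply/andP; split; lra.
- move: IHa IHb; move: (d *+ leaves a) (d *+ leaves b) => ca cb.
  rewrite !ler_norml => /andP[h1 h2] /andP[h3 h4].
  by apply/andP; split; lra.
- move: IHa IHb; move: (d *+ leaves a) (d *+ leaves b) => ca cb.
  rewrite !ler_norml => /andP[h1 h2] /andP[h3 h4].
  by apply/andP; split; lra.
- by rewrite subrr normr0 mulr1n.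
- by rewrite mulr1n; apply: hob; rewrite /= inE.
Qed.

Lemma list_witness (I : eqType) (P : I -> wtree R -> Prop) (B : nat) (s : seq I) :
  (forall i, i \in s -> exists2 c, P i c & size (nodes c) <= B)%N ->
  exists cs : seq (wtree R), [/\ forall c, List.In c cs -> exists2 i, i \in s & P i c,
    forall i, i \in s -> exists2 c, List.In c cs & P i c &
    (size (flatten [seq nodes c | c <- cs]) <= size s * B)%N].
Proof.
elim: s => [|i s IH] h; first by exists [::]; split.
have [|cs [h1 h2 h3]] := IH; first by move=> j js; apply: h; rewrite inE js orbT.
have [c hc hB] := h i (mem_head _ _); exists (c :: cs); split=> /=.
- move=> c' [<-|/h1 [j js hj]]; first by exists i => //; rewrite mem_head.
  by exists j => //; rewrite inE js orbT.
- move=> j; rewrite inE => /orP[/eqP ->|/h2 [c' hc' hj]]; first by exists c => //; left.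
  by exists c' => //; right.
- by rewrite size_cat mulSn leq_add.
Qed.

(** The child chosen for a box comes close to the infimum of that box, and each child approximates
    all of [obs F] at a genuine successor, so none falls much below any of the infima. The size
    bound closes because [1 + q * 4 ^ b <= 4 ^ (q + b)] when [q] is positive. *)
Lemma finite_approx (F : seq form) x (eps : R) : 0 < eps ->
  exists2 t : wtree R, (size (nodes t) <= 4 ^ bxs F)%N &
    forall f, f \in F -> `|teval f t - ev f x| <= eps.
Proof.
have [k] := ubnP (bxs F); elim: k F x eps => // k IH F x eps hk eps0.
pose L := (\sum_(f <- F) leaves f).+1; pose d := eps / L%:R.
have d0 : 0 < d by rewrite divr_gt0 // ltr0n.
have leL f : f \in F -> (leaves f <= L)%N.
  by move=> fF; rewrite /L (big_rem f fF) /=; lia.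
have fin (t : wtree R) : (forall p, tval t p = V p x) ->
    (forall g, g \in obs F -> `|teval (FBox g) t - ev (FBox g) x| <= d) ->
    forall f, f \in F -> `|teval f t - ev f x| <= eps.
  move=> hV hob f fF; apply: (le_trans (eval_lipschitz (ltW d0) hV _)).
    by move=> g hg; apply: hob; apply/flatten_mapP; exists f.
  apply: (@le_trans _ _ (d *+ L)); first by apply: ler_wpMn2l; [exact: ltW|exact: leL].
  by rewrite /d -mulr_natr divfK // pnatr_eq0.
pose G := obs F.
have [G0|Gn] := eqVneq G [::].
  exists (Node (fun p => V p x) [::]); first by rewrite expn_gt0.
  by apply: fin => // g; rewrite -/G G0.
have bG : (bxs F = size G + bxs G)%N := bxsE F.
have szG : (0 < size G)%N by rewrite lt0n size_eq0.
have [[y0 xy0]|nosucc] := pselect (exists y, Rel x y); last first.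
  exists (Node (fun p => V p x) [::]); first by rewrite expn_gt0.
  apply: fin => // g _ /=; rewrite (_ : [set _ | _ in _] = set0) ?inf0 ?subrr ?normr0 ?(ltW d0) //.
  by apply/seteqP; split=> // z [y xy _]; case: nosucc; exists y.
pose A g := [set ev g y | y in [set y | Rel x y]].
have infA g : has_inf (A g).
  split; first by exists (ev g y0), y0.
  have [B _ hB] := eval_bounded g; exists (- B) => z [y _ <-].
  by have := hB y; rewrite ler_norml => /andP[].
have d2 : 0 < d / 2 by rewrite divr_gt0.
pose P g c := exists y, [/\ Rel x y, ev g y <= inf (A g) + d / 2 &
  forall f, f \in G -> `|teval f c - ev f y| <= d / 2].
have [|cs [h1 h2 h3]] := @list_witness _ P (4 ^ bxs G) G.
  move=> g gG; have [z [y xy <-] hz] := inf_adherent d2 (infA g).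
  have [|c hc hh] := IH G y (d / 2) _ d2; first by lia.
  by exists c => //; exists y; split=> //; apply: ltW.
exists (Node (fun p => V p x) cs).
  rewrite /=; apply: (@leq_trans (1 + size G * 4 ^ bxs G)%N); first by rewrite add1n ltnS.
  rewrite bG expnD; have : (1 + size G <= 4 ^ size G)%N.
    by elim: (size G) => // q IHq; rewrite expnS; lia.
  have : (0 < 4 ^ bxs G)%N by rewrite expn_gt0.
  by move: (4 ^ _)%N (4 ^ _)%N => p q; nia.
apply: fin => // g gG /=.
have [c hc [y [xy hy1 hy2]]] := h2 g gG.
rewrite ler_norml; apply/andP; split.
  have : tinf [seq teval g c | c <- cs] \in [seq teval g c | c <- cs].
    by apply: tinf_mem; case: (cs) hc.
  case/In_map_mem=> c' hc' ->; have [g' g'G [y' [xy' _ hy']]] := h1 c' hc'.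
  have := hy' g gG; rewrite ler_norml => /andP[k1 _].
  have : inf (A g) <= ev g y' by apply: ge_inf; [have [] := infA g|exists y'].
  by rewrite -/(A g) => k2; lra.
have : tinf [seq teval g c | c <- cs] <= teval g c by apply: tinf_le; apply/In_map_mem; exists c.
have := hy2 g gG; rewrite ler_norml => /andP[_ k1] k2.
by rewrite -/(A g); lra.
Qed.
End Models.

(** * Refuting trees with small integer values *)

Section IntegerTrees.
Local Open Scope ring_scope.
Local Notation R := Rdefinitions.R.

Lemma nodes_tmap T U (h : T -> U) (t : wtree T) : nodes (tmap h t) = [seq tmap h s | s <- nodes t].
Proof.
elim/wtree_nested_ind: t => v ch IH /=; congr (_ :: _).
elim: ch IH => //= c ch IHc IH; rewrite map_cat IH; last by left.
by rewrite IHc // => d hd; apply: IH; right.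
Qed.

Lemma tch_tmap T U (h : T -> U) (t : wtree T) : tch (tmap h t) = [seq tmap h s | s <- tch t].
Proof. by case: t. Qed.

Lemma tval_tmap T U (h : T -> U) (t : wtree T) p : tval (tmap h t) p = h (tval t p).
Proof. by case: t. Qed.

Lemma subf_cases f g : f \in subf g ->
  match f with
  | FAnd a b | FOr a b | FAmp a b | FImp a b => (a \in subf g) && (b \in subf g)
  | FBox a => a \in subf g
  | _ => true
  end.
Proof.
move=> fg; case: f fg => // [a b|a b|a b|a b|a] fg; rewrite ?(@subf_trans a _ _ _ fg) ?(@subf_trans b _ _ _ fg) //.
all: by rewrite /= in_cons ?mem_cat subf_refl ?orbT.
Qed.

Definition vals (phi : form) (t : wtree R) : seq R :=
  0 :: [seq teval f s | s <- nodes t, f <- subf phi].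

Lemma vals_mem phi t s f : List.In s (nodes t) -> f \in subf phi -> teval f s \in vals phi t.
Proof.
move=> hs hf; rewrite in_cons; apply/orP; right.
elim: (nodes t) hs => //= s' ns IH [<-|/IH h]; rewrite mem_cat ?h ?orbT //.
by rewrite map_f.
Qed.

(** All values of subformulas at nodes lie in [vals phi t], so each connective only meets
    comparisons and sums that [h] preserves; a finite infimum is attained, and monotonicity keeps it
    at the same child. *)
Lemma teval_tmap (h : R -> int) phi t :
  {in vals phi t &, forall x y, x <= y -> h x <= h y} ->
  {in vals phi t & &, forall x y z, x + y = z -> h x + h y = h z} ->
  forall s f, List.In s (nodes t) -> f \in subf phi -> teval f (tmap h s) = h (teval f s).
Proof.
move=> hmono hadd s f; have mem := @vals_mem phi t; have h0 : h 0 = 0.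
  have z : 0 \in vals phi t by rewrite mem_head.
  have := hadd 0 0 0 z z z (addr0 0); move/eqP; rewrite -subr_eq0 addrK => /eqP; exact.
elim: f s => [p|a IHa b IHb|a IHa b IHb|a IHa b IHb|a IHa b IHb||a IHa] s hs hf;
  have := subf_cases hf => /=; rewrite ?tval_tmap //.
1-4: move=> /andP[ha hb]; rewrite (IHa _ hs ha) (IHb _ hs hb);
  have ma := mem _ _ hs ha; have mb := mem _ _ hs hb.
- case: (leP (teval a s) (teval b s)) => hle; first by apply/min_idPl/hmono.
  by apply/min_idPr/hmono => //; apply: ltW.
- case: (leP (teval a s) (teval b s)) => hle; first by apply/max_idPr/hmono.
  by apply/max_idPl/hmono => //; apply: ltW.
- by apply: hadd => //; apply: (mem _ _ hs hf).
(* The difference is itself the value of a subformula, so the value of [b] is an existing sum. *)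
- apply/eqP; rewrite subr_eq; apply/eqP/esym; apply: hadd => //; first exact: (mem _ _ hs hf).
  by rewrite subrK.
move=> ha; rewrite tch_tmap -map_comp.
have E c : List.In c (tch s) -> teval a (tmap h c) = h (teval a c).
  by move=> hc; apply: IHa => //; apply: nodes_child hs hc.
have Ein c : List.In c (tch s) -> teval a c \in vals phi t.
  by move=> hc; apply: mem => //; apply: nodes_child hs hc.
case: (tch s) E Ein => [|c cs] E Ein; first by rewrite h0.
have : tinf [seq teval a x | x <- c :: cs] \in [seq teval a x | x <- c :: cs] by apply: tinf_mem.
case/In_map_mem=> d hd dE; rewrite -/(map _ (c :: cs)) -/(map _ (c :: cs)) dE.
apply: tinf_eq; first by apply/In_map_mem; exists d => //=; rewrite E.
move=> y /In_map_mem [d' hd' ->]; rewrite /= E //; apply: hmono; rewrite ?Ein //.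
by rewrite -dE; apply: tinf_le; apply/In_map_mem; exists d'.
Qed.

Definition bnd (k : nat) : nat := k * 3 ^ k.

Lemma refuting_tree phi : ~ KA_valid phi ->
  exists t : wtree int, teval phi t < 0 /\
    forall s f, List.In s (nodes t) -> f \in subf phi ->
      `|teval f s| <= (bnd (4 ^ boxes phi * size (subf phi)).+1)%:Z.
Proof.
move=> nval.
have [W [Rel [V [r [r0 [Vr [x hx]]]]]]] : exists W Rel (V : nat -> W -> R) r, 0 <= r /\
    (forall p x, - r <= V p x <= r) /\ exists x, eval Rel V phi x < 0.
  apply: contrapT => h; apply: nval => W Rel V r r0 Vr x; rewrite leNgt; apply/negP => hx.
  by apply: h; exists W, Rel, V, r; split=> //; split=> //; exists x.
(* An error of half the distance to 0 leaves the value negative. *)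
have eps0 : 0 < - eval Rel V phi x / 2 by rewrite divr_gt0 ?oppr_gt0.
have [t szt ht] := @finite_approx W Rel V r Vr [:: phi] x _ eps0.
have tneg : teval phi t < 0.
  have := ht phi (mem_head _ _); rewrite ler_norml => /andP[_ h].
  by move: h hx; move: (eval _ _ _ _) => e; lra.
have [||h [h0 hmono hadd hb]] := @small_hom _ (vals phi t) (teval phi t) _ _ tneg.
- by rewrite mem_head.
- by apply: vals_mem; [apply: nodes_refl|apply: subf_refl].
have E := teval_tmap hmono hadd.
exists (tmap h t); split; first by rewrite E ?nodes_refl ?subf_refl //; apply: nodes_refl.
move=> s f; rewrite nodes_tmap => /List.in_map_iff [s' [<- hs']] hf; rewrite E //.
apply: le_trans (hb _) _; rewrite lez_nat /bnd.
have sz : (size (vals phi t) <= (4 ^ boxes phi * size (subf phi)).+1)%N.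
  rewrite /= size_allpairs ltnS leq_mul2r; apply/orP; right.
  by move: szt; rewrite /bxs /= addn0.
by rewrite leq_mul // leq_exp2l.
Qed.

Fixpoint maxvar (f : form) : nat :=
  match f with
  | FVar p => p.+1
  | FAnd a b | FOr a b | FAmp a b | FImp a b => maxn (maxvar a) (maxvar b)
  | FBox a => maxvar a
  | FZero => 0
  end.

Lemma refutation_of_tree phi (t : wtree int) : teval phi t < 0 -> ~ KA_valid phi.
Proof.
move=> neg val; pose P := maxvar phi.
pose r : nat := \sum_(s <- nodes t) \sum_(p < P) `|tval s p|%N.
have hr s p : List.In s (nodes t) -> (p < P)%N -> (`|tval s p| <= r)%N.
  move=> hs hp; rewrite /r; elim: (nodes t) hs => //= s' ns IH [->|/IH h]; rewrite big_cons.
    by rewrite (bigD1 (Ordinal hp)) //=; lia.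
  by apply: leq_trans h _; rewrite leq_addl.
pose Rel (x y : wtree int) := List.In y (tch x).
(* The worlds are all integer trees, yet the valuation must be bounded on all of them, so values
   above [r] are replaced by 0. At nodes of [t] and for variables below [maxvar phi] the choice of
   [r] prevents any replacement. *)
pose V p (x : wtree int) : R := if (`|tval x p| <= r)%N then (tval x p)%:~R else 0.
have E f s : List.In s (nodes t) -> (maxvar f <= P)%N -> eval Rel V f s = (teval f s)%:~R.
  elim: f s => [p|a IHa b IHb|a IHa b IHb|a IHa b IHb|a IHa b IHb||a IHa] s hs /=.
  1: by move=> hp; rewrite /V hr.
  1-4: rewrite geq_max => /andP[ha hb]; rewrite (IHa _ hs ha) (IHb _ hs hb).
  - by rewrite !minEle ler_int; case: ifP.
  - by rewrite !maxEle ler_int; case: ifP.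
  - by rewrite RplusE rmorphD.
  - by rewrite RminusE rmorphB.
  - by [].
  move=> ha; set A := (X in inf X).
  have Ac c : List.In c (tch s) -> eval Rel V a c = (teval a c)%:~R.
    by move=> hc; apply: IHa => //; apply: nodes_child hs hc.
  case Ech: (tch s) => [|c cs].
    rewrite (_ : A = classical_sets.set0) ?inf0 //.
    by apply/seteqP; split=> // z [y]; rewrite /= /Rel Ech.
  set l := [seq _ | _ <- _]; have : tinf l \in l by apply: tinf_mem.
  rewrite /l -Ech; case/In_map_mem=> d hd dE.
  apply/le_anti/andP; split.
    rewrite dE -Ac //; apply: ge_inf; last by exists d.
    exists (tinf [seq teval a x | x <- tch s])%:~R => z [y hy <-]; rewrite Ac // ler_int.
    by apply: tinf_le; apply/In_map_mem; exists y.
  apply: lb_le_inf; first by exists (eval Rel V a d), d.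
  move=> z [y hy <-]; rewrite Ac // ler_int.
  by apply: tinf_le; apply/In_map_mem; exists y.
have := val _ Rel V r%:R (ler0n _ r) _ t.
rewrite E ?nodes_refl //; last exact: nodes_refl.
rewrite ler0z leNgt neg => /(_ _) h; have : false; last by [].
apply: h => p x; rewrite /V; case: ifP => h; last by rewrite oppr_le0 ler0n.
rewrite -ler_norml -intr_norm -[r%:R]/(r%:Z%:~R) ler_int; lia.
Qed.
End IntegerTrees.

(** * The refutation program: alphabet, procedures and their bodies *)

Definition sym_list : seq sym :=
  [:: SVar; SBit0; SBit1; SAnd; SOr; SAmp; SImp; SZero; SBox].
Definition sym_code (s : sym) : 'I_9 :=
  match s with
  | SVar => @Ordinal 9 0 isT | SBit0 => @Ordinal 9 1 isT | SBit1 => @Ordinal 9 2 isT | SAnd => @Ordinal 9 3 isT | SOr => @Ordinal 9 4 isT | SAmp => @Ordinal 9 5 isT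
  | SImp => @Ordinal 9 6 isT | SZero => @Ordinal 9 7 isT | SBox => @Ordinal 9 8 isT end.
Lemma sym_codeK : cancel sym_code (nth SVar sym_list).
Proof. by case. Qed.
HB.instance Definition _ := Finite.copy sym (can_type sym_codeK).

(** [MEnd] closes the name of a variable, [MCol] separates a formula from its number, [MDot] closes
    a number, [MHash] closes a list of obligations or an environment, [MDol] closes the list of
    boxes that await a successor, and [MGe], [MLe] open an obligation bounding a formula from below
    or above. *)
Inductive mark := MEnd | MCol | MDot | MHash | MDol | MGe | MLe.
Definition mark_code (s : mark) : 'I_7 :=
  match s with
  | MEnd => @Ordinal 7 0 isT | MCol => @Ordinal 7 1 isT | MDot => @Ordinal 7 2 isT | MHash => @Ordinal 7 3 isT | MDol => @Ordinal 7 4 isT | MGe => @Ordinal 7 5 isT | MLe => @Ordinal 7 6 isT end.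
Lemma mark_codeK : cancel mark_code (nth MEnd [:: MEnd; MCol; MDot; MHash; MDol; MGe; MLe]).
Proof. by case. Qed.
HB.instance Definition _ := Finite.copy mark (can_type mark_codeK).

(** Stacks for the input, for formulas and obligations, for the environments along the current
    branch, for computed values, and for the operand moved aside during a pass. *)
Inductive kind := KI | KO | KE | KV | KA.
Definition kind_code (s : kind) : 'I_5 :=
  match s with KI => @Ordinal 5 0 isT | KO => @Ordinal 5 1 isT | KE => @Ordinal 5 2 isT | KV => @Ordinal 5 3 isT | KA => @Ordinal 5 4 isT end.
Lemma kind_codeK : cancel kind_code (nth KI [:: KI; KO; KE; KV; KA]).
Proof. by case. Qed.
HB.instance Definition _ := Finite.copy kind (can_type kind_codeK).

(* Signed binary digits: [None] is 0, [Some true] is 1, [Some false] is -1. *)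
Notation digit3 := (option bool).
Definition glyph : predArgType := (sym + mark + digit3)%type.
HB.instance Definition _ := Finite.on glyph.
Notation LS s := (inl (inl s)).
Notation LM m := (inl (inr m)).
Notation LD d := (inr d).

(* Synchronous passes over a number on [KA] and a number on [KV]: sum,
   difference, or comparison ([true]: [KA <= KV]) optionally returning the
   first or second number. *)
Inductive mode := MAdd | MSub | MCmp of bool & option bool.
Definition mode_code (m : mode) : option (option (bool * option bool)) :=
  match m with MAdd => None | MSub => Some None | MCmp d o => Some (Some (d, o)) end.
Definition mode_decode x : mode :=
  match x with None => MAdd | Some None => MSub | Some (Some (d, o)) => MCmp d o end.
Lemma mode_codeK : cancel mode_code mode_decode. Proof. by case. Qed.
HB.instance Definition _ := Finite.copy mode (can_type mode_codeK).

Inductive pname :=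
  | Main | Par | ParB | Bad | BadB | Bad0 | Rest | Stop
  | GEnv | GDig | GLeaf | GVar | GBit | GForm
  | Ev | Look | Match | CopyVal | Neq | Skip
  | Sat | Obl | Col | Dead | Drop | DropK | Zeros | Loop | Dol | DropE.
Definition pname_list :=
  [:: Main; Par; ParB; Bad; BadB; Bad0; Rest; Stop; GEnv; GDig; GLeaf; GVar; GBit; GForm;
      Ev; Look; Match; CopyVal; Neq; Skip; Sat; Obl; Col; Dead; Drop; DropK; Zeros; Loop; Dol; DropE].
Definition pname_code (p : pname) : 'I_30 :=
  match p with
  | Main => @Ordinal 30 0 isT | Par => @Ordinal 30 1 isT | ParB => @Ordinal 30 2 isT | Bad => @Ordinal 30 3 isT | BadB => @Ordinal 30 4 isT | Bad0 => @Ordinal 30 5 isT | Rest => @Ordinal 30 6 isT | Stop => @Ordinal 30 7 isT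
  | GEnv => @Ordinal 30 8 isT | GDig => @Ordinal 30 9 isT | GLeaf => @Ordinal 30 10 isT | GVar => @Ordinal 30 11 isT | GBit => @Ordinal 30 12 isT | GForm => @Ordinal 30 13 isT
  | Ev => @Ordinal 30 14 isT | Look => @Ordinal 30 15 isT | Match => @Ordinal 30 16 isT | CopyVal => @Ordinal 30 17 isT | Neq => @Ordinal 30 18 isT | Skip => @Ordinal 30 19 isT
  | Sat => @Ordinal 30 20 isT | Obl => @Ordinal 30 21 isT | Col => @Ordinal 30 22 isT | Dead => @Ordinal 30 23 isT | Drop => @Ordinal 30 24 isT | DropK => @Ordinal 30 25 isT | Zeros => @Ordinal 30 26 isT
  | Loop => @Ordinal 30 27 isT | Dol => @Ordinal 30 28 isT | DropE => @Ordinal 30 29 isT end.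
Lemma pname_codeK : cancel pname_code (nth Main pname_list).
Proof. by case. Qed.
HB.instance Definition _ := Finite.copy pname (can_type pname_codeK).

Inductive proc :=
  | PN of pname | GZ of kind | Mv of kind | Bin of sym
  | Sync of mode & 'I_7 | Sync2 of mode & 'I_7 & digit3 | SyncE of mode & 'I_7
  | Match2 of glyph | Neq2 of glyph | CB of bool | CS of bool | CK of bool.
Definition proc_code (p : proc) :
    pname + (kind + kind) + (sym + (mode * 'I_7 + (mode * 'I_7 * digit3 + mode * 'I_7)))
    + (glyph + glyph) + (bool + (bool + bool)) :=
  match p with
  | PN p => inl (inl (inl (inl p)))
  | GZ k => inl (inl (inl (inr (inl k))))
  | Mv k => inl (inl (inl (inr (inr k))))
  | Bin s => inl (inl (inr (inl s)))
  | Sync m c => inl (inl (inr (inr (inl (m, c)))))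
  | Sync2 m c d => inl (inl (inr (inr (inr (inl (m, c, d))))))
  | SyncE m c => inl (inl (inr (inr (inr (inr (m, c))))))
  | Match2 x => inl (inr (inl x))
  | Neq2 x => inl (inr (inr x))
  | CB b => inr (inl b)
  | CS b => inr (inr (inl b))
  | CK b => inr (inr (inr b))
  end.
Definition proc_decode x : proc :=
  match x with
  | inl (inl (inl (inl p))) => PN p
  | inl (inl (inl (inr (inl k)))) => GZ k
  | inl (inl (inl (inr (inr k)))) => Mv k
  | inl (inl (inr (inl s))) => Bin s
  | inl (inl (inr (inr (inl (m, c))))) => Sync m c
  | inl (inl (inr (inr (inr (inl (m, c, d)))))) => Sync2 m c d
  | inl (inl (inr (inr (inr (inr (m, c)))))) => SyncE m c
  | inl (inr (inl x)) => Match2 x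
  | inl (inr (inr x)) => Neq2 x
  | inr (inl b) => CB b
  | inr (inr (inl b)) => CS b
  | inr (inr (inr b)) => CK b
  end.
Lemma proc_codeK : cancel proc_code proc_decode. Proof. by case. Qed.
HB.instance Definition _ := Finite.copy proc (can_type proc_codeK).

Definition rdp (c : proc) : option kind :=
  match c with
  | PN p => match p with
    | Main | GEnv | GDig | GLeaf | GVar | GBit | GForm | Look | Sat | Loop => None
    | Par | ParB | Bad | BadB | Bad0 | Rest | Stop => Some KI
    | Ev | Neq | Obl | Col | Dol => Some KO
    | Match | CopyVal | Skip | Dead | Drop | DropK | Zeros | DropE => Some KE
    end
  | GZ _ | Bin _ => None
  | Mv k => Some k
  | Sync _ _ => Some KA
  | Sync2 _ _ _ | SyncE _ _ => Some KV
  | Match2 _ => Some KO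
  | Neq2 _ | CB _ | CS _ | CK _ => Some KE
  end.

Definition dv (d : digit3) : int := match d with None => 0 | Some true => 1 | Some false => -1 end.
(** Carries range from -3 to 3: adding three signed digits gives at most 6 in absolute value, and
    halving returns to at most 3. *)
Definition cz (c : 'I_7) : int := ((c : nat)%:Z - 3%:Z)%R.
Definition c0 : 'I_7 := @Ordinal 7 3 isT.

(** The result digit and the new carry are guessed and checked. In a comparison the carry is halved
    rounding down; dropping a remainder 0 or 1 does not change whether the total is nonnegative. *)
Definition okstep (m : mode) (c : 'I_7) (a b r : digit3) (c' : 'I_7) : bool :=
  match m with
  | MAdd => (cz c + dv a + dv b - dv r == 2 * cz c')%R
  | MSub => (cz c + dv b - dv a - dv r == 2 * cz c')%R
  | MCmp dir o =>
      let x := (cz c + (if dir then dv b - dv a else dv a - dv b) - 2 * cz c')%R in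
      ((x == 0%R) || (x == 1%R)) &&
      (r == match o with Some true => a | Some false => b | None => None end)
  end.

Definition okend (m : mode) (c : 'I_7) : bool :=
  if m is MCmp _ _ then (0 <= cz c)%R else cz c == 0%R.

Definition quiet (m : mode) : bool := if m is MCmp _ None then true else false.

Definition iskey (x : glyph) : bool :=
  match x with LS _ | LM MEnd => true | _ => false end.
Definition isbit (x : glyph) : bool :=
  match x with LS SBit0 | LS SBit1 => true | _ => false end.

Local Notation ins := (instr kind glyph proc).
Notation call p := (inl (PN p) : instr kind glyph proc).
Notation push k x := (inr (k, x : glyph) : instr kind glyph proc).

(** [Main] succeeds if parsing fails ([Bad]), if symbols remain after a formula ([Par], [Rest]), or
    if the formula can take a value at most -1 ([Sat]). [Sat] guesses an environment, that is,
    values for variables and boxed formulas, and checks the obligations of the world against it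
    ([Obl]). The world is then either a dead end, whose boxes must be 0 ([Dead]), or [CB true] lists
    an upper bound for each box, and [Loop] visits one successor for each of them after [CB false]
    has added the lower bounds for all boxes. A letter that a procedure does not expect has no body,
    and the branch dies. What must survive a reading pass is pushed back by instructions placed
    after the recursive call. *)
Definition body (c : proc) (x : option glyph) : seq (seq ins) :=
  match c, x with
  | PN Main, _ =>
      [:: [:: call Bad];
          [:: call Par; call Rest];
          [:: push KO (LM MHash); push KO (LM MDot); inl (GZ KO); push KO (LD (Some false));
              push KO (LM MCol); call Par; call Stop; push KO (LM MLe); call Sat]]
  | PN Par, Some (LS s) =>
      match s with
      | SAnd | SOr | SAmp | SImp => [:: [:: call Par; call Par; push KO (LS s)]]
      | SBox => [:: [:: call Par; push KO (LS SBox)]]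
      | SZero => [:: [:: push KO (LS SZero)]]
      | SVar => [:: [:: call ParB; push KO (LS SVar)]]
      | _ => [::]
      end
  | PN ParB, Some y =>
      if isbit y then [:: [:: call ParB; push KO y]]
      else [:: [:: push KI y; push KO (LM MEnd)]]
  | PN ParB, None => [:: [:: push KO (LM MEnd)]]
  | PN Bad, None => [:: [::]]
  | PN Bad, Some (LS s) =>
      match s with
      | SBit0 | SBit1 => [:: [::]]
      | SAnd | SOr | SAmp | SImp => [:: [:: call Bad]; [:: call Par; call Bad]]
      | SBox => [:: [:: call Bad]]
      | SVar => [:: [:: call BadB]]
      | SZero => [::]
      end
  | PN BadB, None => [:: [::]]
  | PN BadB, Some (LS SBit0) => [:: [:: call Bad0]]
  | PN BadB, Some (LS SBit1) => [::]
  | PN BadB, Some _ => [:: [::]]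
  | PN Bad0, Some y => if isbit y then [:: [::]] else [::]
  | PN Rest, Some _ => [:: [::]]
  | PN Stop, None => [:: [::]]
  | PN GEnv, _ =>
      [:: [::]; [:: push KE (LM MDot); call GDig; push KE (LM MCol); call GLeaf; call GEnv]]
  | PN GDig, _ => [:: [::]; [:: push KE (LD None); call GDig];
      [:: push KE (LD (Some true)); call GDig]; [:: push KE (LD (Some false)); call GDig]]
  | PN GLeaf, _ => [:: [:: call GVar]; [:: call GForm; push KE (LS SBox)]]
  | PN GVar, _ =>
      [:: [:: push KE (LM MEnd); push KE (LS SBit0); push KE (LS SVar)];
          [:: push KE (LM MEnd); call GBit; push KE (LS SBit1); push KE (LS SVar)]]
  | PN GBit, _ => [:: [::]; [:: push KE (LS SBit0); call GBit]; [:: push KE (LS SBit1); call GBit]]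
  | PN GForm, _ =>
      [:: [:: call GLeaf]; [:: push KE (LS SZero)];
          [:: call GForm; call GForm; push KE (LS SAnd)];
          [:: call GForm; call GForm; push KE (LS SOr)];
          [:: call GForm; call GForm; push KE (LS SAmp)];
          [:: call GForm; call GForm; push KE (LS SImp)]]
  | PN Ev, Some (LS s) =>
      match s with
      | SAnd | SOr | SAmp | SImp => [:: [:: call Ev; call Ev; inl (Bin s)]]
      | SZero => [:: [:: push KV (LM MDot); inl (GZ KV)]]
      | SVar | SBox => [:: [:: push KO (LS s); call Look]]
      | _ => [::]
      end
  | PN Look, _ => [:: [:: call Match]; [:: call Neq; call Skip]]
  | PN Match, Some (LM MCol) => [:: [:: call CopyVal; push KE (LM MCol)]]
  | PN Match, Some y => if iskey y then [:: [:: inl (Match2 y)]] else [::]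
  | PN CopyVal, Some (LD d) => [:: [:: call CopyVal; push KE (LD d); push KV (LD d)]]
  | PN CopyVal, Some (LM MDot) => [:: [:: push KE (LM MDot); push KV (LM MDot)]]
  | PN Neq, Some y => if iskey y then [:: [:: inl (Neq2 y)]] else [::]
  | PN Skip, Some (LM MDot) => [:: [:: call Look; push KE (LM MDot)]]
  | PN Skip, Some y => [:: [:: call Skip; push KE y]]
  | PN Sat, _ =>
      [:: [:: push KE (LM MHash); call GEnv; call Obl; call Dead];
          [:: push KE (LM MHash); call GEnv; call Obl; push KO (LM MDol);
              inl (CB true); call Loop]]
  | PN Obl, Some (LM MHash) => [:: [::]]
  | PN Obl, Some (LM MGe) =>
      [:: [:: call Ev; call Col; inl (Mv KO); inl (Sync (MCmp true None) c0); call Obl]]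
  | PN Obl, Some (LM MLe) =>
      [:: [:: call Ev; call Col; inl (Mv KO); inl (Sync (MCmp false None) c0); call Obl]]
  | PN Col, Some (LM MCol) => [:: [::]]
  | PN Dead, Some (LM MHash) => [:: [::]]
  | PN Dead, Some (LS SVar) => [:: [:: call Drop; call Dead]]
  | PN Dead, Some (LS SBox) => [:: [:: call DropK; call Zeros; call Dead]]
  | PN Drop, Some (LM MDot) => [:: [::]]
  | PN Drop, Some _ => [:: [:: call Drop]]
  | PN DropK, Some (LM MCol) => [:: [::]]
  | PN DropK, Some _ => [:: [:: call DropK]]
  | PN Zeros, Some (LM MDot) => [:: [::]]
  | PN Zeros, Some (LD None) => [:: [:: call Zeros]]
  | PN Loop, _ => [:: [:: call Dol; call DropE]; [:: inl (CB false); call Sat; call Loop]]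
  | PN Dol, Some (LM MDol) => [:: [::]]
  | PN DropE, Some (LM MHash) => [:: [::]]
  | PN DropE, Some _ => [:: [:: call DropE]]
  | GZ k, _ => [:: [::]; [:: push k (LD None); inl (GZ k)]]
  | Mv k, Some (LD d) => [:: [:: inl (Mv k); push KA (LD d)]]
  | Mv k, Some (LM MDot) => [:: [:: push KA (LM MDot)]]
  | Bin SAnd, _ => [:: [:: inl (Mv KV); inl (Sync (MCmp true (Some true)) c0)];
                       [:: inl (Mv KV); inl (Sync (MCmp false (Some false)) c0)]]
  | Bin SOr, _ => [:: [:: inl (Mv KV); inl (Sync (MCmp true (Some false)) c0)];
                      [:: inl (Mv KV); inl (Sync (MCmp false (Some true)) c0)]]
  | Bin SAmp, _ => [:: [:: inl (Mv KV); inl (Sync MAdd c0)]]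
  | Bin SImp, _ => [:: [:: inl (Mv KV); inl (Sync MSub c0)]]
  | Sync m c, Some (LD a) => [:: [:: inl (Sync2 m c a)]]
  | Sync m c, Some (LM MDot) => [:: [:: inl (SyncE m c)]]
  | Sync2 m c a, Some (LD b) =>
      [seq inl (Sync m p.2) :: (if quiet m then [::] else [:: push KV (LD p.1)])
         | p <- enum [pred p : digit3 * 'I_7 | okstep m c a b p.1 p.2]]
  | SyncE m c, Some (LM MDot) =>
      if okend m c then [:: if quiet m then [::] else [:: push KV (LM MDot)]] else [::]
  | Match2 y, Some z => if y == z then [:: [:: call Match; push KE y]] else [::]
  | Neq2 y, Some z =>
      if iskey z then
        [:: if y == z then [:: call Neq; push KE z; push KO y] else [:: push KE z; push KO y]]
      else [::]
  | CB b, Some (LM MHash) => [:: [:: push KE (LM MHash)]]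
  | CB b, Some (LS SVar) => [:: [:: inl (CS b); push KE (LS SVar)]]
  | CB b, Some (LS SBox) =>
      [:: [:: inl (CK b); push KE (LS SBox); push KO (LM (if b then MLe else MGe))]]
  | CS b, Some (LM MDot) => [:: [:: inl (CB b); push KE (LM MDot)]]
  | CS b, Some y => [:: [:: inl (CS b); push KE y]]
  | CK b, Some (LM MDot) =>
      [:: [:: inl (CB b), push KE (LM MDot) &
           if b then [:: push KO (LM MHash); push KO (LM MDot)] else [:: push KO (LM MDot)]]]
  | CK b, Some y => [:: [:: inl (CK b); push KE y; push KO y]]
  | _, _ => [::]
  end.

Lemma In_enum_map (T : finType) (U : Type) (P : pred T) (f : T -> U) y :
  List.In y [seq f x | x <- enum P] <-> exists2 x, P x & y = f x.
Proof.
have h s : List.In y [seq f x | x <- s] <-> exists2 x, x \in s & y = f x.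
  elim: s => [|x s IH] /=; first by split=> // -[].
  rewrite IH; split=> [[<-|[z h1 h2]]|[z]]; first by exists x; rewrite ?mem_head.
  - by exists z => //; rewrite inE h1 orbT.
  - by rewrite inE => /orP[/eqP -> ->|h1 h2]; [left|right; exists z].
by rewrite h; split=> [[x]|[x h1 ->]]; [rewrite mem_enum => h1 ->; exists x|exists x; rewrite ?mem_enum].
Qed.

Lemma body_size c x b : List.In b (body c x) -> size b <= 10.
Proof.
suff h : all (fun b => size b <= 10) (body c x).
  by elim: (body c x) h => //= b' bs IH /andP[h1 /IH h2] [<-|].
case: c => [p|k|k|s|m c|m c d|m c|y|y|b1|b1|b1].
- by case: p; case: x => [[[[]|[]]|[[]|]]|].
- by [].
- by case: x => [[[[]|[]]|[[]|]]|].
- by case: s.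
- by case: x => [[[[]|[]]|[[]|]]|].
- by case: x => [[[s|mm]|e]|] //=; apply/allP => b' /mapP[p _ ->] /=; case: ifP.
- by case: x => [[[[]|[]]|[[]|]]|] //=; case: (okend _ _) => //=; case: (quiet _).
- by case: x => [z|] //=; case: ifP.
- by case: x => [z|] //=; case: ifP => //= _; case: ifP.
- by case: x => [[[[]|[]]|[[]|]]|].
- by case: x => [[[[]|[]]|[[]|]]|].
- by case: b1; case: x => [[[[]|[]]|[[]|]]|].
Qed.

(** * Tools for runs of the program *)

Notation prun := (run rdp body).

Definition St (I O E V A : seq glyph) : stacks kind glyph :=
  [ffun k => match k with KI => I | KO => O | KE => E | KV => V | KA => A end].

Lemma St_get I O E V A : (St I O E V A KI = I) * (St I O E V A KO = O) * (St I O E V A KE = E)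
  * (St I O E V A KV = V) * (St I O E V A KA = A).
Proof. by rewrite !ffunE. Qed.

Lemma St_set I O E V A l :
  (setstk (St I O E V A) KI l = St l O E V A) *
  (setstk (St I O E V A) KO l = St I l E V A) *
  (setstk (St I O E V A) KE l = St I O l V A) *
  (setstk (St I O E V A) KV l = St I O E l A) *
  (setstk (St I O E V A) KA l = St I O E V l).
Proof. by do !split; apply/ffunP; case; rewrite !ffunE. Qed.

Definition StE := (St_get, St_set).

(** Completeness and cost are proved together in this form; soundness speaks of arbitrary runs. *)
Definition within n cs s s' := exists2 t, t <= n & prun t cs s s'.

Lemma within_nil n s : within n [::] s s.
Proof. by exists 0 => //; apply: run_nil. Qed.

Lemma within_le n n' cs s s' : n <= n' -> within n cs s s' -> within n' cs s s'.
Proof. by move=> h [t ht hr]; exists t => //; apply: leq_trans h. Qed.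

Lemma within_push n k x (cs : seq ins) s s' : within n cs (setstk s k (x :: s k)) s' ->
  within n.+1 (inr (k, x) :: cs) s s'.
Proof. by case=> t ht hr; exists t.+1 => //; apply: run_push. Qed.

Lemma within_seq n n' c cs s s1 s' : within n [:: inl c] s s1 -> within n' cs s1 s' ->
  within (n + n') (inl c :: cs) s s'.
Proof.
move=> [t ht hr] [t' ht' hr']; exists (t + t'); first exact: leq_add.
by rewrite -cat1s; apply: cat_run hr hr'.
Qed.

Lemma within_call b n c s s' : rdp c = None -> List.In b (body c None) -> within n b s s' ->
  within n.+1 [:: inl c] s s'.
Proof. by move=> h1 h2 [t ht hr]; exists t.+1 => //; apply: (run_call h1 h2); rewrite cats0. Qed.

Lemma within_pop b n c k x l (s : stacks kind glyph) s' : rdp c = Some k -> s k = x :: l ->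
  List.In b (body c (Some x)) -> within n b (setstk s k l) s' -> within n.+1 [:: inl c] s s'.
Proof. by move=> h1 h2 h3 [t ht hr]; exists t.+1 => //; apply: (run_pop h1 h2 h3); rewrite cats0. Qed.

Lemma within_empty b n c k (s : stacks kind glyph) s' : rdp c = Some k -> s k = [::] ->
  List.In b (body c None) -> within n b s s' -> within n.+1 [:: inl c] s s'.
Proof. by move=> h1 h2 h3 [t ht hr]; exists t.+1 => //; apply: (run_empty h1 h2 h3); rewrite cats0. Qed.

Lemma run_nilE t s s' : prun t [::] s s' -> s' = s.
Proof. by move=> h; inversion h. Qed.

Lemma run_pushE t k x (cs : seq ins) s s' : prun t (inr (k, x) :: cs) s s' ->
  exists2 t', t = t'.+1 & prun t' cs (setstk s k (x :: s k)) s'.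
Proof. by move/run_cons. Qed.

Lemma run_seqE t c c2 cs s s' : prun t (inl c :: c2 :: cs) s s' ->
  exists t1 t2 s1, [/\ t = t1 + t2, prun t1 [:: inl c] s s1 & prun t2 (c2 :: cs) s1 s'].
Proof. by rewrite -cat1s => /run_cat. Qed.

Lemma run_callE t c s s' : rdp c = None -> prun t [:: inl c] s s' ->
  exists t' b, [/\ t = t'.+1, List.In b (body c None) & prun t' b s s'].
Proof. by move=> h /run_cons [t' ->] [b]; rewrite cats0 h => hr hb; exists t', b. Qed.

Lemma run_popE t c k x l (s : stacks kind glyph) s' : rdp c = Some k -> s k = x :: l ->
  prun t [:: inl c] s s' ->
  exists t' b, [/\ t = t'.+1, List.In b (body c (Some x)) & prun t' b (setstk s k l) s'].
Proof. by move=> h e /run_cons [t' ->] [b]; rewrite cats0 h e => hr hb; exists t', b. Qed.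

Lemma run_emptyE t c k (s : stacks kind glyph) s' : rdp c = Some k -> s k = [::] ->
  prun t [:: inl c] s s' ->
  exists t' b, [/\ t = t'.+1, List.In b (body c None) & prun t' b s s'].
Proof.
move=> h e /run_cons [t' ->] [b]; rewrite cats0 h e => hr hb; exists t', b; split=> //.
by move: hr; rewrite (_ : setstk s k _ = s) //; apply/ffunP=> j; rewrite ffunE; case: eqP => // ->.
Qed.

(* Executing the pushes and sequencing of a known body. *)
Ltac wstep := repeat first
  [ exact: within_nil
  | apply: within_push; rewrite !StE
  | fail ].
Ltac rstep H := repeat match type of H with
  | run _ _ _ [::] _ _ => move/run_nilE: H => H
  | run _ _ _ (inr _ :: _) _ _ => let t := fresh "t" in let e := fresh "e" in
      case/run_pushE: H => t e H; rewrite ?StE in H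
  end.

(** * Encodings *)

(** A formula as [Par] leaves it on the stack: operator on top, second argument above the first.
    [MEnd] makes names of variables self-delimiting. *)
Fixpoint fenc (f : form) : seq glyph :=
  match f with
  | FVar n => LS SVar :: [seq LS s | s <- nat_bits n] ++ [:: LM MEnd]
  | FAnd a b => LS SAnd :: fenc b ++ fenc a
  | FOr a b => LS SOr :: fenc b ++ fenc a
  | FAmp a b => LS SAmp :: fenc b ++ fenc a
  | FImp a b => LS SImp :: fenc b ++ fenc a
  | FZero => [:: LS SZero]
  | FBox a => LS SBox :: fenc a
  end.

Definition bit (s : sym) : bool := match s with SBit0 | SBit1 => true | _ => false end.

Lemma pos_bits_bits p : all bit (pos_bits p).
Proof. by elim: p => //= p IH; rewrite all_rcons. Qed.

Lemma nat_bits_bits n : all bit (nat_bits n).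
Proof. by rewrite /nat_bits; case: (BinNat.N.of_nat n) => // p; apply: pos_bits_bits. Qed.

Lemma pos_bits_head p : exists s, pos_bits p = SBit1 :: s.
Proof.
by elim: p => [p [s e]|p [s e]|] /=; [exists (rcons s SBit1)|exists (rcons s SBit0)|exists [::]];
  rewrite ?e.
Qed.

Lemma pos_bits_size p : 0 < size (pos_bits p).
Proof. by have [s ->] := pos_bits_head p. Qed.

Lemma pos_bits_inj : injective pos_bits.
Proof.
elim=> [p IH|p IH|] [q|q|] //=; try by move/rcons_inj => [/IH ->].
all: try by move/rcons_inj => [].
all: move=> /(congr1 size) /=; rewrite size_rcons.
all: try by have := pos_bits_size p; case: (size _).
all: by have := pos_bits_size q; case: (size _).
Qed.

Lemma nat_bits_inj : injective nat_bits.
Proof.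
move=> n n'; rewrite /nat_bits => h; apply: Nnat.Nat2N.inj; move: h.
case: (BinNat.N.of_nat n) => [|p]; case: (BinNat.N.of_nat n') => [|q] //.
- by have [s ->] := pos_bits_head q.
- by have [s ->] := pos_bits_head p.
- by move/pos_bits_inj => ->.
Qed.

Lemma canonical_bits bs : all bit bs -> exists n, nat_bits n = SBit1 :: bs.
Proof.
move=> h; have [p hp] : exists p, pos_bits p = SBit1 :: bs.
  elim/last_ind: bs h => [|bs b IH]; first by exists BinNums.xH.
  rewrite all_rcons => /andP[hb /IH [p hp]].
  by case: b hb => // _; [exists (BinNums.xO p)|exists (BinNums.xI p)]; rewrite /= hp.
by exists (BinNat.N.to_nat (BinNums.Npos p)); rewrite /nat_bits Nnat.N2Nat.id.
Qed.

Lemma bits_end_inj bs bs' (r r' : seq glyph) : all bit bs -> all bit bs' ->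
  [seq LS s | s <- bs] ++ LM MEnd :: r = [seq LS s | s <- bs'] ++ LM MEnd :: r' ->
  bs = bs' /\ r = r'.
Proof.
elim: bs bs' => [|b bs IH] [|b' bs'] //=; first by move=> _ _ [].
by move=> /andP[_ h] /andP[_ h'] [<-] /(IH _ h h') [-> ->].
Qed.

Lemma fenc_inj f g r r' : fenc f ++ r = fenc g ++ r' -> f = g /\ r = r'.
Proof.
elim: f g r r' => [n|a IHa b IHb|a IHa b IHb|a IHa b IHb|a IHa b IHb||a IHa] [n'|a' b'|a' b'|a' b'|a' b'||a'] r r' //=.
1: by case; rewrite -!catA => /bits_end_inj [] //; try exact: nat_bits_bits; move/nat_bits_inj => ->.
1-4: by case; rewrite -!catA => /IHb [-> /IHa [-> ->]].
- by case=> ->.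
- by case=> /IHa [-> ->].
Qed.

Lemma fenc_key f : all iskey (fenc f).
Proof.
elim: f => //= [n|a IHa b IHb|a IHa b IHb|a IHa b IHb|a IHa b IHb]; rewrite all_cat ?IHa ?IHb //=.
by rewrite andbT all_map; apply/allP.
Qed.

Lemma prefix_trichotomy (T : eqType) (a b : seq T) :
  (exists c, a = b ++ c) \/ (exists c, b = a ++ c) \/
  exists p x y u v, [/\ a = p ++ x :: u, b = p ++ y :: v & x != y].
Proof.
elim: a b => [|x a IH] [|y b]; first by left; exists [::].
- by right; left; exists (y :: b).
- by left; exists (x :: a).
have [->|ne] := eqVneq x y; last by right; right; exists [::], x, y, a, b.
case: (IH b) => [[c ->]|[[c ->]|[p [x' [y' [u [v [-> -> h]]]]]]]].
- by left; exists c.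
- by right; left; exists c.
- by right; right; exists (y :: p), x', y', u, v.
Qed.

(** No encoding is a prefix of a different one, so distinct keys differ at a common position, which
    is what [Neq] exhibits. *)
Lemma fenc_mismatch f g : f != g ->
  exists p x y u v, [/\ fenc f = p ++ x :: u, fenc g = p ++ y :: v & x != y].
Proof.
move=> ne; case: (prefix_trichotomy (fenc f) (fenc g)) => [[c e]|[[c e]|//]].
  by have := @fenc_inj f g [::] c; rewrite cats0 => /(_ e) [fg _]; rewrite fg eqxx in ne.
by have := @fenc_inj f g c [::]; rewrite cats0 => /(_ (esym e)) [fg _]; rewrite fg eqxx in ne.
Qed.

Definition dg (d : seq digit3) : seq glyph := [seq LD x | x <- d].

Notation entry := (form * seq digit3)%type.
Definition encE1 (p : entry) : seq glyph := fenc p.1 ++ LM MCol :: dg p.2 ++ [:: LM MDot].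
Definition encE (e : seq entry) : seq glyph := flatten [seq encE1 p | p <- e].

Notation oblig := (bool * form * seq digit3)%type.
Definition encO1 (o : oblig) : seq glyph :=
  LM (if o.1.1 then MGe else MLe) :: fenc o.1.2 ++ LM MCol :: dg o.2 ++ [:: LM MDot].
Definition encO (o : seq oblig) : seq glyph := flatten [seq encO1 p | p <- o].

(** * Signed binary numbers and synchronous passes *)

Section Numbers.
Local Open Scope ring_scope.

Fixpoint val (d : seq digit3) : int := if d is x :: d' then dv x + 2 * val d' else 0.

Fixpoint nbits (s : bool) (L n : nat) : seq digit3 :=
  if L is L'.+1 then (if odd n then Some s else None) :: nbits s L' n./2 else [::].

(** One of many representations of [z], least significant digit first, all nonzero digits having its
    sign. The fixed length keeps operands aligned. *)
Definition dig (L : nat) (z : int) : seq digit3 := nbits (0 <= z) L `|z|%N.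

Lemma size_dig L z : size (dig L z) = L.
Proof. by rewrite /dig; move: `|z|%N => n; elim: L n => //= L IH n; rewrite IH. Qed.

Lemma val_nbits s L n : (n < 2 ^ L)%N -> val (nbits s L n) = if s then n%:Z else - n%:Z.
Proof.
elim: L n => [|L IH] n; first by case: n => //; case: s.
rewrite expnS => h /=; rewrite IH; last by have := odd_double_half n; lia.
by have := odd_double_half n; clear IH; case: (odd n); case: s => /=; lia.
Qed.

Lemma val_dig L z : (`|z| < 2 ^ L)%N -> val (dig L z) = z.
Proof. by move=> h; rewrite /dig val_nbits //; case: ifP => hz; lia. Qed.

Lemma dig0 L : dig L 0 = nseq L None.
Proof. by rewrite /dig /=; elim: L => //= L ->. Qed.

Lemma val_nseq0 L : val (nseq L None) = 0.
Proof. by elim: L => //= L ->. Qed.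

(* What a pass in mode [m] with incoming carry [c] establishes about the
   numbers [a], [b] and the result [r]. *)
Definition sync_rel (m : mode) (c : int) (a b r : seq digit3) : Prop :=
  match m with
  | MAdd => c + val a + val b = val r
  | MSub => c + val b - val a = val r
  | MCmp dir o => 0 <= c + (if dir then val b - val a else val a - val b) /\
      (if o is Some x then r = if x then a else b else True)
  end.
End Numbers.

Ltac subst_nat := repeat match goal with E : ?t = _ :> nat |- _ => is_var t; subst t end.
Ltac getb hb := match type of hb with
  | False => destruct hb
  | _ \/ False => destruct hb as [<-|[]]
  | _ => idtac
  end.
Ltac rpop H := eapply run_popE in H; [|reflexivity|rewrite !StE; reflexivity];
  let t := fresh "t" in let b := fresh "b" in let hb := fresh "hb" in let e := fresh "e" in
  destruct H as [t [b [e hb H]]]; rewrite ?StE in H; simpl in hb;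
  getb hb; rstep H.
Ltac rempty H := eapply run_emptyE in H; [|reflexivity|rewrite !StE; reflexivity];
  let t := fresh "t" in let b := fresh "b" in let hb := fresh "hb" in let e := fresh "e" in
  destruct H as [t [b [e hb H]]]; simpl in hb;
  getb hb; rstep H.
Ltac rcall H := eapply run_callE in H; [|reflexivity];
  let t := fresh "t" in let b := fresh "b" in let hb := fresh "hb" in let e := fresh "e" in
  destruct H as [t [b [e hb H]]]; simpl in hb;
  getb hb; rstep H.
Ltac rseq H H1 := let t1 := fresh "t" in let t2 := fresh "t" in let s1 := fresh "s" in
  let e := fresh "e" in
  apply run_seqE in H; destruct H as [t1 [t2 [s1 [e H1 H]]]].

Ltac wpop := eapply within_pop; [reflexivity|rewrite !StE; reflexivity| |rewrite !StE].
Ltac wempty := eapply within_empty; [reflexivity|rewrite !StE; reflexivity| |].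
Ltac wcall := eapply within_call; [reflexivity| |].

Ltac b1 := left; reflexivity.
Ltac b2 := right; left; reflexivity.
Ltac b3 := right; right; left; reflexivity.

Definition det (c : proc) : bool :=
  match c with
  | PN p => match p with Par | ParB | CopyVal | Drop | DropK | DropE => true | _ => false end
  | Mv _ | CB _ | CS _ | CK _ => true
  | _ => false
  end.
Definition deti (i : ins) : bool := if i is inl c then det c else true.

Lemma det_body c x : det c -> (size (body c x) <= 1) && all (all deti) (body c x).
Proof.
case: c => [p|k|k|s|m c|m c d|m c|y|y|b1|b1|b1] //.
- by case: p => //; case: x => [[[[]|[]]|[[]|]]|].
- by case: x => [[[[]|[]]|[[]|]]|].
- by case: x => [[[[]|[]]|[[]|]]|].
- by case: x => [[[[]|[]]|[[]|]]|].
- by case: b1; case: x => [[[[]|[]]|[[]|]]|].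
Qed.

Lemma run_det t t' cs s s1 s2 : all deti cs -> prun t cs s s1 -> prun t' cs s s2 -> s1 = s2.
Proof.
have [n] := ubnP t; elim: n t t' cs s => // n IH t t' [|[c|[k x]] cs] s ht.
- by move=> _ /run_nilE -> /run_nilE ->.
- move=> /= /andP[dc dcs] /run_cons [t1 e1 [b1 h1 hb1]] /run_cons [t2 e2 [b2 h2 hb2]].
  have /andP[sz al] := det_body (if rdp c is Some k then ohead (s k) else None) dc.
  have eb : b1 = b2.
    by case: (body _ _) sz hb1 hb2 => [|b [|]] //= _ [] // <- [].
  subst b2; apply: (IH _ _ _ _ _ _ h1 h2); first by lia.
  rewrite all_cat dcs andbT; elim: (body _ _) al hb1 {sz hb2} => //= b bs IHb /andP[h3 h4] [<- //|].
  exact: IHb.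
- move=> /= dcs /run_pushE [t1 e1 h1] /run_pushE [t2 e2 h2].
  by apply: (IH _ _ _ _ _ dcs h1 h2); lia.
Qed.

(** A procedure with at most one body per letter needs no soundness proof of its own: the run built
    for completeness fixes the outcome of all others. *)
Lemma within_det n t c s s1 s2 : det c -> within n [:: inl c] s s1 -> prun t [:: inl c] s s2 -> s2 = s1.
Proof. by move=> dc [t' _ h] h'; apply: (run_det _ h' h); rewrite /= dc. Qed.

Lemma dg_cons x d : dg (x :: d) = LD x :: dg d. Proof. by []. Qed.

Lemma mvV_within I O E V A d : within (2 * size d + 2) [:: inl (Mv KV)]
  (St I O E (dg d ++ LM MDot :: V) A) (St I O E V (dg d ++ LM MDot :: A)).
Proof.
elim: d => [|x d IH].
  by wpop; [b1|apply: within_push; rewrite !StE; apply: within_nil].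
apply: (@within_le (2 * size d + 2 + 1).+1); first by rewrite /=; lia.
wpop; first by b1.
by apply: within_seq IH _; apply: within_push; rewrite !StE; apply: within_nil.
Qed.

Lemma mvO_within I O E V A d : within (2 * size d + 2) [:: inl (Mv KO)]
  (St I (dg d ++ LM MDot :: O) E V A) (St I O E V (dg d ++ LM MDot :: A)).
Proof.
elim: d => [|x d IH].
  by wpop; [b1|apply: within_push; rewrite !StE; apply: within_nil].
apply: (@within_le (2 * size d + 2 + 1).+1); first by rewrite /=; lia.
wpop; first by b1.
by apply: within_seq IH _; apply: within_push; rewrite !StE; apply: within_nil.
Qed.

Lemma nseq_cat_cons (T : Type) n (x : T) s : nseq n x ++ x :: s = nseq n.+1 x ++ s.
Proof. by elim: n => //= n ->. Qed.

Lemma gz_within I O E V A n :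
  within (2 * n + 1) [:: inl (GZ KV)] (St I O E V A) (St I O E (nseq n (LD None) ++ V) A) /\
  within (2 * n + 1) [:: inl (GZ KO)] (St I O E V A) (St I (nseq n (LD None) ++ O) E V A).
Proof.
split.
  elim: n V => [|n IH] V; first by wcall; [b1|apply: within_nil].
  apply: (@within_le (2 * n + 1).+2); first by lia.
  wcall; first by b2.
  apply: within_push; rewrite !StE; have := IH (LD None :: V).
  by rewrite nseq_cat_cons.
elim: n O => [|n IH] O; first by wcall; [b1|apply: within_nil].
apply: (@within_le (2 * n + 1).+2); first by lia.
wcall; first by b2.
apply: within_push; rewrite !StE; have := IH (LD None :: O).
by rewrite nseq_cat_cons.
Qed.

Lemma gz_sound t I O E V A s' : (prun t [:: inl (GZ KV)] (St I O E V A) s' ->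
    exists n, s' = St I O E (nseq n (LD None) ++ V) A) /\
  (prun t [:: inl (GZ KO)] (St I O E V A) s' ->
    exists n, s' = St I (nseq n (LD None) ++ O) E V A).
Proof.
have [N] := ubnP t; elim: N t V O => // N IH t V O ht; split=> H.
  rcall H; destruct hb as [<-|[<-|[]]]; rstep H; first by exists 0.
  have [|h _] := IH t1 (LD None :: V) O; first by lia.
  by have [n ->] := h H; exists n.+1; rewrite nseq_cat_cons.
rcall H; destruct hb as [<-|[<-|[]]]; rstep H; first by exists 0.
have [|_ h] := IH t1 V (LD None :: O); first by lia.
by have [n ->] := h H; exists n.+1; rewrite nseq_cat_cons.
Qed.

Lemma cz_surj (q : int) : (-3%:Z <= q <= 3%:Z)%R -> exists c : 'I_7, cz c = q.
Proof.
move=> h; exists (inord (absz (q + 3%:Z)%R)); rewrite /cz inordK; lia.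
Qed.

Lemma dv_bound d : (-1 <= dv d <= 1)%R. Proof. by case: d => [[]|]. Qed.
Lemma cz_bound c : (-3%:Z <= cz c <= 3%:Z)%R.
Proof. by rewrite /cz; have := ltn_ord c; lia. Qed.

Lemma sync_sound m a : forall t c b I O E V A s',
  prun t [:: inl (Sync m c)] (St I O E (dg b ++ LM MDot :: V) (dg a ++ LM MDot :: A)) s' ->
  exists2 r, sync_rel m (cz c) a b r &
    s' = St I O E (if quiet m then V else dg r ++ LM MDot :: V) A.
Proof.
elim: a => [|x a IH] t c b I O E V A s' H.
  rpop H; case: b H => [|y b] H; rpop H.
  move: hb; case ok: (okend m c) => //= hb; destruct hb as [<-|[]].
  exists [::]; last by move: H; case: (quiet m) => H; rstep H.
  move: ok; rewrite /okend /sync_rel; clear; case: m => [||dir o] /=; rewrite ?subr0 ?addr0; try by move/eqP.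
  by move=> h; split; [case: dir; lia|case: o => // -[]].
rpop H; case: b H => [|y b] H; rpop H.
case/In_enum_map: hb => -[r c'] /= ok E1; subst b0.
have [s1 [t3 H1 H2]] : exists s1, exists2 t3, prun t3 [:: inl (Sync m c')]
    (St I O E (dg b ++ LM MDot :: V) (dg a ++ LM MDot :: A)) s1 &
    s' = if quiet m then s1 else setstk s1 KV (LD r :: s1 KV).
  move: H; case: (quiet m) => H; first by exists s'; exists t1.
  rseq H H1; rstep H; by exists s; exists t2.
have [r' rel es] := IH _ _ _ _ _ _ _ _ _ H1; subst s1.
exists (r :: r'); last by rewrite H2; case: (quiet m); rewrite ?StE.
move: ok rel; rewrite /okstep /sync_rel; case: (m) => [||dir o] /=.
- by move=> /eqP h1 h2; lia.
- by move=> /eqP h1 h2; lia.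
move=> /andP[h1 /eqP ->] [h2 h3]; split.
  by clear -h1 h2; case: dir h1 h2 => h1 h2; lia.
by case: o h3 => [[]|] // ->.
Qed.

(** A pass that returns nothing still carries a fictitious result, all of whose digits [okstep]
    forces to be 0. *)
Lemma sync_within m a : forall c b r I O E V A, size b = size a -> size r = size a ->
  sync_rel m (cz c) a b r -> (quiet m -> r = nseq (size a) None) ->
  within (3 * size a + 3) [:: inl (Sync m c)]
    (St I O E (dg b ++ LM MDot :: V) (dg a ++ LM MDot :: A))
    (St I O E (if quiet m then V else dg r ++ LM MDot :: V) A).
Proof.
elim: a => [|x a IH] c [|y b] [|z r] I O E V A //= sb sr rel hq.
  wpop; first by b1.
  wpop.
    have ok : okend m c; last by rewrite /= ok; b1.
    move: rel; rewrite /okend; clear; case: m => [||dir o] /=; rewrite ?subr0 ?addr0; try by move=> ->.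
    by case=> h _; case: dir h; lia.
  by case: (quiet m); [apply: within_nil|apply: within_push; rewrite !StE; apply: within_nil].
(* In a sum or difference the carry is dictated by the tails; in a comparison it is half of the
   current total, rounded down. *)
have [c' ok rel'] : exists2 c', okstep m c x y z c' & sync_rel m (cz c') a b r.
  have hx := dv_bound x; have hy := dv_bound y; have hz := dv_bound z; have hc := cz_bound c.
  move: rel hq; rewrite /sync_rel /okstep; case: (m) => [||dir o] /=.
  - move=> h _; have [|c' hc'] := @cz_surj (val r - val a - val b)%R; first by lia.
    by exists c'; rewrite hc'; [apply/eqP|]; lia.
  - move=> h _; have [|c' hc'] := @cz_surj (val r + val a - val b)%R; first by lia.
    by exists c'; rewrite hc'; [apply/eqP|]; lia.
  move=> [h1 h2] h3; set w := (cz c + (if dir then dv y - dv x else dv x - dv y))%R.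
  have hw : (-5%:Z <= w <= 5%:Z)%R by rewrite /w; clear -hx hy hc; case: dir; lia.
  have [q hq1 hq2] : exists2 q : int, (w = 2 * q \/ w = 2 * q + 1)%R & (-3%:Z <= q <= 3%:Z)%R.
    by exists (w %/ 2)%Z; lia.
  have [c' hc'] := cz_surj hq2; exists c'.
    apply/andP; split; first by rewrite hc'; case: hq1 => ->; apply/orP; [left|right]; lia.
    by case: o h2 h3 => [[]|] //= => [[->]|[->]|_ /(_ isT) [-> _]].
  split; last by case: o h2 {h3} => [[]|] //= [].
  by rewrite hc'; move: h1 hq1; rewrite /w; clear; case: dir => h1 hq1; lia.
apply: (@within_le (3 * size a + 3 + 1).+2); first by lia.
wpop; first by b1.
wpop.
  by apply/In_enum_map; exists (z, c').
have W := IH c' b r I O E V A (succn_inj sb) (succn_inj sr) rel'.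
case: (quiet m) hq W => hq W.
  apply: within_le (W _); first by lia.
  by move=> _; have [] := hq isT.
by apply: within_seq (W _) _ => //; apply: within_push; rewrite !StE; apply: within_nil.
Qed.

(** * Looking up a value in the environment *)

Lemma copy_within I O E V A d : within (3 * size d + 3) [:: call CopyVal]
  (St I O (dg d ++ LM MDot :: E) V A) (St I O (dg d ++ LM MDot :: E) (dg d ++ LM MDot :: V) A).
Proof.
elim: d => [|x d IH].
  by wpop; [b1|do 2 (apply: within_push; rewrite !StE); apply: within_nil].
apply: (@within_le (3 * size d + 3 + 2).+1); first by rewrite /=; lia.
wpop; first by b1.
by apply: within_seq IH _; do 2 (apply: within_push; rewrite !StE); apply: within_nil.
Qed.

Lemma match_body y : iskey y -> body (PN Match) (Some y) = [:: [:: inl (Match2 y)]].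
Proof. by case: y => [[s|[]]|]. Qed.

Lemma skip_body y : y != LM MDot -> body (PN Skip) (Some y) = [:: [:: call Skip; push KE y]].
Proof. by case: y => [[s|[]]|]. Qed.

Lemma match_within I O E V A key d : all iskey key ->
  within (3 * size key + 3 * size d + 5) [:: call Match]
   (St I (key ++ O) (key ++ LM MCol :: dg d ++ LM MDot :: E) V A)
   (St I O (key ++ LM MCol :: dg d ++ LM MDot :: E) (dg d ++ LM MDot :: V) A).
Proof.
elim: key => [|y key IH] /=.
  move=> _; apply: (@within_le (3 * size d + 3 + 1).+1); first by lia.
  by wpop; [b1|apply: within_seq (copy_within _ _ _ _ _ _) _; apply: within_push; rewrite !StE; apply: within_nil].
move=> /andP[hy /IH {}IH].
apply: (@within_le (3 * size key + 3 * size d + 5 + 1).+2); first by lia.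
wpop; first by rewrite match_body //; b1.
wpop; first by rewrite /= eqxx; b1.
by apply: within_seq IH _; apply: within_push; rewrite !StE; apply: within_nil.
Qed.

Lemma match_sound t I O E V A key d s' : all iskey key ->
  prun t [:: call Match] (St I O (key ++ LM MCol :: dg d ++ LM MDot :: E) V A) s' ->
  exists2 O', O = key ++ O' &
    s' = St I O' (key ++ LM MCol :: dg d ++ LM MDot :: E) (dg d ++ LM MDot :: V) A.
Proof.
elim: key t O s' => [|y key IH] t O s' /=.
  move=> _ H; rpop H; rseq H H1; rstep H; exists O => //.
  by rewrite H (within_det _ (copy_within _ _ _ _ _ _) H1) ?StE.
move=> /andP[hy hk] H.
have [t' [b [e1 hb {}H]]] := run_popE (c := PN Match) (k := KE) erefl (St_get _ _ _ _ _).1.1.2 H.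
rewrite match_body // in hb; simpl in hb; getb hb; rewrite !StE in H.
case: O H => [|x O] H; first by rempty H.
rpop H; move: hb; case: eqP => //= e2 hb; getb hb; rseq H H1; rstep H.
have [O' -> es] := IH _ _ _ hk H1; exists O'; first by rewrite e2.
by rewrite H es !StE.
Qed.

Lemma neq_within I O E V A p x y : all iskey p -> iskey x -> iskey y -> x != y ->
  within (4 * size p + 4) [:: call Neq] (St I (p ++ x :: O) (p ++ y :: E) V A)
    (St I (p ++ x :: O) (p ++ y :: E) V A).
Proof.
move=> hp hx hy ne; elim: p hp => [|z p IH] /= hp.
  wpop; first by rewrite /= hx; b1.
  wpop; first by rewrite /= hy (negPf ne); b1.
  by do 2 (apply: within_push; rewrite !StE); apply: within_nil.
case/andP: hp => hz /IH {}IH.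
apply: (@within_le (4 * size p + 4 + 2).+2); first by lia.
wpop; first by rewrite /= hz; b1.
wpop; first by rewrite /= hz eqxx; b1.
by apply: within_seq IH _; do 2 (apply: within_push; rewrite !StE); apply: within_nil.
Qed.

Lemma neq_sound t I O E V A key s' : all iskey key ->
  prun t [:: call Neq] (St I O (key ++ LM MCol :: E) V A) s' ->
  s' = St I O (key ++ LM MCol :: E) V A /\ forall O', O <> key ++ O'.
Proof.
elim: key t O s' => [|y key IH] t [|x O] s' hk H; try by rempty H.
  by rpop H; move: hb; case: ifP => //= _ hb; getb hb; rpop H.
rpop H; move: hb; case: ifP => //= hx hb; getb hb; rpop H.
move: hk hb => /= /andP[hy hk]; rewrite hy /=; case: eqP => [e2|ne] hb; getb hb.
  rseq H H1; rstep H; have [es hO] := IH _ _ _ hk H1; subst s y.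
  by split=> [|O' [/hO]]; rewrite ?H ?StE.
by rstep H; split=> [|O' []] //; rewrite H.
Qed.

Lemma skip_within n (w : seq glyph) I O E V A I2 O2 V2 A2 : all (predC1 (LM MDot : glyph)) w ->
  within n [:: call Look] (St I O E V A) (St I2 O2 E V2 A2) ->
  within (2 * size w + 2 + n) [:: call Skip] (St I O (w ++ LM MDot :: E) V A)
    (St I2 O2 (w ++ LM MDot :: E) V2 A2).
Proof.
move=> hw hl; elim: w hw => [|y w IH] /= hw.
  apply: (@within_le (n + 1).+1); first by lia.
  by wpop; [b1|apply: within_seq hl _; apply: within_push; rewrite !StE; apply: within_nil].
case/andP: hw => hy /IH {}IH.
apply: (@within_le (2 * size w + 2 + n + 1).+1); first by lia.
wpop; first by rewrite skip_body //; b1.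
by apply: within_seq IH _; apply: within_push; rewrite !StE; apply: within_nil.
Qed.

Lemma skip_sound (w : seq glyph) t I O E V A s' : all (predC1 (LM MDot : glyph)) w ->
  prun t [:: call Skip] (St I O (w ++ LM MDot :: E) V A) s' ->
  exists t' s1, prun t' [:: call Look] (St I O E V A) s1 /\
    s' = setstk s1 KE (w ++ LM MDot :: s1 KE).
Proof.
elim: w t s' => [|y w IH] t s' /= hw H.
  by rpop H; rseq H H1; rstep H; do 2 eexists; split; [exact: H1|exact: H].
case/andP: hw => hy hw.
have [t' [b [e1 hb {}H]]] := run_popE (c := PN Skip) (k := KE) erefl (St_get _ _ _ _ _).1.1.2 H.
rewrite skip_body // in hb; simpl in hb; getb hb; rewrite !StE in H.
rseq H H1; rstep H; have [t9 [s9 [H2 es]]] := IH _ _ hw H1; exists t9, s9; split=> //.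
rewrite H es; apply/ffunP=> k; rewrite !ffunE; by case: eqP => // ->.
Qed.

(** A guessed environment may repeat a key. [Look] skips an entry only after [Neq] has verified a
    mismatch, so the first match always wins and a leaf never gets two values. *)
Fixpoint lk (e : seq entry) (f : form) : option (seq digit3) :=
  if e is (k, d) :: e' then if k == f then Some d else lk e' f else None.

Lemma fenc_cons f : exists x r, fenc f = x :: r /\ iskey x.
Proof. by case: f => *; do 2 eexists; (split; [reflexivity|]). Qed.

Lemma encE_cons k d e E : encE ((k, d) :: e) ++ E =
  (fenc k ++ LM MCol :: dg d) ++ LM MDot :: encE e ++ E.
Proof. by rewrite /encE /= /encE1 /= -!catA /= -!catA. Qed.

Lemma nodot k d : all (predC1 (LM MDot : glyph)) (fenc k ++ LM MCol :: dg d).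
Proof.
rewrite all_cat /= all_map; apply/andP; split; last by apply/allP.
by apply/allP => x hx; have := allP (fenc_key k) x hx; case: x {hx} => [[s|[]]|].
Qed.

(** The [MHash] under the environment blocks [Match] as well as [Neq], so a lookup never reaches the
    environment of an ancestor. *)
Lemma look_sound e t I O E V A f s' :
  prun t [:: call Look] (St I (fenc f ++ O) (encE e ++ LM MHash :: E) V A) s' ->
  exists2 d, lk e f = Some d &
    s' = St I O (encE e ++ LM MHash :: E) (dg d ++ LM MDot :: V) A.
Proof.
elim: e t s' => [|[k d] e IH] t s' H.
  rcall H; destruct hb as [<-|[<-|[]]]; first by rpop H.
  rseq H H1; have [x [r [ef hx]]] := fenc_cons f; rewrite ef in H1.
  by rpop H1; move: hb; case: ifP => //= _ hb; getb hb; rpop H1.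
rewrite encE_cons -catA in H *; rcall H; destruct hb as [<-|[<-|[]]].
  have [O' eO ->] := match_sound (fenc_key k) H.
  have [-> ->] := fenc_inj eO; exists d => //; by rewrite /= eqxx.
rseq H H1; have [es ne] := neq_sound (fenc_key k) H1; subst s.
rewrite -cat_cons catA in H; have [t9 [s9 [H2 ->]]] := skip_sound (nodot k d) H.
have [d' hd ->] := IH _ _ H2; exists d' => /=; last by rewrite !StE -catA.
by case: eqP => // ek; case: (ne O); rewrite ek.
Qed.

Lemma look_within e I O E V A f d : lk e f = Some d ->
  within (7 * size (encE e)) [:: call Look] (St I (fenc f ++ O) (encE e ++ LM MHash :: E) V A)
    (St I O (encE e ++ LM MHash :: E) (dg d ++ LM MDot :: V) A).
Proof.
elim: e => [//|[k d'] e IH]; rewrite [lk _ _]/= encE_cons.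
have sz : size (encE ((k, d') :: e)) = size (fenc k) + size d' + 2 + size (encE e).
  by rewrite /encE /= /encE1 !size_cat /= size_cat size_map /=; lia.
case: (eqVneq k f) => [ek [ed]|ne hl]; first subst k d'.
  apply: (@within_le (3 * size (fenc f) + 3 * size d + 5).+1); first by rewrite sz; lia.
  by wcall; [b1|rewrite -catA; apply: match_within (fenc_key f)].
have [p [x [y [u [v [ek ef nxy]]]]]] := fenc_mismatch ne.
have hk : all iskey p /\ iskey x /\ iskey y.
  by have := fenc_key k; have := fenc_key f; rewrite ek ef !all_cat /= => /and3P[-> -> _] /and3P[_ -> _].
case: hk => hp [hx hy].
have szk : size p + 1 <= size (fenc k) by rewrite ek size_cat /=; lia.
apply: (@within_le (4 * size p + 4 + (2 * size (fenc k ++ LM MCol :: dg d') + 2 + 7 * size (encE e))).+1).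
  by rewrite sz size_cat /= size_map; lia.
wcall; first by b2.
apply: (within_seq (s1 := St I (fenc f ++ O) ((fenc k ++ LM MCol :: dg d') ++ LM MDot :: encE e ++ LM MHash :: E) V A)).
  by rewrite ek ef -!catA; apply: neq_within; rewrite // eq_sym.
exact: (skip_within (nodot k d') (IH hl)).
Qed.

(** * Evaluating formulas and checking obligations *)

Section EvalSpec.
Local Open Scope ring_scope.

Fixpoint evE (e : seq entry) (f : form) : option int :=
  match f with
  | FVar _ | FBox _ => omap val (lk e f)
  | FZero => Some 0
  | FAnd a b => if (evE e a, evE e b) is (Some x, Some y) then Some (Num.min x y) else None
  | FOr a b => if (evE e a, evE e b) is (Some x, Some y) then Some (Num.max x y) else None
  | FAmp a b => if (evE e a, evE e b) is (Some x, Some y) then Some (x + y) else None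
  | FImp a b => if (evE e a, evE e b) is (Some x, Some y) then Some (y - x) else None
  end.
End EvalSpec.

Fixpoint lfs (f : form) : seq form :=
  match f with
  | FVar _ | FBox _ => [:: f]
  | FZero => [::]
  | FAnd a b | FOr a b | FAmp a b | FImp a b => lfs a ++ lfs b
  end.

Lemma mvV_sync_sound t m I O E V A a b s' :
  prun t [:: inl (Mv KV); inl (Sync m c0)]
    (St I O E (dg a ++ LM MDot :: dg b ++ LM MDot :: V) A) s' ->
  exists2 r, sync_rel m 0 a b r & s' = St I O E (if quiet m then V else dg r ++ LM MDot :: V) A.
Proof.
move=> H; rseq H H1; have es := within_det (isT : det (Mv KV)) (mvV_within _ _ _ _ _ _) H1; subst s.
exact: sync_sound H.
Qed.

Lemma ev_sound f : forall t e I O E V A s',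
  prun t [:: call Ev] (St I (fenc f ++ O) (encE e ++ LM MHash :: E) V A) s' ->
  exists2 d, evE e f = Some (val d) &
    s' = St I O (encE e ++ LM MHash :: E) (dg d ++ LM MDot :: V) A.
Proof.
elim: f => [n|a IHa b IHb|a IHa b IHb|a IHa b IHb|a IHa b IHb||a IHa] t e I O E V A s' H.
- rewrite /= in H; rpop H; rewrite -[LS SVar :: _ ++ O]/(fenc (FVar n) ++ O) in H.
  by have [d hd ->] := look_sound H; exists d => //=; rewrite hd.
- rewrite /= -catA in H; rpop H; rseq H H1; have [y hy es] := IHb _ _ _ _ _ _ _ _ H1; subst s.
  rseq H H2; have [x hx es] := IHa _ _ _ _ _ _ _ _ H2; subst s; rcall H; rewrite /= hx hy.
  destruct hb as [<-|[<-|[]]]; have [r [h1 h2] ->] := mvV_sync_sound H; exists r => //; rewrite h2 /=.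
    by congr Some; apply/min_idPl; lia.
  by congr Some; apply/min_idPr; lia.
- rewrite /= -catA in H; rpop H; rseq H H1; have [y hy es] := IHb _ _ _ _ _ _ _ _ H1; subst s.
  rseq H H2; have [x hx es] := IHa _ _ _ _ _ _ _ _ H2; subst s; rcall H; rewrite /= hx hy.
  destruct hb as [<-|[<-|[]]]; have [r [h1 h2] ->] := mvV_sync_sound H; exists r => //; rewrite h2 /=.
    by congr Some; apply/max_idPr; lia.
  by congr Some; apply/max_idPl; lia.
- rewrite /= -catA in H; rpop H; rseq H H1; have [y hy es] := IHb _ _ _ _ _ _ _ _ H1; subst s.
  rseq H H2; have [x hx es] := IHa _ _ _ _ _ _ _ _ H2; subst s; rcall H; rewrite /= hx hy.
  have [r h1 ->] := mvV_sync_sound H; exists r => //; congr Some.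
  by move: h1; rewrite /sync_rel add0r.
- rewrite /= -catA in H; rpop H; rseq H H1; have [y hy es] := IHb _ _ _ _ _ _ _ _ H1; subst s.
  rseq H H2; have [x hx es] := IHa _ _ _ _ _ _ _ _ H2; subst s; rcall H; rewrite /= hx hy.
  have [r h1 ->] := mvV_sync_sound H; exists r => //; congr Some.
  by move: h1; rewrite /sync_rel add0r.
- rewrite /= in H; rpop H; have [n ->] := (gz_sound _ _ _ _ _ _ _).1 H.
  by exists (nseq n None); rewrite ?val_nseq0 // /dg map_nseq.
- rewrite /= in H; rpop H; rewrite -[LS SBox :: _ ++ O]/(fenc (FBox a) ++ O) in H.
  by have [d hd ->] := look_sound H; exists d => //=; rewrite hd.
Qed.

Lemma mvV_sync_within m I O E V A L a b r : size a = L -> size b = L -> size r = L ->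
  sync_rel m 0 a b r -> quiet m = false ->
  within (5 * L + 5) [:: inl (Mv KV); inl (Sync m c0)]
    (St I O E (dg a ++ LM MDot :: dg b ++ LM MDot :: V) A) (St I O E (dg r ++ LM MDot :: V) A).
Proof.
move=> sa sb sr rel q; apply: (@within_le (2 * size a + 2 + (3 * size a + 3))); first by lia.
apply: within_seq (mvV_within _ _ _ _ _ _) _.
have := @sync_within m a c0 b r I O E V A; rewrite q; apply=> //; congruence.
Qed.

(** The bound on all subformulas lets every intermediate value fit into [L] digits, so each pass
    finds operands and result of equal length. *)
Lemma ev_within f : forall e (t : wtree int) L I O E V A,
  (forall k, k \in lfs f -> lk e k = Some (dig L (teval k t))) ->
  (forall g, g \in subf f -> absz (teval g t) < 2 ^ L) ->
  within (size (fenc f) * (7 * size (encE e) + 5 * L + 10)) [:: call Ev]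
    (St I (fenc f ++ O) (encE e ++ LM MHash :: E) V A)
    (St I O (encE e ++ LM MHash :: E) (dg (dig L (teval f t)) ++ LM MDot :: V) A).
Proof.
elim: f => [n|a IHa b IHb|a IHa b IHb|a IHa b IHb|a IHa b IHb||a IHa] e t L I O E V A hlk hb;
  set X := (X in _ * X).
2-5: have sz := size_dig L.
2-5: have vd g (hg : absz (teval g t) < 2 ^ L) := val_dig hg.
2-5: have hab : (absz (teval a t) < 2 ^ L) /\ (absz (teval b t) < 2 ^ L)
    by (split; apply: hb; rewrite /= in_cons mem_cat subf_refl ?orbT).
2-5: have va := vd _ hab.1; have vb := vd _ hab.2.
2-5: have hf := vd _ (hb _ (subf_refl _)).
2-5: have {}IHa O' V' : within (size (fenc a) * X) [:: call Ev]
    (St I (fenc a ++ O') (encE e ++ LM MHash :: E) V' A)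
    (St I O' (encE e ++ LM MHash :: E) (dg (dig L (teval a t)) ++ LM MDot :: V') A)
    by (apply: IHa => [k hk|g hg]; [apply: hlk|apply: hb]; rewrite /= ?in_cons mem_cat ?hk ?hg ?orbT).
2-5: have {}IHb O' V' : within (size (fenc b) * X) [:: call Ev]
    (St I (fenc b ++ O') (encE e ++ LM MHash :: E) V' A)
    (St I O' (encE e ++ LM MHash :: E) (dg (dig L (teval b t)) ++ LM MDot :: V') A)
    by (apply: IHb => [k hk|g hg]; [apply: hlk|apply: hb]; rewrite /= ?in_cons mem_cat ?hk ?hg ?orbT).
2-5: apply: (@within_le (size (fenc b) * X + (size (fenc a) * X + (5 * L + 5).+1)).+1);
  [by rewrite /= size_cat /X; nia|].
2-5: rewrite [fenc _]/= cat_cons -catA; wpop; [b1|].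
2-5: apply: (within_seq (IHb _ _)); apply: (within_seq (IHa _ _)).
- apply: (@within_le (7 * size (encE e)).+2); first by rewrite /= size_cat /X /=; nia.
  rewrite /=; wpop; first by b1.
  apply: within_push; rewrite !StE -[LS SVar :: _ ++ O]/(fenc (FVar n) ++ O).
  by apply: look_within; rewrite hlk // mem_head.
- rewrite [teval (_ a b) t]/=; case: (leP (teval a t) (teval b t)) => [le|lt']; [wcall; [b1|]|wcall; [b2|]].
    by apply: mvV_sync_within; rewrite ?sz //= va vb; split=> //; lia.
  by apply: mvV_sync_within; rewrite ?sz //= va vb; split=> //; lia.
- rewrite [teval (_ a b) t]/=; case: (leP (teval a t) (teval b t)) => [le|lt']; [wcall; [b1|]|wcall; [b2|]].
    by apply: mvV_sync_within; rewrite ?sz //= va vb; split=> //; lia.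
  by apply: mvV_sync_within; rewrite ?sz //= va vb; split=> //; lia.
- wcall; first by b1.
  by apply: mvV_sync_within; rewrite ?sz //= va vb hf /=; lia.
- wcall; first by b1.
  by apply: mvV_sync_within; rewrite ?sz //= va vb hf /=; lia.
- apply: (@within_le (2 * L + 1).+2); first by rewrite /= /X; lia.
  rewrite /=; wpop; first by b1.
  apply: within_push; rewrite !StE dig0 /dg map_nseq.
  exact: (gz_within _ _ _ _ _ _).1.
- apply: (@within_le (7 * size (encE e)).+2); first by rewrite /= /X /=; nia.
  rewrite /=; wpop; first by b1.
  apply: within_push; rewrite !StE -[LS SBox :: _ ++ O]/(fenc (FBox a) ++ O).
  by apply: look_within; rewrite hlk // mem_head.
Qed.

Definition holdsO (e : seq entry) (o : oblig) : Prop :=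
  exists2 z, evE e o.1.2 = Some z & (if o.1.1 then val o.2 <= z else z <= val o.2)%R.

Lemma encO_cons b f d os O : encO ((b, f, d) :: os) ++ O =
  LM (if b then MGe else MLe) :: fenc f ++ LM MCol :: dg d ++ LM MDot :: encO os ++ O.
Proof. by rewrite /encO /= /encO1 /= -!catA /= -!catA. Qed.

(** The end marker is [MDol] if [Loop] starts a further round with no box left; [Obl] has no body
    for it, so such a round never completes. *)
Lemma obl_sound os : forall t x I O e E V A s', x = MHash \/ x = MDol ->
  prun t [:: call Obl] (St I (encO os ++ LM x :: O) (encE e ++ LM MHash :: E) V A) s' ->
  [/\ x = MHash, s' = St I O (encE e ++ LM MHash :: E) V A &
    forall o, o \in os -> holdsO e o].
Proof.
elim: os => [|[[b f] d] os IH] t x I O e E V A s' hx H.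
  by case: hx => ->  in H *; rpop H.
have main m t' : prun t' [:: call Ev; call Col; inl (Mv KO); inl (Sync (MCmp m None) c0); call Obl]
    (St I (fenc f ++ LM MCol :: dg d ++ LM MDot :: encO os ++ LM x :: O) (encE e ++ LM MHash :: E) V A) s' ->
    m = b ->
    [/\ x = MHash, s' = St I O (encE e ++ LM MHash :: E) V A &
    forall o, o \in (b, f, d) :: os -> holdsO e o].
  move=> {}H em; rseq H H1; have [z hz es] := ev_sound H1; subst s.
  rseq H H2; rpop H2; subst s.
  rseq H H3; have es := within_det (isT : det (Mv KO)) (mvO_within _ _ _ _ _ _) H3; subst s.
  rseq H H4; have [r [rel _] es] := sync_sound H4; rewrite /= in es; subst s.
  have [-> -> hos] := IH _ _ _ _ _ _ _ _ _ hx H; split=> // o.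
  rewrite in_cons => /orP[/eqP ->|]; last exact: hos.
  by exists (val z) => //=; move: rel; rewrite em; clear; case: b; rewrite /cz /=; lia.
rewrite encO_cons in H; case: b H main => H main; rpop H; exact: main H _.
Qed.

Definition satT (T : wtree int) (o : oblig) : Prop :=
  (if o.1.1 then val o.2 <= teval o.1.2 T else teval o.1.2 T <= val o.2)%R.

Lemma obl_within os : forall e (t : wtree int) L I O E V A,
  (forall o, o \in os -> forall k, k \in lfs o.1.2 -> lk e k = Some (dig L (teval k t))) ->
  (forall o, o \in os -> forall g, g \in subf o.1.2 -> absz (teval g t) < 2 ^ L) ->
  (forall o, o \in os -> size o.2 = L /\ satT t o) ->
  within (size (encO os) * (7 * size (encE e) + 5 * L + 10) + 1) [:: call Obl]
    (St I (encO os ++ LM MHash :: O) (encE e ++ LM MHash :: E) V A)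
    (St I O (encE e ++ LM MHash :: E) V A).
Proof.
elim: os => [|[[b f] d] os IH] e t L I O E V A h1 h2 h3; first by wpop; [b1|apply: within_nil].
set X := (X in _ * X).
have hm := mem_head (b, f, d) os.
have [sd sat] := h3 _ hm; rewrite /= in sd.
have hf : absz (teval f t) < 2 ^ L by apply: (h2 _ hm); apply: subf_refl.
have We := @ev_within f e t L I _ E V A (h1 _ hm) (h2 _ hm).
have hos o (ho : o \in os) : o \in (b, f, d) :: os by rewrite in_cons ho orbT.
have Wo := IH e t L I O E V A (fun o ho => h1 o (hos o ho))
  (fun o ho => h2 o (hos o ho)) (fun o ho => h3 o (hos o ho)).
rewrite -/X in We Wo.
apply: (@within_le (size (fenc f) * X + (1 + (2 * size d + 2 + (3 * size d + 3 + (size (encO os) * X + 1))))).+1).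
  have -> : size (encO ((b, f, d) :: os)) = size (fenc f) + size d + 3 + size (encO os).
    by rewrite /encO /= /encO1 /= !size_cat /= !size_cat size_map /=; lia.
  have : 5 * size d + 10 <= X by rewrite /X sd; lia.
  by nia.
rewrite encO_cons.
have Wc O' V' : within 1 [:: call Col] (St I (LM MCol :: O') (encE e ++ LM MHash :: E) V' A)
    (St I O' (encE e ++ LM MHash :: E) V' A) by wpop; [b1|apply: within_nil].
have Ws m : (0 <= 0 + (if m then val (dig L (teval f t)) - val d else val d - val (dig L (teval f t))))%R ->
  within (3 * size d + 3) [:: inl (Sync (MCmp m None) c0)]
    (St I (encO os ++ LM MHash :: O) (encE e ++ LM MHash :: E) (dg (dig L (teval f t)) ++ LM MDot :: V) (dg d ++ LM MDot :: A))
    (St I (encO os ++ LM MHash :: O) (encE e ++ LM MHash :: E) V A).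
  move=> hm'; apply: (@sync_within (MCmp m None) d c0 _ (nseq (size d) None)) => //.
  - by rewrite size_dig.
  - by rewrite size_nseq.
move: sat; rewrite /satT /= => sat.
by case: b {hm hos h1 h2 h3} sat => sat; (wpop; [b1|]); apply: (within_seq (We _)); apply: (within_seq (Wc _ _));
  apply: (within_seq (mvO_within _ _ _ _ _ _)); (apply: within_seq; last exact: Wo); apply: Ws; rewrite val_dig //; lia.
Qed.

(** * Guessing environments *)

Definition leafk (f : form) : bool := match f with FVar _ | FBox _ => true | _ => false end.

Lemma gdig_sound t I O E V A s' : prun t [:: call GDig] (St I O E V A) s' ->
  exists d, s' = St I O (dg d ++ E) V A.
Proof.
have [N] := ubnP t; elim: N t E => // N IH t E ht H.
have step x t' : t' < N -> prun t' [:: call GDig] (St I O (LD x :: E) V A) s' ->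
    exists d, s' = St I O (dg d ++ E) V A.
  by move=> h1 h2; have [d ->] := IH _ _ h1 h2; exists (rcons d x); rewrite /dg map_rcons cat_rcons.
rcall H; destruct hb as [<-|[<-|[<-|[<-|[]]]]]; rstep H; first by exists [::].
all: by apply: step H; lia.
Qed.

Lemma gdig_within I O E V A d : within (2 * size d + 1) [:: call GDig] (St I O E V A) (St I O (dg d ++ E) V A).
Proof.
elim/last_ind: d E => [|d x IH] E; first by wcall; [b1|apply: within_nil].
apply: (@within_le (2 * size d + 1).+2); first by rewrite size_rcons; lia.
rewrite /dg map_rcons cat_rcons; have W := IH (LD x :: E).
by case: x W => [[]|] W; [wcall; [b3|]|wcall; [right; b3|]|wcall; [b2|]]; apply: within_push; rewrite !StE.
Qed.

Lemma gbit_sound t I O E V A s' : prun t [:: call GBit] (St I O E V A) s' ->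
  exists2 bs, all bit bs & s' = St I O ([seq LS s | s <- bs] ++ E) V A.
Proof.
have [N] := ubnP t; elim: N t E => // N IH t E ht H.
have step x t' : bit x -> t' < N -> prun t' [:: call GBit] (St I O (LS x :: E) V A) s' ->
    exists2 bs, all bit bs & s' = St I O ([seq LS s | s <- bs] ++ E) V A.
  move=> hx h1 h2; have [d hd ->] := IH _ _ h1 h2; exists (rcons d x); first by rewrite all_rcons hx.
  by rewrite map_rcons cat_rcons.
rcall H; destruct hb as [<-|[<-|[<-|[]]]]; rstep H; first by exists [::].
all: by apply: step H => //; lia.
Qed.

Lemma gbit_within I O E V A bs : all bit bs ->
  within (2 * size bs + 1) [:: call GBit] (St I O E V A) (St I O ([seq LS s | s <- bs] ++ E) V A).
Proof.
elim/last_ind: bs E => [|bs x IH] E; first by move=> _; wcall; [b1|apply: within_nil].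
rewrite all_rcons => /andP[hx /IH {}IH].
apply: (@within_le (2 * size bs + 1).+2); first by rewrite size_rcons; lia.
rewrite map_rcons cat_rcons; have W := IH (LS x :: E).
by case: x hx W => //= _ W; [wcall; [b2|]|wcall; [b3|]]; apply: within_push; rewrite !StE.
Qed.

Lemma gvar_sound t I O E V A s' : prun t [:: call GVar] (St I O E V A) s' ->
  exists n, s' = St I O (fenc (FVar n) ++ E) V A.
Proof.
move=> H; rcall H; destruct hb as [<-|[<-|[]]]; rstep H; first by exists 0.
rseq H H1; have [bs hbs es] := gbit_sound H1; subst s; rstep H.
have [n hn] := canonical_bits hbs; exists n.
by rewrite H /= hn /= -catA.
Qed.

Lemma gvar_within I O E V A n :
  within (2 * size (fenc (FVar n))) [:: call GVar] (St I O E V A) (St I O (fenc (FVar n) ++ E) V A).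
Proof.
have [e0|[bs hbs e1]] : nat_bits n = [:: SBit0] \/ exists2 bs, all bit bs & nat_bits n = SBit1 :: bs.
  have := nat_bits_bits n; rewrite /nat_bits; case: (BinNat.N.of_nat n) => [|p]; first by left.
  by have [s ->] := pos_bits_head p => /= h; right; exists s.
  rewrite /= e0 /=; wcall; first by b1.
  apply: (@within_le 3) => //; do 3 (apply: within_push; rewrite !StE); exact: within_nil.
apply: (@within_le (1 + (2 * size bs + 1 + 2)).+1).
  by rewrite /= e1 size_cat /= size_map; lia.
rewrite /= e1 /= -catA; wcall; first by b2.
apply: within_push; rewrite !StE; apply: within_seq (gbit_within _ _ _ _ _ hbs) _.
by do 2 (apply: within_push; rewrite !StE); apply: within_nil.
Qed.

Lemma gform_sound t I O E V A s' :
  (prun t [:: call GForm] (St I O E V A) s' -> exists f, s' = St I O (fenc f ++ E) V A) /\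
  (prun t [:: call GLeaf] (St I O E V A) s' ->
    exists2 f, leafk f & s' = St I O (fenc f ++ E) V A).
Proof.
have [N] := ubnP t; elim: N t E s' => // N IH t E s' ht; split=> H.
  have bin s c t' : (forall a b, fenc (c a b) = LS s :: fenc b ++ fenc a) -> t' < N ->
    prun t' [:: call GForm; call GForm; push KE (LS s)] (St I O E V A) s' ->
    exists f, s' = St I O (fenc f ++ E) V A.
    move=> hc ht' {}H; rseq H H1; have [|h _] := IH t0 E s0; first by lia.
    have [a es] := h H1; subst s0.
    rseq H H2; have [|{}h _] := IH t2 (fenc a ++ E) s0; first by lia.
    have [b es] := h H2; subst s0; rstep H.
    by exists (c a b); rewrite H hc /= catA.
  rcall H; destruct hb as [<-|[<-|[<-|[<-|[<-|[<-|[]]]]]]].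
  - have [|_ h] := IH t0 E s'; first by lia.
    by have [f _ ->] := h H; exists f.
  - by rstep H; exists FZero.
  - by apply: (bin _ FAnd _ _ _ H) => //; lia.
  - by apply: (bin _ FOr _ _ _ H) => //; lia.
  - by apply: (bin _ FAmp _ _ _ H) => //; lia.
  - by apply: (bin _ FImp _ _ _ H) => //; lia.
rcall H; destruct hb as [<-|[<-|[]]].
  by have [n ->] := gvar_sound H; exists (FVar n).
rseq H H1; have [|h _] := IH t1 E s; first by lia.
by have [f es] := h H1; subst s; rstep H; exists (FBox f).
Qed.

Lemma gform_within f : forall I O E V A,
  (within (4 * size (fenc f)) [:: call GForm] (St I O E V A) (St I O (fenc f ++ E) V A)) /\
  (leafk f -> within (4 * size (fenc f) - 1) [:: call GLeaf] (St I O E V A) (St I O (fenc f ++ E) V A)).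
Proof.
have leaf f' I O E V A : 0 < size (fenc f') ->
  within (4 * size (fenc f') - 1) [:: call GLeaf] (St I O E V A) (St I O (fenc f' ++ E) V A) ->
  within (4 * size (fenc f')) [:: call GForm] (St I O E V A) (St I O (fenc f' ++ E) V A).
  move=> h0 W; apply: (@within_le (4 * size (fenc f') - 1).+1); first by lia.
  by wcall; [b1|].
elim: f => [n|a IHa b IHb|a IHa b IHb|a IHa b IHb|a IHa b IHb||a IHa] I O E V A.
- have W : within (4 * size (fenc (FVar n)) - 1) [:: call GLeaf] (St I O E V A) (St I O (fenc (FVar n) ++ E) V A).
    apply: (@within_le (2 * size (fenc (FVar n))).+1); first by rewrite /= size_cat /=; lia.
    by wcall; [b1|apply: gvar_within].
  by split=> // ; apply: leaf.
1-4: split=> //; apply: (@within_le (4 * size (fenc a) + (4 * size (fenc b) + 1)).+1);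
  [by rewrite /= size_cat; lia|].
1: wcall; [b3|].
2: wcall; [right; b3|].
3: wcall; [right; right; b3|].
4: wcall; [right; right; right; b3|].
1-4: apply: (within_seq (IHa _ _ _ _ _).1); apply: (within_seq (IHb _ _ _ _ _).1).
1-4: by apply: within_push; rewrite !StE /= -catA; apply: within_nil.
- by split=> //; wcall; [b2|apply: within_push; rewrite !StE; apply: within_nil].
have W : within (4 * size (fenc (FBox a)) - 1) [:: call GLeaf] (St I O E V A) (St I O (fenc (FBox a) ++ E) V A).
  apply: (@within_le (4 * size (fenc a) + 1).+1); first by rewrite /=; lia.
  wcall; first by b2.
  by apply: (within_seq (IHa _ _ _ _ _).1); apply: within_push; rewrite !StE; apply: within_nil.
by split=> //; apply: leaf.
Qed.

Definition leafe (p : entry) : bool := leafk p.1.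

Lemma encE_cat e e' : encE (e ++ e') = encE e ++ encE e'.
Proof. by rewrite /encE map_cat flatten_cat. Qed.

Lemma encE1E p : encE [:: p] = fenc p.1 ++ LM MCol :: dg p.2 ++ [:: LM MDot].
Proof. by rewrite /encE /= cats0. Qed.

Lemma genv_sound t I O E V A s' : prun t [:: call GEnv] (St I O E V A) s' ->
  exists2 e, all leafe e & s' = St I O (encE e ++ E) V A.
Proof.
have [N] := ubnP t; elim: N t E => // N IH t E ht H.
rcall H; destruct hb as [<-|[<-|[]]]; rstep H; first by exists [::].
rseq H H1; have [d es] := gdig_sound H1; subst s; rstep H.
rseq H H2; have [f hf es] := (gform_sound _ _ _ _ _ _ _).2 H2; subst s.
have [|env he ->] := IH _ _ _ H; first by lia.
exists (env ++ [:: (f, d)]); first by rewrite all_cat he /= /leafe hf.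
by rewrite encE_cat encE1E -!catA /= -!catA.
Qed.

Lemma genv_within I O E V A e : all leafe e ->
  within (4 * size (encE e) + 1) [:: call GEnv] (St I O E V A) (St I O (encE e ++ E) V A).
Proof.
elim/last_ind: e E => [|e [f d] IH] E; first by move=> _; wcall; [b1|apply: within_nil].
rewrite all_rcons => /andP[hf /IH {}IH].
apply: (@within_le (1 + (2 * size d + 1 + (1 + (4 * size (fenc f) - 1 + (4 * size (encE e) + 1))))).+1).
  by rewrite -cats1 encE_cat size_cat encE1E size_cat /= size_cat size_map /=; lia.
wcall; first by b2.
apply: within_push; rewrite !StE; apply: within_seq (gdig_within _ _ _ _ _ d) _.
apply: within_push; rewrite !StE; apply: (within_seq ((gform_within f _ _ _ _ _).2 hf)).
by rewrite -cats1 encE_cat encE1E -!catA /= -!catA; apply: IH.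
Qed.

(** * Boxes of the environment: dead ends and obligations of successors *)

Definition bxE (e : seq entry) : seq (form * seq digit3) :=
  pmap (fun p => if p.1 is FBox g then Some (g, p.2) else None) e.

Definition ges (l : seq (form * seq digit3)) : seq oblig := [seq (true, p.1, p.2) | p <- l].
(** Each upper bound has its own [MHash], so that pushing the lower bounds in front of it completes
    the list of obligations of one successor. *)
Definition les (l : seq (form * seq digit3)) : seq glyph :=
  flatten [seq encO1 (false, p.1, p.2) ++ [:: LM MHash] | p <- l].
Definition cbO (b : bool) (e : seq entry) : seq glyph :=
  if b then les (bxE e) else encO (ges (bxE e)).

Lemma cs_body b y : y != LM MDot -> body (CS b) (Some y) = [:: [:: inl (CS b); push KE y]].
Proof. by case: y => [[s|[]]|]. Qed.

Lemma ck_body b y : y != LM MDot -> body (CK b) (Some y) = [:: [:: inl (CK b); push KE y; push KO y]].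
Proof. by case: y => [[s|[]]|]. Qed.

Lemma cs_within b n (w : seq glyph) I O O2 E V A : all (predC1 (LM MDot : glyph)) w ->
  within n [:: inl (CB b)] (St I O E V A) (St I O2 E V A) ->
  within (2 * size w + 2 + n) [:: inl (CS b)] (St I O (w ++ LM MDot :: E) V A)
    (St I O2 (w ++ LM MDot :: E) V A).
Proof.
move=> hw hl; elim: w hw => [|y w IH] /= hw.
  apply: (@within_le (n + 1).+1); first by lia.
  by wpop; [b1|apply: within_seq hl _; apply: within_push; rewrite !StE; apply: within_nil].
case/andP: hw => hy /IH {}IH.
apply: (@within_le (2 * size w + 2 + n + 1).+1); first by lia.
wpop; first by rewrite cs_body //; b1.
by apply: within_seq IH _; apply: within_push; rewrite !StE; apply: within_nil.
Qed.

Lemma ck_within b n (w : seq glyph) I O O2 E V A : all (predC1 (LM MDot : glyph)) w ->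
  within n [:: inl (CB b)] (St I O E V A) (St I O2 E V A) ->
  within (3 * size w + 4 + n) [:: inl (CK b)] (St I O (w ++ LM MDot :: E) V A)
    (St I (w ++ LM MDot :: if b then LM MHash :: O2 else O2) (w ++ LM MDot :: E) V A).
Proof.
move=> hw hl; elim: w hw => [|y w IH] /= hw.
  apply: (@within_le (n + 3).+1); first by lia.
  wpop; first by b1.
  apply: within_seq hl _; apply: within_push; rewrite !StE; case: (b); last first.
    by apply: within_push; rewrite !StE; apply: within_nil.
  by do 2 (apply: within_push; rewrite !StE); apply: within_nil.
case/andP: hw => hy /IH {}IH.
apply: (@within_le (3 * size w + 4 + n + 2).+1); first by lia.
wpop; first by rewrite ck_body //; b1.
by apply: within_seq IH _; do 2 (apply: within_push; rewrite !StE); apply: within_nil.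
Qed.

Lemma nodot_tail x k d : all (predC1 (LM MDot : glyph)) (x :: k ++ LM MCol :: dg d) ->
  all (predC1 (LM MDot : glyph)) (k ++ LM MCol :: dg d).
Proof. by case/andP. Qed.

Lemma cb_within b e I O E V A : all leafe e ->
  within (4 * size (encE e) + 2) [:: inl (CB b)] (St I O (encE e ++ LM MHash :: E) V A)
    (St I (cbO b e ++ O) (encE e ++ LM MHash :: E) V A).
Proof.
elim: e => [_|[f d] e IH].
  have -> : cbO b [::] = [::] by case: b.
  by wpop; [b1|apply: within_push; rewrite !StE; apply: within_nil].
rewrite [all _ _]/= => /andP[hf /IH {}IH].
have sz : size (encE ((f, d) :: e)) = size (fenc f) + size d + 2 + size (encE e).
  by rewrite /encE /= /encE1 !size_cat /= size_cat size_map /=; lia.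
rewrite sz encE_cons; have nd := nodot f d; case: f hf nd sz => // [n|g] _ nd sz.
  apply: (@within_le (2 * size (behead (fenc (FVar n)) ++ LM MCol :: dg d) + 2 + (4 * size (encE e) + 2) + 1).+1).
    by rewrite size_cat /= size_map; lia.
  rewrite {2 3}/fenc -/fenc !cat_cons; wpop; first by b1.
  apply: within_seq (cs_within (nodot_tail nd) IH) _.
  by apply: within_push; rewrite !StE; apply: within_nil.
apply: (@within_le (3 * size (fenc g ++ LM MCol :: dg d) + 4 + (4 * size (encE e) + 2) + 2).+1).
  by rewrite size_cat /= size_map; lia.
rewrite {2 3}/fenc -/fenc !cat_cons; wpop; first by b1.
apply: within_seq (ck_within (nodot_tail nd) IH) _.
do 2 (apply: within_push; rewrite !StE).
have -> : cbO b ((FBox g, d) :: e) ++ O =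
    LM (if b then MLe else MGe) :: (fenc g ++ LM MCol :: dg d) ++ LM MDot ::
      (if b then LM MHash :: cbO b e ++ O else cbO b e ++ O).
  by case: (b); rewrite /cbO /les /encO /= /encO1 /= -!catA /= -!catA.
exact: within_nil.
Qed.

Lemma drop_within I O E V A (w : seq glyph) : all (predC1 (LM MDot : glyph)) w ->
  within (size w + 1) [:: call Drop] (St I O (w ++ LM MDot :: E) V A) (St I O E V A).
Proof.
elim: w => [|y w IH] /=; first by move=> _; wpop; [b1|apply: within_nil].
move=> /andP[hy /IH W].
have hb : body (PN Drop) (Some y) = [:: [:: call Drop]] by case: y hy => [[s|[]]|].
by wpop; [rewrite hb; b1|exact: W].
Qed.

Lemma dropk_within I O E V A (w : seq glyph) : all iskey w ->
  within (size w + 1) [:: call DropK] (St I O (w ++ LM MCol :: E) V A) (St I O E V A).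
Proof.
elim: w => [|y w IH] /=; first by move=> _; wpop; [b1|apply: within_nil].
move=> /andP[hy /IH W].
have hb : body (PN DropK) (Some y) = [:: [:: call DropK]] by case: y hy => [[s|[]]|].
by wpop; [rewrite hb; b1|exact: W].
Qed.

Lemma drope_within I O E V A (w : seq glyph) : all (predC1 (LM MHash : glyph)) w ->
  within (size w + 1) [:: call DropE] (St I O (w ++ LM MHash :: E) V A) (St I O E V A).
Proof.
elim: w => [|y w IH] /=; first by move=> _; wpop; [b1|apply: within_nil].
move=> /andP[hy /IH W].
have hb : body (PN DropE) (Some y) = [:: [:: call DropE]] by case: y hy => [[s|[]]|].
by wpop; [rewrite hb; b1|exact: W].
Qed.

Lemma nohash e : all (predC1 (LM MHash : glyph)) (encE e).
Proof.
elim: e => //= -[f d] e IH; rewrite -[encE _]cats0 encE_cons cats0 all_cat /= IH andbT all_cat /= all_map.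
apply/andP; split; last by apply/allP.
by apply/allP => x hx; have := allP (fenc_key f) x hx; case: x {hx} => [[s|[]]|].
Qed.

Lemma zeros_sound t I O E V A d s' :
  prun t [:: call Zeros] (St I O (dg d ++ LM MDot :: E) V A) s' ->
  s' = St I O E V A /\ val d = 0%R.
Proof.
elim: d t s' => [|[x|] d IH] t s' H; rpop H; first by [].
by have [-> /= ->] := IH _ _ H.
Qed.

Lemma zeros_within I O E V A n :
  within (n + 1) [:: call Zeros] (St I O (dg (nseq n None) ++ LM MDot :: E) V A) (St I O E V A).
Proof. by elim: n => [|n IH]; wpop; [b1|apply: within_nil|b1|]. Qed.

Lemma dead_sound e : forall t I O E V A s', all leafe e ->
  prun t [:: call Dead] (St I O (encE e ++ LM MHash :: E) V A) s' ->
  s' = St I O E V A /\ forall p, p \in bxE e -> val p.2 = 0%R.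
Proof.
elim: e => [|[f d] e IH] t I O E V A s' he H; first by rpop H.
rewrite encE_cons in H; move: he => /= /andP[hf he]; have nd := nodot f d.
case: f hf H nd => // [n|g] _ H nd.
  rewrite /fenc !cat_cons in H; rpop H; rseq H H1.
  have es := within_det (isT : det (PN Drop)) (drop_within _ _ _ _ _ (nodot_tail nd)) H1; subst s.
  exact: IH H.
rewrite [fenc _]/= !cat_cons -catA in H; rpop H; rseq H H1.
have es := within_det (isT : det (PN DropK)) (dropk_within _ _ _ _ _ (fenc_key g)) H1; subst s.
rseq H H2; have [es z] := zeros_sound H2; subst s.
have [-> hz] := IH _ _ _ _ _ _ _ he H; split=> // p.
by rewrite [bxE _]/= in_cons => /orP[/eqP ->|/hz].
Qed.

Lemma dead_within e L : forall I O E V A, all leafe e ->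
  (forall p, p \in bxE e -> p.2 = nseq L None) ->
  within (2 * size (encE e) + 1) [:: call Dead] (St I O (encE e ++ LM MHash :: E) V A) (St I O E V A).
Proof.
elim: e => [|[f d] e IH] I O E V A he hz; first by wpop; [b1|apply: within_nil].
have sz : size (encE ((f, d) :: e)) = size (fenc f) + size d + 2 + size (encE e).
  by rewrite /encE /= /encE1 !size_cat /= size_cat size_map /=; lia.
rewrite encE_cons sz; move: he => /= /andP[hf he]; have nd := nodot f d.
case: f hf hz nd sz => // [n|g] _ hz nd sz.
  apply: (@within_le (size (behead (fenc (FVar n)) ++ LM MCol :: dg d) + 1 + (2 * size (encE e) + 1)).+1).
    by rewrite size_cat /= size_map; lia.
  rewrite [fenc _]/= !cat_cons; wpop; first by b1.
  by apply: within_seq (drop_within _ _ _ _ _ (nodot_tail nd)) _; apply: IH.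
apply: (@within_le (size (fenc g) + 1 + (size d + 1 + (2 * size (encE e) + 1))).+1).
  by rewrite /=; lia.
have ed : d = nseq L None by apply: (hz (g, d)); rewrite [bxE _]/= mem_head.
rewrite [fenc _]/= !cat_cons -catA; wpop; first by b1.
apply: within_seq (dropk_within _ _ _ _ _ (fenc_key g)) _; rewrite {2}ed ed size_nseq.
apply: within_seq (zeros_within _ _ _ _ _ _) _; apply: IH => // p hp.
by apply: hz; rewrite [bxE _]/= in_cons hp orbT.
Qed.

Lemma les_cons g d l O : les ((g, d) :: l) ++ O = encO [:: (false, g, d)] ++ LM MHash :: les l ++ O.
Proof.
have -> o : encO [:: o] = encO1 o by rewrite /encO -[flatten _]/(encO1 o ++ [::]) cats0.
by rewrite -[les _]/((encO1 (false, g, d) ++ [:: LM MHash]) ++ les l) -!catA.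
Qed.

(** * Soundness of the search *)

Lemma encO_cat o1 o2 : encO (o1 ++ o2) = encO o1 ++ encO o2.
Proof. by rewrite /encO map_cat flatten_cat. Qed.

Lemma lk_mem e g d : lk e (FBox g) = Some d -> (g, d) \in bxE e.
Proof.
elim: e => //= -[k d'] e IH; case: eqP => [-> [->]|_ /IH h]; first by rewrite mem_head.
by case: k => //= *; rewrite ?in_cons h ?orbT.
Qed.

Definition etree (e : seq entry) (cs : seq (wtree int)) : wtree int :=
  Node (fun p => odflt 0%R (omap val (lk e (FVar p)))) cs.

Lemma evE_teval e cs f z :
  (forall g d, lk e (FBox g) = Some d -> teval (FBox g) (etree e cs) = val d) ->
  evE e f = Some z -> teval f (etree e cs) = z.
Proof.
move=> hb; elim: f z => [n|a IHa b IHb|a IHa b IHb|a IHa b IHb|a IHa b IHb||a _] z.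
- by rewrite /=; case: (lk e (FVar n)) => //= d [].
1-4: rewrite /=; case: (evE e a) IHa => // x /(_ _ erefl) ->; case: (evE e b) IHb => // y /(_ _ erefl) ->; by case.
- by case.
- by rewrite [evE _ _]/=; case E: (lk e (FBox a)) => [d|] //= [<-]; apply: hb.
Qed.

Lemma holdsO_sat e cs (os : seq oblig) :
  (forall g d, lk e (FBox g) = Some d -> teval (FBox g) (etree e cs) = val d) ->
  (forall o, o \in os -> holdsO e o) -> forall o, o \in os -> satT (etree e cs) o.
Proof.
by move=> hb ho o /ho [z hz h]; rewrite /satT (evE_teval hb hz).
Qed.

Lemma choose_children (l m : seq (form * seq digit3)) :
  (forall p, p \in l -> exists2 T : wtree int, (teval p.1 T <= val p.2)%R &
    forall q, q \in m -> (val q.2 <= teval q.1 T)%R) ->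
  exists cs : seq (wtree int),
    (forall c, List.In c cs -> forall q, q \in m -> (val q.2 <= teval q.1 c)%R) /\
    (forall p, p \in l -> exists2 c, List.In c cs & (teval p.1 c <= val p.2)%R).
Proof.
elim: l => [|p l IH] h; first by exists [::].
have [|cs [h1 h2]] := IH; first by move=> q hq; apply: h; rewrite in_cons hq orbT.
have [T hT hm] := h p (mem_head _ _); exists (T :: cs); split=> [c [<-//|/h1]|q] //.
rewrite in_cons => /orP[/eqP ->|/h2 [c hc hle]]; first by exists T => //; left.
by exists c => //; right.
Qed.

(** [Sat] and [Loop] call each other, hence a joint induction on time. The guessed value of a box is
    the exact infimum in the tree built: every chosen child is bounded below by it, and the child
    visited for that box is bounded above by it. *)
Lemma sat_loop_sound N : forall t,
  t < N ->
  (forall x os I O E V A s', x = MHash \/ x = MDol ->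
    prun t [:: call Sat] (St I (encO os ++ LM x :: O) E V A) s' ->
    [/\ x = MHash, s' = St I O E V A &
      exists T : wtree int, forall o, o \in os -> satT T o]) /\
  (forall l e I O E V A s', all leafe e ->
    prun t [:: call Loop] (St I (les l ++ LM MDol :: O) (encE e ++ LM MHash :: E) V A) s' ->
    s' = St I O E V A /\
    forall p, p \in l -> exists2 T : wtree int, (teval p.1 T <= val p.2)%R &
      forall q, q \in bxE e -> (val q.2 <= teval q.1 T)%R).
Proof.
elim: N => // N IH t ht.
have satIH t' x os I O E V A s' : x = MHash \/ x = MDol ->
    prun t' [:: call Sat] (St I (encO os ++ LM x :: O) E V A) s' -> t' < N ->
    [/\ x = MHash, s' = St I O E V A & exists T : wtree int, forall o, o \in os -> satT T o].
  by move=> hx H ht'; have [h _] := IH t' ht'; apply: h H.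
have loopIH t' l e I O E V A s' : all leafe e ->
    prun t' [:: call Loop] (St I (les l ++ LM MDol :: O) (encE e ++ LM MHash :: E) V A) s' ->
    t' < N -> s' = St I O E V A /\
    forall p, p \in l -> exists2 T : wtree int, (teval p.1 T <= val p.2)%R &
      forall q, q \in bxE e -> (val q.2 <= teval q.1 T)%R.
  by move=> he H ht'; have [_ h] := IH t' ht'; apply: h H.
clear IH; split.
  move=> x os I O E V A s' hx H; rcall H; destruct hb as [<-|[<-|[]]]; rstep H.
    rseq H H1; have [env he es] := genv_sound H1; subst s.
    rseq H H2; have [ex es ho] := obl_sound hx H2; subst s.
    have [-> hz] := dead_sound he H; split=> //; exists (etree env [::]).
    by apply: holdsO_sat ho => g d /lk_mem /hz /= ->.
  rseq H H1; have [env he es] := genv_sound H1; subst s.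
  rseq H H2; have [ex es ho] := obl_sound hx H2; subst s; rstep H.
  rseq H H3; have es := within_det (isT : det (CB true)) (cb_within true _ _ _ _ _ he) H3; subst s.
  have [|-> hl] := loopIH _ _ _ _ _ _ _ _ _ he H; first by lia.
  split=> //.
  have [cs [hc1 hc2]] := choose_children hl; exists (etree env cs).
  apply: holdsO_sat ho => g d /lk_mem hg /=.
  have [c hc hle] := hc2 _ hg.
  have E1 : teval g c = val d by apply/le_anti; rewrite hle (hc1 _ hc _ hg).
  rewrite -E1; apply: tinf_eq; first by apply/In_map_mem; exists c.
  by move=> y /In_map_mem [c' hc' ->]; rewrite E1; apply: (hc1 _ hc' _ hg).
move=> l e I O E V A s' he H; rcall H; destruct hb as [<-|[<-|[]]].
  rseq H H1; case: l H1 => [|[g d] l] H1; last by rewrite les_cons in H1; rpop H1.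
  rpop H1; subst s; have -> := within_det (isT : det (PN DropE)) (drope_within _ _ _ _ _ (nohash e)) H.
  by split.
rseq H H1; have es := within_det (isT : det (CB false)) (cb_within false _ _ _ _ _ he) H1; subst s.
rseq H H2; rewrite /cbO in H2.
clear H1; case: l H2 H => [|[g d] l] H2 H.
  by have [|//] := satIH _ MDol _ _ _ _ _ _ _ (or_intror erefl) H2; lia.
rewrite les_cons catA -encO_cat in H2.
have [|_ es [T hT]] := satIH _ MHash _ _ _ _ _ _ _ (or_introl erefl) H2; first by lia.
subst s; have [|-> hl] := loopIH _ _ _ _ _ _ _ _ _ he H; first by lia.
split=> // p.
rewrite in_cons => /orP[/eqP ->|/hl] //; exists T.
  by have := hT (false, g, d); apply; rewrite mem_cat mem_head orbT.
move=> q hq; have := hT (true, q.1, q.2); apply; rewrite mem_cat; apply/orP; left.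
by apply/mapP; exists q.
Qed.

(** * Completeness and cost of the search *)

Definition env_of (L : nat) (t : wtree int) (F : seq form) : seq entry :=
  [seq (k, dig L (teval k t)) | k <- flatten [seq lfs f | f <- F]].

Lemma lfs_leaf f k : k \in lfs f -> leafk k.
Proof.
elim: f => //= [n|a IHa b IHb|a IHa b IHb|a IHa b IHb|a IHa b IHb|a _].
1,6: by rewrite inE => /eqP ->.
all: by rewrite mem_cat => /orP[/IHa|/IHb].
Qed.

Lemma env_leafe L t F : all leafe (env_of L t F).
Proof. by rewrite all_map; apply/allP => k /flatten_mapP [f _ /lfs_leaf]. Qed.

Lemma env_lk L t F f k : f \in F -> k \in lfs f -> lk (env_of L t F) k = Some (dig L (teval k t)).
Proof.
move=> fF kf; have : k \in flatten [seq lfs f | f <- F] by apply/flatten_mapP; exists f.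
rewrite /env_of; elim: (flatten _) => //= k' s IH; rewrite in_cons eq_sym.
by case: eqP => [->|_] //= /IH.
Qed.

Definition obody (k : form) : option form := if k is FBox g then Some g else None.

Lemma lfs_ob f : pmap obody (lfs f) = ob f.
Proof. by elim: f => //= [a <- b <-|a <- b <-|a <- b <-|a <- b <-]; rewrite pmap_cat. Qed.

Lemma env_bxE L t F : bxE (env_of L t F) = [seq (g, dig L (teval (FBox g) t)) | g <- obs F].
Proof.
rewrite /env_of /obs; elim: F => //= f F IH.
rewrite !map_cat [LHS]pmap_cat [X in _ ++ X]IH -lfs_ob; congr (_ ++ _).
by elim: (lfs f) => //= -[] //= g s ->.
Qed.

(** Passing to bodies of outermost boxes does not increase this length, so the length of the input
    formula bounds it at every depth. *)
Definition szF (F : seq form) : nat := sumn [seq size (fenc f) | f <- F].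

Lemma szF_cat F G : szF (F ++ G) = szF F + szF G.
Proof. by rewrite /szF map_cat sumn_cat. Qed.

Lemma szF_lfs f : szF (lfs f) <= size (fenc f).
Proof.
by elim: f => //= [n|a IHa b IHb|a IHa b IHb|a IHa b IHb|a IHa b IHb|a _];
  rewrite ?szF_cat /szF /= ?size_cat ?addn0 //=; rewrite /szF in IHa IHb; lia.
Qed.

Lemma szF_ob f : szF (ob f) <= size (fenc f).
Proof.
by elim: f => //= [a IHa b IHb|a IHa b IHb|a IHa b IHb|a IHa b IHb|a _];
  rewrite ?szF_cat ?size_cat /= ?addn0; try lia; rewrite /szF /=; lia.
Qed.

Lemma szF_flat (h : form -> seq form) F : (forall f, szF (h f) <= size (fenc f)) ->
  szF (flatten [seq h f | f <- F]) <= szF F.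
Proof.
move=> hh; elim: F => //= f F IH; rewrite szF_cat /szF /= -/(szF F) -/(szF (h f)) leq_add //.
Qed.

Lemma fenc_gt0 f : 0 < size (fenc f). Proof. by case: f. Qed.

Lemma size_szF F : size F <= szF F.
Proof. by elim: F => //= f F IH; rewrite /szF /= -/(szF F); have := fenc_gt0 f; lia. Qed.

Lemma env_size L t F : size (encE (env_of L t F)) <= szF F * (L + 3).
Proof.
have h : size (encE (env_of L t F)) <= szF (flatten [seq lfs f | f <- F]) * (L + 3).
  rewrite /env_of; elim: (flatten _) => //= k s IH.
  rewrite -[encE _]cats0 encE_cons cats0 size_cat /= size_cat /= size_map size_dig.
  by rewrite /szF /= -/(szF s); have := fenc_gt0 k; nia.
by apply: leq_trans h _; rewrite leq_mul2r szF_flat ?orbT //; apply: szF_lfs.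
Qed.

Lemma size_encO1 (o : oblig) : size (encO1 o) = size (fenc o.1.2) + size o.2 + 3.
Proof. by rewrite /encO1 /= size_cat /= size_cat size_map /=; lia. Qed.

Lemma ges_size L t F : size (encO (ges [seq (g, dig L (teval (FBox g) t)) | g <- F])) <= szF F * (L + 4).
Proof.
elim: F => [//|g F IH]; rewrite -[encO _]/(encO1 (true, g, dig L (teval (FBox g) t)) ++
  encO (ges [seq (g, dig L (teval (FBox g) t)) | g <- F])) size_cat size_encO1 size_dig /=.
rewrite -[szF _]/(size (fenc g) + szF F) mulnDl; apply: leq_add => //.
by have := fenc_gt0 g; nia.
Qed.

Lemma loop_within C e I O E V A l : all leafe e ->
  (forall p O', p \in l -> within C [:: call Sat]
    (St I (encO (ges (bxE e) ++ [:: (false, p.1, p.2)]) ++ LM MHash :: O') (encE e ++ LM MHash :: E) V A)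
    (St I O' (encE e ++ LM MHash :: E) V A)) ->
  within (size l * (4 * size (encE e) + 3 + C) + size (encE e) + 3) [:: call Loop]
    (St I (les l ++ LM MDol :: O) (encE e ++ LM MHash :: E) V A) (St I O E V A).
Proof.
move=> he; elim: l => [|[g d] l IH] h.
  apply: (@within_le (1 + (size (encE e) + 1)).+1); first by rewrite /=; lia.
  wcall; first by b1.
  apply: within_seq; first by wpop; [b1|apply: within_nil].
  exact: drope_within (nohash e).
apply: (@within_le (4 * size (encE e) + 2 + (C + (size l * (4 * size (encE e) + 3 + C) + size (encE e) + 3))).+1).
  by rewrite /=; lia.
wcall; first by b2.
apply: (within_seq (cb_within false _ _ _ _ _ he)).
rewrite /cbO les_cons catA -encO_cat.
apply: (within_seq (h (g, d) _ (mem_head _ _))).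
by apply: IH => p O' hp; apply: h; rewrite in_cons hp orbT.
Qed.

Section SatCost.
Variables (phi : form) (T0 : wtree int) (L : nat).
Hypothesis small : forall s f, List.In s (nodes T0) -> f \in subf phi ->
  absz (teval f s) < 2 ^ L.

Let n := size (fenc phi).
(** Bounds for the environment of a world, for its list of obligations, and for the work done in the
    world itself. The factor 2 in [Os] covers the lower bounds for all boxes and the single upper
    bound. *)
Let Es := n * (L + 3).
Let Os := 2 * n * (L + 4).
Let Ps := 20 * Es + Os * (7 * Es + 5 * L + 10) + 20.

(** The guesses follow the given tree. With [q] outermost boxes a world costs at most [Ps] plus, for
    each box, [Ps] and a recursive call; [1 + 2 * q <= 4 ^ q] closes the recursion. *)
Lemma sat_within k : forall F t (os : seq oblig) I O E V A,
  bxs F < k -> {subset F <= subf phi} -> szF F <= n -> List.In t (nodes T0) ->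
  size (encO os) <= Os ->
  (forall o, o \in os -> [/\ o.1.2 \in F, size o.2 = L & satT t o]) ->
  within (Ps * 4 ^ bxs F) [:: call Sat] (St I (encO os ++ LM MHash :: O) E V A) (St I O E V A).
Proof.
elim: k => // k IH F t os I O E V A hk hF szn ht szo hos.
pose e := env_of L t F; have he : all leafe e := env_leafe L t F.
have sze : size (encE e) <= Es.
  by apply: leq_trans (env_size L t F) _; rewrite leq_mul2r szn orbT.
have small' f : f \in F -> forall g, g \in subf f -> absz (teval g t) < 2 ^ L.
  by move=> fF g gf; apply: small => //; apply: subf_trans gf (hF _ fF).
have Wo V' A' E' O' : within (Os * (7 * Es + 5 * L + 10) + 1) [:: call Obl]
    (St I (encO os ++ LM MHash :: O') (encE e ++ LM MHash :: E') V' A')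
    (St I O' (encE e ++ LM MHash :: E') V' A').
  apply: within_le; last apply: (@obl_within os e t L).
  - by rewrite leq_add2r leq_mul // !leq_add2r leq_mul2l sze orbT.
  - by move=> o ho k' hk'; have [oF _ _] := hos o ho; apply: env_lk oF hk'.
  - by move=> o ho; have [oF _ _] := hos o ho; apply: small'.
  - by move=> o ho; have [_ ? ?] := hos o ho.
have ebx : bxE e = [seq (g, dig L (teval (FBox g) t)) | g <- obs F] := env_bxE L t F.
have hobs g : g \in obs F -> FBox g \in subf phi.
  by case/flatten_mapP=> f fF /ob_sub hg; apply: subf_trans hg (hF _ fF).
have hobs' : {subset obs F <= subf phi}.
  by move=> g /hobs hg; have := subf_cases hg.
have p4 : 0 < 4 ^ bxs F by rewrite expn_gt0.
have valg g : g \in obs F -> val (dig L (teval (FBox g) t)) = teval (FBox g) t.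
  by move=> hg; apply: val_dig; apply: small => //; apply: hobs.
case Ech: (tch t) => [|c cs].
  apply: (@within_le (1 + (4 * size (encE e) + 1 + (Os * (7 * Es + 5 * L + 10) + 1 + (2 * size (encE e) + 1)))).+1).
    by apply: (@leq_trans Ps); [rewrite /Ps; lia|rewrite leq_pmulr].
  wcall; first by b1.
  apply: within_push; rewrite !StE; apply: (within_seq (genv_within _ _ _ _ _ he)); apply: (within_seq (Wo _ _ _ _)).
  apply: (@dead_within e L) => // p; rewrite ebx => /mapP [g hg ->].
  by rewrite -dig0 /= Ech.
pose C := Ps * 4 ^ bxs (obs F).
have bF := bxsE F.
apply: (@within_le (1 + (4 * size (encE e) + 1 + (Os * (7 * Es + 5 * L + 10) + 1 +
   (1 + (4 * size (encE e) + 2 + (size (obs F) * (4 * size (encE e) + 3 + C) + size (encE e) + 3)))))).+1).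
  apply: (@leq_trans (Ps + size (obs F) * (Ps + C))).
    have : size (obs F) * (4 * size (encE e) + 3 + C) <= size (obs F) * (Ps + C).
      by rewrite leq_mul2l leq_add2r /Ps; apply/orP; right; lia.
    by rewrite /Ps; lia.
  rewrite /C bF expnD; have h1 : 1 + 2 * size (obs F) <= 4 ^ size (obs F).
    by elim: (size (obs F)) => // q IHq; rewrite expnS; lia.
  have h2 : 0 < 4 ^ bxs (obs F) by rewrite expn_gt0.
  move: (4 ^ size (obs F)) (4 ^ bxs (obs F)) h1 h2 => x y.
  move: (size (obs F)) => q h1 h2.
  have -> : Ps + q * (Ps + Ps * y) = Ps * (1 + q + q * y).
    by move: Ps => P; rewrite !mulnDr muln1 mulnCA (mulnC q P) addnA.
  rewrite leq_mul2l; apply/orP; right.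
  apply: leq_trans (leq_mul h1 (leqnn y)); rewrite mulnDl mul1n.
  have : q <= q * y by rewrite leq_pmulr.
  by rewrite -mulnA; move: (q * y) => z; lia.
wcall; first by b2.
apply: within_push; rewrite !StE; apply: (within_seq (genv_within _ _ _ _ _ he)); apply: (within_seq (Wo _ _ _ _)).
apply: within_push; rewrite !StE; apply: (within_seq (cb_within true _ _ _ _ _ he)).
have -> : size (obs F) = size (bxE e) by rewrite ebx size_map.
apply: loop_within => // p O'; rewrite ebx => hp; have /mapP [g hg pE] := hp.
(* The successor visited for a box is a child at which its infimum is attained; different boxes may
   revisit the same child. *)
have [d hd dE] : exists2 d, List.In d (tch t) & teval (FBox g) t = teval g d.
  have : tinf [seq teval g x | x <- tch t] \in [seq teval g x | x <- tch t].
    by apply: tinf_mem; rewrite Ech.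
  by case/In_map_mem=> d hd dE; exists d.
case: (posnP (size (obs F))) => [z|pos]; first by move: hg; rewrite (size0nil z).
apply: (@IH (obs F) d) => //.
- by lia.
- by apply: leq_trans szn; apply: szF_flat; apply: szF_ob.
- exact: nodes_child ht hd.
- rewrite encO_cat size_cat -ebx ebx.
  have h1 := ges_size L t (obs F).
  have h2 : size (encO [:: (false, p.1, p.2)]) <= n * (L + 4).
    rewrite -[encO _]/(encO1 (false, p.1, p.2) ++ [::]) cats0 size_encO1 pE /= size_dig.
    have h3 : size (fenc g) <= n.
      apply: leq_trans szn; apply: leq_trans (szF_flat F szF_ob).
      rewrite -/(obs F); move: hg; clear; elim: (obs F) => //= f s IHs.
      rewrite -[szF _]/(size (fenc f) + szF s) in_cons => /orP[/eqP <-|/IHs h]; first exact: leq_addr.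
      by apply: leq_trans h _; rewrite leq_addl.
    by have := fenc_gt0 g; nia.
  have h4 : szF (obs F) <= n by apply: leq_trans szn; apply: szF_flat; apply: szF_ob.
  rewrite /Os; nia.
move=> o; rewrite mem_cat => /orP[/mapP [q /mapP [g' hg' ->] ->]|].
  split=> //=; first by rewrite size_dig.
  rewrite /satT /= valg //=; apply: tinf_le; apply/In_map_mem; by exists d.
rewrite inE => /eqP ->; rewrite pE /=; split=> //; first by rewrite size_dig.
by rewrite /satT /= valg // dE.
Qed.
End SatCost.

(** * Parsing the input and detecting malformed words *)

Definition inw (w : seq sym) : seq glyph := [seq LS s | s <- w].

(** Numbers in the input have no end marker and are read as far as bits go, so the rest of the input
    must not begin with a bit. *)
Definition nobit (r : seq glyph) : bool := if r is x :: _ then ~~ isbit x else true.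

Lemma inw_cat w1 w2 : inw (w1 ++ w2) = inw w1 ++ inw w2.
Proof. exact: map_cat. Qed.

Lemma nobit_enc f r : nobit (inw (enc f) ++ r).
Proof. by case: f. Qed.

Lemma parb_body y : isbit y -> body (PN ParB) (Some y) = [:: [:: call ParB; push KO y]].
Proof. by move=> /= ->. Qed.

Lemma bad0_body y : isbit y -> body (PN Bad0) (Some y) = [:: [::]].
Proof. by move=> /= ->. Qed.

Lemma parb_within bs r O E V A : all bit bs -> nobit r ->
  within (2 * size bs + 3) [:: call ParB] (St (inw bs ++ r) O E V A)
    (St r (inw bs ++ LM MEnd :: O) E V A).
Proof.
move=> hbs hr; elim: bs hbs => [|b bs IH] /= hbs.
  case: r hr => [|x r] /= hr; first by wempty; [b1|apply: within_push; rewrite !StE; apply: within_nil].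
  wpop; first by rewrite /= (negPf hr); b1.
  by do 2 (apply: within_push; rewrite !StE); apply: within_nil.
case/andP: hbs => hb /IH {}IH.
apply: (@within_le (2 * size bs + 3 + 1).+1); first by lia.
have ib : isbit (LS b) by case: (b) hb.
wpop; first by rewrite parb_body //; b1.
by apply: within_seq IH _; apply: within_push; rewrite !StE; apply: within_nil.
Qed.

Lemma par_within f : forall r O E V A, nobit r ->
  within (4 * size (enc f)) [:: call Par] (St (inw (enc f) ++ r) O E V A) (St r (fenc f ++ O) E V A).
Proof.
elim: f => [n|a IHa b IHb|a IHa b IHb|a IHa b IHb|a IHa b IHb||a IHa] r O E V A hr.
2-5: apply: (@within_le (4 * size (enc a) + (4 * size (enc b) + 1)).+1);
  [by rewrite /= size_cat; lia|].
2-5: rewrite [enc _]/= [inw _]/= inw_cat cat_cons -catA; wpop; [b1|].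
2-5: apply: (within_seq (IHa _ _ _ _ _ (nobit_enc _ _))); apply: (within_seq (IHb _ _ _ _ _ hr)).
2-5: by apply: within_push; rewrite !StE /= -catA; apply: within_nil.
- have sz : 0 < size (nat_bits n).
    by rewrite /nat_bits; case: (BinNat.N.of_nat n) => // p; apply: pos_bits_size.
  apply: (@within_le (2 * size (nat_bits n) + 3 + 1).+1); first by rewrite /=; lia.
  rewrite [enc _]/= [inw _]/= cat_cons; wpop; first by b1.
  apply: (within_seq (parb_within _ _ _ _ (nat_bits_bits n) hr)).
  by apply: within_push; rewrite !StE /= -catA; apply: within_nil.
- by rewrite [enc _]/= [inw _]/=; wpop; [b1|apply: within_push; rewrite !StE; apply: within_nil].
- apply: (@within_le (4 * size (enc a) + 1).+1); first by rewrite /=; lia.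
  rewrite [enc _]/= [inw _]/= cat_cons; wpop; first by b1.
  by apply: (within_seq (IHa _ _ _ _ _ hr)); apply: within_push; rewrite !StE; apply: within_nil.
Qed.

Lemma par_sound t f r O E V A s' : nobit r ->
  prun t [:: call Par] (St (inw (enc f) ++ r) O E V A) s' -> s' = St r (fenc f ++ O) E V A.
Proof. by move=> hr; apply: within_det (isT : det (PN Par)) (par_within f _ _ _ _ hr). Qed.

Lemma nat_bits_cases n : nat_bits n = [:: SBit0] \/ exists bs, nat_bits n = SBit1 :: bs.
Proof.
rewrite /nat_bits; case: (BinNat.N.of_nat n) => [|p]; first by left.
by right; apply: pos_bits_head.
Qed.

Lemma bad_sound f : forall t r O E V A s', nobit r ->
  ~ prun t [:: call Bad] (St (inw (enc f) ++ r) O E V A) s'.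
Proof.
have bin a b s t r O E V A s' : nobit r ->
  (forall t r O E V A s', nobit r -> ~ prun t [:: call Bad] (St (inw (enc a) ++ r) O E V A) s') ->
  (forall t r O E V A s', nobit r -> ~ prun t [:: call Bad] (St (inw (enc b) ++ r) O E V A) s') ->
  body (PN Bad) (Some (LS s)) = [:: [:: call Bad]; [:: call Par; call Bad]] ->
  ~ prun t [:: call Bad] (St (inw (s :: enc a ++ enc b) ++ r) O E V A) s'.
  move=> hr IHa IHb hb0 H; rewrite [inw _]/= inw_cat cat_cons -catA in H.
  have [t' [b' [e1 hb {}H]]] := run_popE (c := PN Bad) (k := KI) erefl (St_get _ _ _ _ _).1.1.1.1 H.
  rewrite hb0 in hb; simpl in hb; rewrite !StE in H; destruct hb as [<-|[<-|[]]].
    by apply: IHa H; apply: nobit_enc.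
  by rseq H H1; rewrite (par_sound (nobit_enc _ _) H1) in H; apply: IHb H.
elim: f => [n|a IHa b IHb|a IHa b IHb|a IHa b IHb|a IHa b IHb||a IHa] t r O E V A s' hr.
2-5: exact: bin.
- move=> H; rewrite [enc _]/= [inw _]/= cat_cons in H; rpop H.
  case: (nat_bits_cases n) => [e0|[bs e0]]; rewrite e0 [inw _]/= cat_cons in H; rpop H.
  case: r hr H => [|x r] /= hr H; first by rempty H.
  by rpop H; move: hb; rewrite (negPf hr).
- by move=> H; rewrite [enc _]/= [inw _]/= cat_cons in H; rpop H.
- by move=> H; rewrite [enc _]/= [inw _]/= cat_cons in H; rpop H; apply: IHa H.
Qed.

Lemma bits_split (w : seq sym) : exists bs r, [/\ w = bs ++ r, all bit bs & nobit (inw r)].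
Proof.
elim: w => [|s w [bs [r [-> h1 h2]]]]; first by exists [::], [::].
have [hs|hs] := boolP (bit s); first by exists (s :: bs), r; rewrite /= hs.
by exists [::], (s :: bs ++ r); split=> //=; case: (s) hs.
Qed.

(** For a variable the only errors are a missing number and a 0 followed by another bit, since any
    bits after a leading 1 are canonical. For a binary connective the error is in the first
    argument, or in the second after the first has been parsed. *)
Lemma parse_or_bad N : forall w, size w < N ->
  (exists f r, w = enc f ++ r /\ forall O E V A,
     within (4 * size (enc f)) [:: call Par] (St (inw w) O E V A) (St (inw r) (fenc f ++ O) E V A)) \/
  (forall O E V A, exists s', within (4 * size w + 4) [:: call Bad] (St (inw w) O E V A) s').
Proof.
elim: N => // N IH [|s w] hw.
  by right=> O E V A; eexists; wempty; [b1|apply: within_nil].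
have bin (c : form -> form -> form) : (forall a b, enc (c a b) = s :: enc a ++ enc b) ->
    (forall a b, fenc (c a b) = LS s :: fenc b ++ fenc a) ->
    body (PN Bad) (Some (LS s)) = [:: [:: call Bad]; [:: call Par; call Bad]] ->
    body (PN Par) (Some (LS s)) = [:: [:: call Par; call Par; push KO (LS s)]] ->
    (exists f r, s :: w = enc f ++ r /\ forall O E V A,
     within (4 * size (enc f)) [:: call Par] (St (inw (s :: w)) O E V A) (St (inw r) (fenc f ++ O) E V A)) \/
    (forall O E V A, exists s', within (4 * size (s :: w) + 4) [:: call Bad] (St (inw (s :: w)) O E V A) s').
  move=> e1 e2 hb hp; case: (IH w) => [//|[a [r [ew Wa]]]|Wb]; last first.
    right=> O E V A; have [s' W] := Wb O E V A; exists s'.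
    apply: (@within_le (4 * size w + 4).+1); first by rewrite /=; lia.
    by rewrite [inw _]/=; wpop; [rewrite hb; b1|].
  have szr : size w = size (enc a) + size r by rewrite ew size_cat.
  case: (IH r) => [|[b [r' [er Wb]]]|Wb]; first by move: hw; rewrite /= szr; lia.
    left; exists (c a b), r'; split; first by rewrite e1 ew er /= catA.
    move=> O E V A; apply: (@within_le (4 * size (enc a) + (4 * size (enc b) + 1)).+1).
      by rewrite e1 /= size_cat; lia.
    rewrite [inw _]/=; wpop; first by rewrite hp; b1.
    apply: (within_seq (Wa _ _ _ _)); apply: (within_seq (Wb _ _ _ _)).
    by apply: within_push; rewrite !StE e2 /= -catA; apply: within_nil.
  right=> O E V A; have [s' W] := Wb (fenc a ++ O) E V A; exists s'.
  apply: (@within_le (4 * size (enc a) + (4 * size r + 4)).+1); first by rewrite /= szr; lia.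
  rewrite [inw _]/=; wpop; first by rewrite hb; b2.
  by apply: (within_seq (Wa _ _ _ _)).
case: s hw bin => hw bin.
- have [bs [r [ew hbs hr]]] := bits_split w.
  have var n : nat_bits n = bs -> exists f r, SVar :: w = enc f ++ r /\ forall O E V A,
     within (4 * size (enc f)) [:: call Par] (St (inw (SVar :: w)) O E V A) (St (inw r) (fenc f ++ O) E V A).
    move=> en; exists (FVar n), r; split; first by rewrite /= en ew.
    move=> O E V A; have -> : inw (SVar :: w) = inw (enc (FVar n)) ++ inw r.
      by rewrite /= en ew inw_cat.
    exact: par_within.
  have bad k s1 O E V A : k <= 3 ->
      within k [:: call BadB] (St (inw w) O E V A) s1 ->
      exists s', within (4 * size (SVar :: w) + 4) [:: call Bad] (St (inw (SVar :: w)) O E V A) s'.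
    move=> hk W; exists s1; apply: (@within_le k.+1); first by rewrite /=; lia.
    by rewrite [inw _]/=; wpop; [b1|].
  case: bs ew hbs var => [|b0 bs] ew hbs var.
    right=> O E V A; case: r ew hr => [|x r] ew hr; rewrite ew in bad *.
      by apply: (@bad 1 (St [::] O E V A)) => //; wempty; [b1|apply: within_nil].
    apply: (@bad 1 (St (inw r) O E V A)) => //.
    rewrite [inw _]/=; wpop; last exact: within_nil.
    by case: x ew hr bad => //=; left.
  case: b0 ew hbs var => // ew /= hbs var; last by left; have [n hn] := canonical_bits hbs; apply: (var n).
  case: bs ew hbs var => [|b1' bs] ew hbs var; first by left; apply: (var 0).
  right=> O E V A; apply: (@bad 2 (St (inw (bs ++ r)) O E V A)) => //.
  rewrite ew [inw _]/=; wpop; first by b1.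
  have ib : isbit (LS b1') by case: (b1') hbs.
  by wpop; [rewrite bad0_body //; b1|apply: within_nil].
- by right=> O E V A; eexists; rewrite [inw _]/=; apply: (@within_le 1) => //; wpop; [b1|apply: within_nil].
- by right=> O E V A; eexists; rewrite [inw _]/=; apply: (@within_le 1) => //; wpop; [b1|apply: within_nil].
- exact: (bin FAnd).
- exact: (bin FOr).
- exact: (bin FAmp).
- exact: (bin FImp).
- left; exists FZero, w; split=> // O E V A.
  by rewrite [inw _]/=; wpop; [b1|apply: within_push; rewrite !StE; apply: (@within_nil 2)].
case: (IH w) => [//|[a [r [ew Wa]]]|Wb].
  left; exists (FBox a), r; split; first by rewrite /= ew.
  move=> O E V A; apply: (@within_le (4 * size (enc a) + 1).+1); first by rewrite /=; lia.
  rewrite [inw _]/=; wpop; first by b1.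
  by apply: (within_seq (Wa _ _ _ _)); apply: within_push; rewrite !StE; apply: within_nil.
right=> O E V A; have [s' W] := Wb O E V A; exists s'.
apply: (@within_le (4 * size w + 4).+1); first by rewrite /=; lia.
by rewrite [inw _]/=; wpop; [b1|].
Qed.

(** * The whole program: correctness and running time *)

Lemma goal_encO f L O : encO [:: (false, f, Some false :: nseq L None)] ++ LM MHash :: O =
  LM MLe :: fenc f ++ LM MCol :: LD (Some false) :: nseq L (LD None) ++ LM MDot :: LM MHash :: O.
Proof. by rewrite encO_cons /= /dg map_nseq. Qed.

Lemma sat_sound t os I O E V A s' :
  prun t [:: call Sat] (St I (encO os ++ LM MHash :: O) E V A) s' ->
  exists T : wtree int, forall o, o \in os -> satT T o.
Proof.
move=> H; have [h _] := @sat_loop_sound t.+1 t (ltnSn t).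
by have [] := h MHash _ _ _ _ _ _ _ (or_introl erefl) H.
Qed.

Lemma main_sound t w s' : prun t [:: call Main] (St (inw w) [::] [::] [::] [::]) s' -> ~ KA_VALID w.
Proof.
move=> H [phi [ew val]]; subst w; rewrite -[inw _]cats0 in H.
rcall H; destruct hb as [<-|[<-|[<-|[]]]].
- exact: (bad_sound (r := [::]) isT H).
- by rseq H H1; have es := par_sound (r := [::]) isT H1; subst s; rempty H.
rstep H; rseq H H1; have [n es] := (gz_sound _ _ _ _ _ _ _).2 H1; subst s; rstep H.
rseq H H2; have es := par_sound (r := [::]) isT H2; subst s.
rseq H H3; rempty H3; subst s; rstep H; rewrite -goal_encO in H.
have [T hT] := sat_sound H.
have := hT _ (mem_head _ _); rewrite /satT /= val_nseq0 => hle.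
by apply: (@refutation_of_tree phi T) val; lia.
Qed.

Lemma enc_gt0 f : 0 < size (enc f). Proof. by case: f. Qed.

Lemma boxes_le f : boxes f <= size (enc f).
Proof. by elim: f => //= *; rewrite ?size_cat; lia. Qed.

Lemma size_subf f : size (subf f) <= size (enc f).
Proof. by elim: f => //= *; rewrite ?size_cat; lia. Qed.

Lemma size_fenc f : size (fenc f) <= 2 * size (enc f).
Proof.
by elim: f => //= *; rewrite ?size_cat ?size_map /=; lia.
Qed.

(** [k * 3 ^ k <= k * 4 ^ k < 2 ^ k * 4 ^ k = 8 ^ k]. *)
Lemma bnd_lt k : bnd k < 2 ^ (3 * k).
Proof.
rewrite /bnd mulnC expnM; apply: (@leq_ltn_trans (4 ^ k * k)).
  by rewrite leq_mul2r; case: k => // k; rewrite leq_exp2r.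
by rewrite (_ : 2 ^ 3 = 4 * 2) // expnMn ltn_pmul2l ?expn_gt0 // ltn_expl.
Qed.

(** Measured in [Y = 4 ^ n * 2 ^ n], which dominates [n], [4 ^ b] and the number of values, [L] is
    linear, [Es] and [Os] are quadratic and [Ps] is of degree 4; the number of worlds contributes
    the fifth factor. *)
Lemma log_bound (n f b s L Es Os Ps : nat) : 1 < n -> b <= n -> s <= n -> f <= 2 * n ->
  L = 3 * (4 ^ b * s).+1 -> Es = f * (L + 3) -> Os = 2 * f * (L + 4) ->
  Ps = 20 * Es + Os * (7 * Es + 5 * L + 10) + 20 ->
  Ps * 4 ^ b + 2 * L + 4 * n + 10 <= 2 ^ 12 * (8 ^ n) ^ 5.
Proof.
move=> n1 hb hs hf eL eE eO eP; set Y := 8 ^ n.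
have hn : n < 2 ^ n by apply: ltn_expl.
have h4 : 4 ^ b <= 4 ^ n by rewrite leq_exp2l.
have Y8 : 8 <= Y by rewrite -{1}[8]expn1 leq_exp2l // ltnW.
have YE : Y = 4 ^ n * 2 ^ n by rewrite -expnMn.
have n4 : 0 < 4 ^ n by rewrite expn_gt0.
have hY : (4 ^ b * s).+1 <= Y.
  apply: (@leq_trans (4 ^ n * n.+1)); last by rewrite YE leq_mul2l hn orbT.
  have : 4 ^ b * s <= 4 ^ n * n by apply: leq_mul.
  by rewrite mulnS; move: (4 ^ b * s) (4 ^ n * n) => u v; lia.
have nY : n <= Y by rewrite YE; apply: leq_trans (ltnW hn) _; rewrite leq_pmull.
have bY : 4 ^ b <= Y by apply: leq_trans h4 _; rewrite YE leq_pmulr // expn_gt0.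
have hL : L <= 3 * Y by rewrite eL; lia.
have hE : Es <= 12 * (Y * Y).
  apply: (@leq_trans (2 * Y * (6 * Y))); last by rewrite mulnACA.
  by rewrite eE; apply: leq_mul; lia.
have hO : Os <= 28 * (Y * Y).
  apply: (@leq_trans (4 * Y * (7 * Y))); last by rewrite mulnACA.
  by rewrite eO; apply: leq_mul; lia.
have Y2 : 8 * Y <= Y * Y by rewrite leq_mul2r Y8 orbT.
have hX : 7 * Es + 5 * L + 10 <= 90 * (Y * Y) by lia.
have hP : Ps <= 2800 * (Y * Y * (Y * Y)).
  have h1 : Os * (7 * Es + 5 * L + 10) <= 28 * (Y * Y) * (90 * (Y * Y)) by apply: leq_mul.
  have h2 : Y * Y * (8 * 8) <= Y * Y * (Y * Y) by rewrite leq_mul2l (leq_mul Y8 Y8) orbT.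
  have h3 : 28 * (Y * Y) * (90 * (Y * Y)) = 2520 * (Y * Y * (Y * Y)) by rewrite mulnACA.
  move: h1 h2 Y2; rewrite h3 eP; move: (Os * _) (Y * Y * (Y * Y)) (Y * Y) hE => u v z; lia.
apply: (@leq_trans (2800 * (Y * Y * (Y * Y)) * Y + 2 * L + 4 * n + 10)).
  by rewrite !leq_add2r; apply: leq_mul.
have h5 : Y <= Y * Y * (Y * Y) * Y by rewrite leq_pmull // !muln_gt0 expn_gt0.
have -> : Y ^ 5 = Y * Y * (Y * Y) * Y by rewrite !expnS expn0 muln1 -!mulnA.
rewrite -mulnA; move: (Y * Y * (Y * Y) * Y) h5 => Z h5.
by rewrite (_ : 2 ^ 12 = 4096) //; lia.
Qed.

Lemma main_within w : 1 < size w -> ~ KA_VALID w ->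
  exists s', within (2 ^ 12 * (8 ^ size w) ^ 5) [:: call Main] (St (inw w) [::] [::] [::] [::]) s'.
Proof.
move=> w1 nval.
have big : 4 * size w + 10 <= 2 ^ 12 * (8 ^ size w) ^ 5.
  apply: leq_trans (@log_bound (size w) 0 0 0 _ _ _ _ w1 _ _ _ erefl erefl erefl erefl) => //.
  by rewrite -addnA leq_addl.
case: (@parse_or_bad (size w).+1 w (ltnSn _)) => [[f [r [ew W]]]|W]; last first.
  have [s' hW] := W [::] [::] [::] [::]; exists s'.
  by apply: within_le big _; apply: (@within_le (4 * size w + 4).+1); [lia|wcall; [b1|exact: hW]].
case: r ew W => [|x r] ew W; last first.
  exists (St (inw r) (fenc f) [::] [::] [::]).
  apply: within_le big _; apply: (@within_le (4 * size (enc f) + 1).+1); first by rewrite ew size_cat /=; lia.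
  wcall; first by b2.
  apply: (within_seq (W _ _ _ _)); rewrite cats0 [inw _]/=.
  by wpop; [b1|apply: within_nil].
rewrite cats0 in ew.
have nvf : ~ KA_valid f by move=> vf; apply: nval; exists f.
have [T [neg hb]] := refuting_tree nvf.
set k := (4 ^ boxes f * size (subf f)).+1 in hb.
(* Numbers get [L.+1] digits because -1 is written as one digit -1 followed by [L] zeros. *)
have [L LE] : exists L, L.+1 = 3 * k by exists (3 * k).-1.
have small s g : List.In s (nodes T) -> g \in subf f -> absz (teval g s) < 2 ^ L.+1.
  move=> hs hg; rewrite LE; apply: leq_ltn_trans (bnd_lt k); have := hb s g hs hg; lia.
exists (St [::] [::] [::] [::] [::]).
have hw := size_fenc f; rewrite -ew in hw.
have hb1 : boxes f <= size w by rewrite ew boxes_le.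
have hb2 : size (subf f) <= size w by rewrite ew size_subf.
have hbound := @log_bound _ _ _ _ L.+1 _ _ _ w1 hb1 hb2 hw LE erefl erefl erefl.
apply: within_le hbound _; clear LE hb k.
have Wsat := @sat_within f T L.+1 small (bxs [:: f]).+1 [:: f] T
  [:: (false, f, Some false :: nseq L None)] [::] [::] [::] [::] [::] (ltnSn _).
rewrite {1}(_ : bxs [:: f] = boxes f) in Wsat; last by rewrite /bxs /= addn0.
have szd : size (Some false :: nseq L None : seq digit3) = L.+1 by rewrite /= size_nseq.
have {Wsat} := Wsat _ _ (nodes_refl T) _ _.
move: (_ * 4 ^ boxes f) => Cs Wsat.
have {}Wsat : within Cs [:: call Sat]
    (St [::] (encO [:: (false, f, Some false :: nseq L None)] ++ LM MHash :: [::]) [::] [::] [::])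
    (St [::] [::] [::] [::] [::]).
  apply: Wsat.
  - by move=> g; rewrite inE => /eqP ->; apply: subf_refl.
  - by rewrite /szF /= addn0.
  - rewrite -[encO _]/(encO1 (false, f, Some false :: nseq L None) ++ [::]) cats0 size_encO1.
    by rewrite [size _.2]szd [X in _ <= 2 * X * _]/=; have := fenc_gt0 f; rewrite /=; nia.
  - move=> o; rewrite inE => /eqP ->; split; [exact: mem_head|exact: szd|].
    by rewrite /satT /= val_nseq0; lia.
apply: (@within_le (1 + (1 + (2 * L + 1 + (1 + (1 + (4 * size (enc f) + (1 + (1 + Cs)))))))).+1).
  by rewrite ew; lia.
wcall; first by b3.
do 2 (apply: within_push; rewrite !StE).
apply: (within_seq (gz_within _ _ _ _ _ L).2).
do 2 (apply: within_push; rewrite !StE).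
rewrite ew -[inw _]cats0.
apply: (within_seq (par_within f _ _ _ _ (isT : nobit [::]))).
apply: within_seq; first by wempty; [b1|apply: within_nil].
apply: within_push; rewrite !StE.
by move: Wsat; rewrite goal_encO.
Qed.

Lemma inst_St w : inst KI (fun s : sym => LS s : glyph) w = St (inw w) [::] [::] [::] [::].
Proof. by apply/ffunP; case; rewrite !ffunE. Qed.

(** [SZero] is the only encoding of length 1, and the constant is valid. *)
Lemma singleton_valid a : ~ KA_VALID [:: a] <-> (LS a != LS SZero :> glyph).
Proof.
have v0 : KA_valid FZero by move=> W Rel V r _ _ x; rewrite /= lexx.
split=> [h|h [phi [e _]]].
  by apply/eqP => -[ea]; apply: h; exists FZero; rewrite ea.
move: h; case: phi e => //= [n [_]|a' b [_]|a' b [_]|a' b [_]|a' b [_]|[->]|a' [_]]; rewrite ?eqxx //.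
- by case: (nat_bits_cases n) => [->|[bs ->]].
all: by move/(congr1 size); rewrite ?size_cat /=; have := enc_gt0 a'; lia.
Qed.

Theorem theorem3p8 : in_coNEXPTIME KA_VALID.
Proof.
have [b0 hb0] : exists b0, forall n, 1 < n -> 2 ^ 12 * (8 ^ n) ^ 5 < b0.+1 ^ n.
  (* In exponents of 2 the requirement reads [12 + 15 * n < 28 * n]. *)
  exists (2 ^ 28).-1 => n n1; rewrite prednK ?expn_gt0 //.
  rewrite -[8]/(2 ^ 3) -!expnM -expnD ltn_exp2l //; lia.
apply: (@stack_program_NEXPTIME sym kind glyph proc rdp body 10 b0 body_size isT KI
  (fun s => LS s) (PN Main) (fun x => x != LS SZero)).
(* The empty word encodes no formula, so it belongs to the complement. *)
- by case=> phi [e _]; have := enc_gt0 phi; rewrite -e.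
- exact: singleton_valid.
- move=> w w1 nval; have [s' [t ht hr]] := main_within w1 nval.
  exists t; first exact: leq_ltn_trans ht (hb0 _ w1).
  by exists s'; rewrite inst_St.
- by move=> w t w1 [s']; rewrite inst_St; apply: main_sound.
Qed.
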